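(* For every integer $n\geq 1$ there is a nonnegative integer $k_n$ and a homotopy equivalence $\mathbb T_n\simeq \bigvee_{i=1}^{k_n} S^{n-1}$.
   Context: Fix the unit square $[0,1]^2$. A tiling is a decomposition of the square into finitely many closed axis-parallel rectangles with disjoint interiors. $\mathbb T_n$ denotes the topological space of all tilings of the unit square by at most $n$ rectangles, topologized via the Hausdorff metric applied to the $1$-skeleta of the tilings (the union of the boundaries of the tiles, including the boundary of the square). *)

(* Defs.v *)
From HB Require Import structures.
From mathcomp Require Import all_boot all_order all_algebra.
From mathcomp Require Import all_classical all_reals all_analysis.
From mathcomp Require Import homotopy.
Unset Printing Implicit Defensive.
Import Order.TTheory GRing.Theory Num.Theory.
Import numFieldNormedType.Exports.
Local Open Scope classical_set_scope.
Local Open Scope ring_scope.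

Section Tilings.
Variable R : realType.

Definition pdist (p q : R * R) : R :=
  Num.sqrt ((p.1 - q.1) ^+ 2 + (p.2 - q.2) ^+ 2).

Definition hausdorff_dist (A B : set (R * R)) : R :=
  Num.max (sup [set inf [set pdist p q | q in B] | p in A])
          (sup [set inf [set pdist p q | p in A] | q in B]).

Record rect := Rect { rx0 : R; rx1 : R; ry0 : R; ry1 : R }.

Definition nondegenerate (r : rect) := rx0 r < rx1 r /\ ry0 r < ry1 r.

Definition closed_rect (r : rect) : set (R * R) :=
  [set p | rx0 r <= p.1 <= rx1 r /\ ry0 r <= p.2 <= ry1 r].

Definition open_rect (r : rect) : set (R * R) :=
  [set p | rx0 r < p.1 < rx1 r /\ ry0 r < p.2 < ry1 r].

Definition rect_boundary (r : rect) : set (R * R) :=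
  closed_rect r `\` open_rect r.

Definition unit_square : rect := Rect 0 1 0 1.

Definition is_tiling (N : nat) (t : 'I_N -> rect) : Prop :=
  [/\ forall i, nondegenerate (t i),
      forall i j, i != j -> open_rect (t i) `&` open_rect (t j) = set0
    & \bigcup_(i in [set: 'I_N]) closed_rect (t i) = closed_rect unit_square].

Definition skeleton (N : nat) (t : 'I_N -> rect) : set (R * R) :=
  rect_boundary unit_square `|` \bigcup_(i in [set: 'I_N]) rect_boundary (t i).

(** 1-skeleta of tilings by at most n rectangles.  A tiling is determined by
    its 1-skeleton, so we represent the points of T_n by their skeleta. *)
Definition is_skeleton_le (n : nat) (K : set (R * R)) : Prop :=
  exists N (t : 'I_N -> rect), (N <= n)%N /\ is_tiling N t /\ K = skeleton N t.

Definition tiling_space (n : nat) := {K : set (R * R) | is_skeleton_le n K}.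

HB.instance Definition _ n := gen_eqMixin (tiling_space n).
HB.instance Definition _ n := gen_choiceMixin (tiling_space n).

Definition hausdorff_open (n : nat) (U : set (tiling_space n)) : Prop :=
  forall x, U x -> exists2 e : R, 0 < e &
    forall y, hausdorff_dist (sval x) (sval y) < e -> U y.

Lemma hausdorff_openT n : hausdorff_open n [set: tiling_space n].
Proof. by move=> x _; exists 1. Qed.

Lemma hausdorff_openI n : setI_closed (hausdorff_open n).
Proof.
move=> A B oA oB x [Ax Bx].
have [e1 e1p H1] := oA x Ax; have [e2 e2p H2] := oB x Bx.
exists (Num.min e1 e2); first by rewrite lt_min e1p e2p.
by move=> y; rewrite lt_min => /andP[y1 y2]; split; [exact: H1|exact: H2].
Qed.

Lemma hausdorff_open_bigU n (I : Type) (f : I -> set (tiling_space n)) :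
  (forall i, hausdorff_open n (f i)) -> hausdorff_open n (\bigcup_i f i).
Proof.
move=> hf x [i _ fx]; have [e ep H] := hf i x fx.
by exists e => // y /H fy; exists i.
Qed.

HB.instance Definition _ n := isOpenTopological.Build (tiling_space n)
  (hausdorff_openT n) (hausdorff_openI n) (hausdorff_open_bigU n).

Definition sphere (m : nat) : set 'rV[R]_m.+1 :=
  [set v | \sum_(i < m.+1) v ord0 i ^+ 2 = 1].

Definition sphere_space (m : nat) : topologicalType := set_type (sphere m).

Lemma sphere_base_proof m :
  sphere m (\row_(i < m.+1) (if i == ord0 then 1 else 0)).
Proof.
rewrite /sphere /= big_ord_recl mxE eqxx expr1n big1 ?addr0 // => i _.
by rewrite mxE /= expr0n.
Qed.

Definition sphere_base m : sphere_space m :=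
  @exist _ (fun v => v \in sphere m) _ (mem_set (sphere_base_proof m)).

(** A one-point space (used so that the wedge of zero spheres is a point). *)
Definition point_space : topologicalType := discrete_topology unit.

(** Wedge of k copies of S^m: the library wedge (quotient of the disjoint sum
    by the base points) of the family indexed by option 'I_k, where index None
    is a single point and index Some i is the i-th copy of S^m. *)
Definition wedge_family (m k : nat) (o : option 'I_k) : topologicalType :=
  match o with None => point_space | Some _ => sphere_space m end.

Definition wedge_base (m k : nat) (o : option 'I_k) : wedge_family m k o :=
  match o return wedge_family m k o with
  | None => (tt : point_space) | Some _ => sphere_base m end.

Definition wedge_of_spheres (m k : nat) : topologicalType :=
  wedge (wedge_base m k).

End Tilings.

Definition homotopic (R : realType) (X Y : topologicalType) (f g : X -> Y) :=
  exists H : X * R -> Y,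
    [/\ {within [set p : X * R | 0 <= p.2 <= 1], continuous H},
        forall x, H (x, 0) = f x
      & forall x, H (x, 1) = g x].

Definition homotopy_equivalent (R : realType) (X Y : topologicalType) :=
  exists (f : X -> Y) (g : Y -> X),
    [/\ continuous f, continuous g,
        homotopic R X X (g \o f) idfun & homotopic R Y Y (f \o g) idfun].

(* Main.v *)
Require Import Defs.
From HB Require Import structures.
From mathcomp Require Import all_boot all_order all_algebra.
From mathcomp Require Import all_classical all_reals all_analysis.
From mathcomp Require Import homotopy zify ring lra.
Set Implicit Arguments.
Unset Strict Implicit.
Unset Printing Implicit Defensive.
Import Order.TTheory GRing.Theory Num.Theory numFieldNormedType.Exports.
Local Open Scope classical_set_scope.
Local Open Scope ring_scope.

(* A tiling with m + 1 rectangles is obtained from the trivial one by m operations,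
   each depending on one parameter in (0, 1): peeling rectangles off at the right
   side recovers the operations. The sequences of operations (codes) index a
   decomposition of the space of tilings into open cubes, and each characteristic
   map extends to the closed cube by admitting degenerate rectangles. The boundary
   of a cell lies in cells of smaller dimension or of the same dimension and
   smaller rank.

   Let Sigma be the operation that squeezes the whole tiling and adds a rectangle of
   full height at the right. Matching c with Sigma c, alternately along the powers
   of Sigma, leaves unmatched only the trivial tiling and some cells of top
   dimension. For a matched pair (c, Sigma c), all faces of the cell of Sigma c that
   are mapped onto that of c, except one, cancel in groups of adjacent faces. Hence
   the pair can be removed by a deformation; removing all pairs in decreasing order
   of dimension and rank contracts the matched part to a point.

   The centres of the unmatched top cells can be chosen off all cell boundaries, by
   counting distinct coordinates. Away from small cubes round these centres the
   space deforms into the matched part, so the space is a contractible one with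
   disjoint top-dimensional cubes attached, that is, a wedge of spheres. *)

(** The cells do not form a CW complex: when the left end of a strip comes level with a neighbour,
    no rectangle disappears, so the boundary of a cell can run through open cells of its own
    dimension. The rank excludes cycles among these. A rectangle added by [Sigma] degenerates at
    parameter 1, so the cell of [Sigma :: c] covers that of [c] once for each of its leading
    [Sigma]s, with alternating orientations. Only an odd number of faces can cancel down to one,
    which is why the matching alternates along the powers of [Sigma]. For a pure power there is one
    more face, where the original rectangle is squeezed to nothing, and the parity is reversed. An
    incidence number 1 would only settle homology. Here two adjacent faces are folded along their
    common edge onto one cube, and the fold is pushed off the small cell by an explicit homotopy.
    All homotopies are glued from finitely many closed pieces, each the image of a compact set, so
    their continuity reduces to that of formulas on cubes. *)

(** * Continuity on closed sets *)

Section ClosedContinuity.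
Implicit Types X Y Z : topologicalType.

(* Continuity on a closed set, phrased so that pasting along finite closed
   covers and descent along maps with compact domain are set identities. *)
Definition clc {X Y} (A : set X) (f : X -> Y) :=
  forall C, closed C -> closed (A `&` f @^-1` C).

Lemma clcP X Y (A : set X) (f : X -> Y) :
  closed A -> clc A f <-> {within A, continuous f}.
Proof.
move=> cA; rewrite continuous_closedP; split=> H C cC.
  have := H C cC; move=> cAC.
  apply/closed_subspaceP; exists (A `&` f @^-1` C) => //.
  by rewrite -setIA [X in _ `&` X]setIC setIA setIid setIC.
have /closed_subspaceP [V cV VE] := H C cC.
by rewrite setIC -VE; apply: closedI.
Qed.

Lemma continuous_clc X Y (A : set X) (f : X -> Y) :
  closed A -> continuous f -> clc A f.
Proof. by move=> cA /continuous_closedP cf C cC; apply: closedI => //; exact: cf. Qed.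

Lemma clc_eq X Y (A : set X) (f g : X -> Y) :
  clc A f -> (forall x, A x -> f x = g x) -> clc A g.
Proof.
move=> cf fg C cC; rewrite (_ : _ `&` _ = A `&` f @^-1` C); first exact: cf.
by apply/seteqP; split=> x [Ax] /=; rewrite fg.
Qed.

Lemma clc_sub X Y (A B : set X) (f : X -> Y) :
  closed B -> B `<=` A -> clc A f -> clc B f.
Proof.
move=> cB sBA cf C cC; rewrite (_ : _ `&` _ = B `&` (A `&` f @^-1` C)).
  by apply: closedI => //; exact: cf.
by apply/seteqP; split=> x; [move=> [Bx ?]; split=> //; split=> //; exact: sBA|
  move=> [? [? ?]]].
Qed.

Lemma clc_closed X Y (A : set X) (f : X -> Y) : clc A f -> closed A.
Proof. by move=> /(_ setT closedT); rewrite preimage_setT setIT. Qed.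

Lemma clc_comp X Y Z (A : set X) (B : set Y) (f : X -> Y) (g : Y -> Z) :
  clc A f -> clc B g -> (forall x, A x -> B (f x)) -> clc A (g \o f).
Proof.
move=> cf cg fAB C cC.
rewrite (_ : _ `&` _ = A `&` f @^-1` (B `&` g @^-1` C)).
  by apply: cf; apply: cg.
by apply/seteqP; split=> x; [move=> [Ax ?]; split=> //; split=> //; exact: fAB|
  move=> [? [? ?]]].
Qed.

Lemma clcU X Y (A B : set X) (f : X -> Y) : clc A f -> clc B f -> clc (A `|` B) f.
Proof. by move=> cA cB C cC; rewrite setIUl; apply: closedU; [exact: cA|exact: cB]. Qed.

Lemma clc_pair X Y Z (A : set X) (f : X -> Y) (g : X -> Z) :
  clc A f -> clc A g -> clc A (fun x => (f x, g x)).
Proof.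
move=> cf cg; have cA := clc_closed cf.
apply/clcP => // x; apply: cvg_pair; first exact: (proj1 (clcP f cA) cf).
exact: (proj1 (clcP g cA) cg).
Qed.

Lemma continuous_pair X Y Z (f : X -> Y) (g : X -> Z) :
  continuous f -> continuous g -> continuous (fun x => (f x, g x)).
Proof. by move=> cf cg x; apply: cvg_pair; [exact: cf|exact: cg]. Qed.

Lemma clc_compact X Y (A : set X) (f : X -> Y) :
  clc A f -> compact A -> compact (f @` A).
Proof. by move=> cf kA; apply: continuous_compact => //; apply/clcP => //; exact: clc_closed cf. Qed.

(** The trace of the preimage of a closed set on the image of [q] is the [q]-image of a compact set,
    hence closed, as [Y] is Hausdorff. This plays the role of the universal property of a quotient:
    maps on a cell are checked on its cube. *)
Lemma clc_descend X Y Z (K : set X) (q : X -> Y) (f : Y -> Z) :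
  hausdorff_space Y -> compact K -> clc K q -> clc K (f \o q) -> clc (q @` K) f.
Proof.
move=> hY kK cq cfq C cC.
rewrite (_ : _ `&` _ = q @` (K `&` (f \o q) @^-1` C)).
  apply: compact_closed => //; apply: clc_compact.
    by apply: clc_sub cq; [exact: cfq|exact: subIsetl].
  by apply: subclosed_compact kK _; [exact: cfq|exact: subIsetl].
apply/seteqP; split=> y.
  by move=> [[x Kx <-] Cx]; exists x.
by move=> [x [Kx Cx] <-]; split=> //; exists x.
Qed.

Lemma closed_setX X Y (A : set X) (B : set Y) : closed A -> closed B -> closed (A `*` B).
Proof.
move=> cA cB; rewrite (_ : A `*` B = fst @^-1` A `&` snd @^-1` B) //.
apply: closedI; apply: closed_comp => // x _; [exact: cvg_fst|exact: cvg_snd].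
Qed.

Lemma continuous_const X Y (c : Y) : continuous (fun _ : X => c).
Proof. by move=> x; exact: cvg_cst. Qed.

Lemma continuous_identity X : continuous (fun x : X => x).
Proof. by move=> x; exact: cvg_id. Qed.

Lemma continuous_fst X Y : continuous (fun p : X * Y => p.1).
Proof. by move=> x; exact: cvg_fst. Qed.

Lemma continuous_snd X Y : continuous (fun p : X * Y => p.2).
Proof. by move=> x; exact: cvg_snd. Qed.

Lemma continuous_comp2 X Y Z (f : X -> Y) (g : Y -> Z) :
  continuous f -> continuous g -> continuous (g \o f).
Proof. by move=> cf cg x; apply: continuous_comp; [exact: cf|exact: cg]. Qed.

Lemma hausdorff_prod X Y : hausdorff_space X -> hausdorff_space Y ->
  hausdorff_space (X * Y)%type.
Proof.
move=> hX hY [a b] [c d] cl; congr pair.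
  apply: hX => A B nA nB.
  have nA' : nbhs (a, b) (fst @^-1` A) by exact: (@cvg_fst _ _ (nbhs a) (nbhs b) _ _ nA).
  have nB' : nbhs (c, d) (fst @^-1` B) by exact: (@cvg_fst _ _ (nbhs c) (nbhs d) _ _ nB).
  by have [[x y] [/= ? ?]] := cl _ _ nA' nB'; exists x.
apply: hY => A B nA nB.
have nA' : nbhs (a, b) (snd @^-1` A) by exact: (@cvg_snd _ _ (nbhs a) (nbhs b) _ _ nA).
have nB' : nbhs (c, d) (snd @^-1` B) by exact: (@cvg_snd _ _ (nbhs c) (nbhs d) _ _ nB).
by have [[x y] [/= ? ?]] := cl _ _ nA' nB'; exists y.
Qed.

Lemma hausdorff_inj X Y (g : X -> Y) : continuous g -> injective g ->
  hausdorff_space Y -> hausdorff_space X.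
Proof.
move=> cg ig hY p q cl; apply/ig/hY => A B nA nB.
have nA' : nbhs p (g @^-1` A) by exact: cg.
have nB' : nbhs q (g @^-1` B) by exact: cg.
by have [z [? ?]] := cl _ _ nA' nB'; exists (g z).
Qed.

Lemma clcT_continuous X Y (f : X -> Y) : clc setT f -> continuous f.
Proof. by move=> h; apply/continuous_closedP => C cC; have := h C cC; rewrite setTI. Qed.

End ClosedContinuity.

(** * Homotopies and deformations of subsets *)

Section Homotopies.
Variable R : realType.
Implicit Types X Y Z : topologicalType.

Definition unit_itv : set R := [set t | 0 <= t <= 1].

Lemma unit_itvE : unit_itv = `[0, 1]%classic.
Proof. by apply/seteqP; split=> t; rewrite /unit_itv /= in_itv. Qed.

Lemma unit_itv_compact : compact unit_itv.
Proof. by rewrite unit_itvE; exact: segment_compact. Qed.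

Lemma unit_itv_closed : closed unit_itv.
Proof. by rewrite unit_itvE; exact: interval_closed. Qed.

Lemma unit_itv0 : unit_itv 0. Proof. by rewrite /unit_itv /= lexx ler01. Qed.
Lemma unit_itv1 : unit_itv 1. Proof. by rewrite /unit_itv /= lexx ler01. Qed.

Lemma continuous_add X (f g : X -> R) : continuous f -> continuous g ->
  continuous (fun x => f x + g x).
Proof. by move=> cf cg x; apply: (@cvgD R R^o); [exact: cf|exact: cg]. Qed.

Lemma continuous_sub X (f g : X -> R) : continuous f -> continuous g ->
  continuous (fun x => f x - g x).
Proof. by move=> cf cg x; apply: (@cvgB R R^o); [exact: cf|exact: cg]. Qed.

Lemma continuous_mul X (f g : X -> R) : continuous f -> continuous g ->
  continuous (fun x => f x * g x).
Proof. by move=> cf cg x; apply: (@cvgM R); [exact: cf|exact: cg]. Qed.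

Lemma continuous_div X (f g : X -> R) : continuous f -> continuous g ->
  (forall x, g x != 0) -> continuous (fun x => f x / g x).
Proof. by move=> cf cg g0 x; apply: (@cvgM R); [exact: cf|apply: (@cvgV R) => //; exact: cg]. Qed.

Lemma continuous_abs X (f : X -> R) : continuous f -> continuous (fun x => `|f x|).
Proof. by move=> cf x; apply: (@cvg_norm R R^o); exact: cf. Qed.

Lemma continuous_maximum X (f g : X -> R) : continuous f -> continuous g ->
  continuous (fun x => Num.max (f x) (g x)).
Proof. by move=> cf cg x; apply: continuous_max; [exact: cf|exact: cg]. Qed.

Lemma continuous_minimum X (f g : X -> R) : continuous f -> continuous g ->
  continuous (fun x => Num.min (f x) (g x)).
Proof. by move=> cf cg x; apply: continuous_min; [exact: cf|exact: cg]. Qed.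

Lemma concat_homotopy X Y (A : set X) (F G : X * R -> Y) : closed A ->
  clc (A `*` unit_itv) F -> clc (A `*` unit_itv) G ->
  (forall x, A x -> F (x, 1) = G (x, 0)) ->
  clc (A `*` unit_itv)
    (fun p => if p.2 <= 2^-1 then F (p.1, 2 * p.2) else G (p.1, 2 * p.2 - 1)).
Proof.
move=> cA cF cG FG.
set H := fun p => _.
have c2 : continuous (fun p : X * R => 2 * p.2).
  by apply: continuous_mul => p; [exact: cvg_cst|exact: cvg_snd].
have c1 : continuous (fun p : X * R => p.1) by move=> p; exact: cvg_fst.
have c3 : continuous (fun p : X * R => p.2) by move=> p; exact: cvg_snd.
pose I1 := [set t : R | 0 <= t <= 2^-1]; pose I2 := [set t : R | 2^-1 <= t <= 1].
have cI1 : closed I1.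
  rewrite (_ : I1 = `[0, 2^-1]%classic); first exact: interval_closed.
  by apply/seteqP; split=> t; rewrite /I1 /= in_itv.
have cI2 : closed I2.
  rewrite (_ : I2 = `[2^-1, 1]%classic); first exact: interval_closed.
  by apply/seteqP; split=> t; rewrite /I2 /= in_itv.
rewrite (_ : A `*` unit_itv = A `*` I1 `|` A `*` I2); last first.
  apply/seteqP; split=> -[x t] /=; rewrite /unit_itv /I1 /I2 /=.
    by move=> [Ax /andP[t0 t1]]; case: (lerP t 2^-1) => h; [left|right]; split=> //; lra.
  by move=> [] [Ax /andP[t0 t1]]; split=> //; lra.
apply: clcU.
  apply: (@clc_eq _ _ _ (F \o (fun p => (p.1, 2 * p.2)))).
    apply: clc_comp cF _; last first.
      by move=> [x t] /= [Ax]; rewrite /I1 /unit_itv /= => h; split=> //; lra.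
    apply: continuous_clc; first exact: closed_setX.
    exact: continuous_pair.
  by move=> [x t] /= [Ax /andP[t0 t1]]; rewrite /H /= t1.
apply: (@clc_eq _ _ _ (G \o (fun p => (p.1, 2 * p.2 - 1)))).
  apply: clc_comp cG _; last first.
    by move=> [x t] /= [Ax]; rewrite /I2 /unit_itv /= => h; split=> //; lra.
  apply: continuous_clc; first exact: closed_setX.
  apply: continuous_pair => //; apply: continuous_sub => // p; exact: cvg_cst.
move=> [x t] /= [Ax /andP[t0 t1]]; rewrite /H /=; case: lerP => // h.
have -> : t = 2^-1 by lra.
by rewrite divff // subrr FG.
Qed.

(** Points of [B] may move, and even leave [B], during the deformation. Such deformations still
    compose, and one that ends in a single point contracts the set. *)
Definition deforms_into X (A B : set X) := exists G : X * R -> X,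
  [/\ clc (A `*` unit_itv) G, forall x, A x -> G (x, 0) = x,
      forall x t, A x -> unit_itv t -> A (G (x, t)) & forall x, A x -> B (G (x, 1))].

Definition contractible_to X (A : set X) (a : X) := deforms_into A [set a].

Lemma clc_at X Y (A : set X) (F : X * R -> Y) t : unit_itv t -> closed A ->
  clc (A `*` unit_itv) F -> clc A (fun x => F (x, t)).
Proof.
move=> It cA cF; apply: (@clc_comp _ _ _ _ _ (fun x => (x, t)) F _ cF) => //.
apply: continuous_clc => //; apply: continuous_pair => x; [exact: cvg_id|exact: cvg_cst].
Qed.

Lemma deforms_trans X (A B C : set X) : closed A -> B `<=` A ->
  deforms_into A B -> deforms_into B C -> deforms_into A C.
Proof.
move=> cA sBA [G [cG G0 GA GB]] [H [cH H0 HB H1]].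
exists (fun p => if p.2 <= 2^-1 then G (p.1, 2 * p.2) else H (G (p.1, 1), 2 * p.2 - 1)).
split.
- apply: (@concat_homotopy _ _ _ G (fun p => H (G (p.1, 1), p.2))) => //; last first.
    by move=> x Ax /=; rewrite H0 //; exact: GB.
  apply: (@clc_comp _ _ _ _ _ (fun p : X * R => (G (p.1, 1), p.2)) H _ cH); last first.
    by move=> [x t] /= [Ax It]; split=> //; exact: GB.
  have cAI := closed_setX cA unit_itv_closed.
  apply: clc_pair; last by apply: continuous_clc => // p; exact: cvg_snd.
  apply: (@clc_comp _ _ _ _ _ (fun p : X * R => (p.1, 1 : R)) G _ cG); last first.
    by move=> [x t] /= [Ax It]; split=> //; exact: unit_itv1.
  apply: continuous_clc => //; apply: continuous_pair => p; [exact: cvg_fst|exact: cvg_cst].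
- by move=> x Ax /=; rewrite mulr0 ifT ?G0 // invr_ge0.
- move=> x t Ax; rewrite /unit_itv /= => h; case: ifPn => h2; first by apply: GA => //=; rewrite /unit_itv /=; lra.
  by apply/sBA/HB; [exact: GB|rewrite /unit_itv /=; lra].
- by move=> x Ax /=; rewrite ifF ?mulr1; [rewrite (_ : 2 - 1 = 1) //; [apply: H1; exact: GB|lra]|apply/negbTE; rewrite -ltNge; lra].
Qed.

End Homotopies.

(** * Cubes, radial clamping and horns *)

Section Cubes.
Variable R : realType.

(** Cubes of all dimensions live in this one space, with zeros beyond their dimension, so that
    inserting, deleting and merging coordinates are maps of a space to itself. *)
Definition seqspace : topologicalType := prod_topology (fun _ : nat => (R : topologicalType)).
Notation W := seqspace.
Implicit Types (v w : W) (d i k : nat) (e t : R).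

Lemma continuous_seqspace (X : topologicalType) (f : X -> W) :
  (forall k, continuous (fun x => f x k)) -> continuous f.
Proof.
move=> cf x; apply/(@pointwise_cvgP nat R (nbhs (f @ x)) (f x)) => k.
exact: cf.
Qed.

Lemma continuous_coord k : continuous (fun w : W => w k).
Proof. exact: (@proj_continuous nat (fun _ => R) k). Qed.

Definition cube d : set W :=
  [set w | (forall k, (k < d)%N -> `|w k| <= 1) /\ forall k, (d <= k)%N -> w k = 0].

Lemma cube_compact d : compact (cube d).
Proof.
pose A k : set R := if (k < d)%N then `[-1, 1]%classic else [set 0].
have := @tychonoff nat (fun _ => R) A _; rewrite (_ : [set f | _] = cube d).
  apply=> k; rewrite /A; case: ifP => _; [exact: segment_compact|exact: compact_set1].
apply/seteqP; split=> w /=.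
  move=> H; split=> k hk; have := H k; rewrite /A.
    by rewrite hk /= in_itv /= ler_norml.
  by rewrite ltnNge hk.
move=> [h1 h2] k; rewrite /A; case: ltnP => hk; last exact: h2.
by rewrite /= in_itv /= -ler_norml; exact: h1.
Qed.

Lemma seqspace_hausdorff : hausdorff_space W.
Proof. by apply: (@hausdorff_product nat (fun _ => R)) => _; exact: Rhausdorff. Qed.

Lemma cube_closed d : closed (cube d).
Proof. by apply: compact_closed; [exact: seqspace_hausdorff|exact: cube_compact]. Qed.

(** The predicate serves to leave out the direction of a horn; with [xpredT] this is the norm whose
    unit ball is the cube. *)
Definition supnorm (P : pred nat) d w : R := \big[Num.max/0]_(k < d | P k) `|w k|.

Lemma supnorm_continuous P d : continuous (supnorm P d).
Proof.
pose f s (w : W) : R := \big[Num.max/0]_(k <- s | P (nat_of_ord k)) `|w (@nat_of_ord d k)|.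
suff: forall s, continuous (f s) by apply.
elim=> [|k s IH].
  have -> : f [::] = cst 0 by apply/funext => w; rewrite /f big_nil.
  exact: continuous_const.
have [Pk|Pk] := boolP (P k); last first.
  by have -> : f (k :: s) = f s by apply/funext => w; rewrite /f big_cons (negbTE Pk).
have -> : f (k :: s) = (fun w : W => Num.max `|w k| (f s w)).
  by apply/funext => w; rewrite /f big_cons Pk.
apply: continuous_maximum => //.
by apply: continuous_abs; exact: continuous_coord.
Qed.

Lemma supnorm_ge0 P d w : 0 <= supnorm P d w.
Proof. by rewrite /supnorm; elim/big_rec: _ => // k x _ x0; rewrite le_max x0 orbT. Qed.

Lemma le_supnorm (P : pred nat) d w k : (k < d)%N -> P k -> `|w k| <= supnorm P d w.
Proof.
move=> kd Pk; rewrite /supnorm.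
by have := @le_bigmax_cond _ R 'I_d 0 (Ordinal kd) (fun k : 'I_d => P k) (fun k : 'I_d => `|w k|) Pk.
Qed.

Lemma supnorm_leP (P : pred nat) d w t : 0 <= t ->
  supnorm P d w <= t <-> forall k, (k < d)%N -> P k -> `|w k| <= t.
Proof.
move=> t0; split=> [h k kd Pk|h]; first exact: le_trans (le_supnorm w kd Pk) h.
by apply/bigmax_leP; split=> // k Pk; exact: h.
Qed.

Lemma supnorm_attained (P : pred nat) d w t : 0 < t -> supnorm P d w = t ->
  exists k, [/\ (k < d)%N, P k & `|w k| = t].
Proof.
move=> t0 wt; apply: contrapT => H.
suff : supnorm P d w < t by rewrite wt ltxx.
apply/bigmax_ltP; split=> // k Pk; rewrite lt_neqAle -wt le_supnorm // andbT.
by apply/eqP => kt; apply: H; exists k; split=> //; rewrite kt.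
Qed.

Lemma supnormZ P d w (a : R) : 0 <= a -> supnorm P d (fun k => a * w k) = a * supnorm P d w.
Proof.
move=> a0; rewrite /supnorm; elim/big_ind2: _ => [|x y z u -> ->|k _]; first by rewrite mulr0.
  by rewrite maxr_pMr.
by rewrite normrM (ger0_norm a0).
Qed.

Notation N := (supnorm xpredT).

Lemma cubeP d w : cube d w <-> N d w <= 1 /\ forall k, (d <= k)%N -> w k = 0.
Proof.
split=> -[h1 h2]; split=> //; first by apply/supnorm_leP => // k kd _; exact: h1.
by move=> k kd; apply: (proj1 (supnorm_leP _ _ _ _) h1).
Qed.

Definition sphere_of_cube d : set W := [set w | cube d w /\ N d w = 1].
Definition open_cube d : set W := [set w | cube d w /\ N d w < 1].

Lemma open_cubeP d w :
  open_cube d w <-> (forall k, (k < d)%N -> `|w k| < 1) /\ forall k, (d <= k)%N -> w k = 0.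
Proof.
split.
  by move=> [[h1 h2] h3]; split=> // k kd; apply: le_lt_trans h3; exact: le_supnorm.
move=> [h1 h2]; split; first by split=> // k kd; exact/ltW/h1.
by apply/bigmax_ltP; split=> // k _; exact: h1.
Qed.

Lemma cubeVP d w : cube d w -> sphere_of_cube d w \/ open_cube d w.
Proof.
move=> cw; have [/[dup] h _ _] := cubeP d w; have [h1 _] := h cw.
by move: h1; rewrite le_eqVlt => /orP[/eqP e|l]; [left|right].
Qed.

Lemma sphere_of_cubeI d w k : cube d w -> (k < d)%N -> `|w k| = 1 -> sphere_of_cube d w.
Proof.
move=> cw kd wk; split=> //; apply/eqP; rewrite eq_le (proj1 (proj1 (cubeP _ _) cw)) /=.
by rewrite -wk; exact: le_supnorm.
Qed.

Lemma sphere_of_cubeP d w : sphere_of_cube d w ->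
  cube d w /\ exists2 k, (k < d)%N & `|w k| = 1.
Proof. by move=> [cw /(supnorm_attained ltr01) [k [kd _ wk]]]; split=> //; exists k. Qed.

Lemma open_sphere d w : open_cube d w -> sphere_of_cube d w -> False.
Proof. by move=> [_ h] [_ e]; rewrite e ltxx in h. Qed.

Lemma supnorm_closed d (A : set R) : closed A -> closed [set w | A (N d w)].
Proof. by move=> cA; apply: (@closed_comp _ _ (N d)) => // x _; exact: supnorm_continuous. Qed.

Lemma sphere_of_cube_closed d : closed (sphere_of_cube d).
Proof.
rewrite (_ : sphere_of_cube d = cube d `&` [set w | [set (1:R)] (N d w)]) //.
apply: closedI; [exact: cube_closed|apply: supnorm_closed].
apply: compact_closed; [exact: Rhausdorff|exact: compact_set1].
Qed.

Lemma cubeZ d w (a : R) : 0 <= a -> a * N d w <= 1 -> (forall k, (d <= k)%N -> w k = 0) ->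
  cube d (fun k => a * w k).
Proof.
by move=> a0 h1 h2; apply/cubeP; rewrite supnormZ //; split=> // k kd; rewrite h2 ?mulr0.
Qed.

(** The identity in the cube and the radial projection to its boundary outside. Being total and
    continuous, it lets a homotopy that scales and then stops at the boundary be written without
    cases. *)
Definition radial_clamp d w : W := fun k => w k / Num.max 1 (N d w).

Lemma radial_clamp_continuous d : continuous (radial_clamp d).
Proof.
apply: continuous_seqspace => k; apply: continuous_div; first exact: continuous_coord.
  by apply: continuous_maximum; [exact: continuous_const|exact: supnorm_continuous].
by move=> w; rewrite gt_eqF // lt_max ltr01.
Qed.

Lemma radial_clamp_id d w : N d w <= 1 -> radial_clamp d w = w.
Proof. by move=> h; apply/funext => k; rewrite /radial_clamp max_l ?divr1. Qed.

Lemma radial_clampE d w : radial_clamp d w = (fun k => (Num.max 1 (N d w))^-1 * w k).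
Proof. by apply/funext => k; rewrite mulrC. Qed.

Lemma radial_clamp_sphere d w : (forall k, (d <= k)%N -> w k = 0) -> 1 <= N d w ->
  sphere_of_cube d (radial_clamp d w).
Proof.
move=> h2 h1; have n0 : 0 < N d w by exact: lt_le_trans h1.
rewrite radial_clampE max_r //; split; last by rewrite supnormZ ?mulVf ?gt_eqF // invr_ge0 ltW.
by apply: cubeZ => //; rewrite ?invr_ge0 ?mulVf ?gt_eqF // ltW.
Qed.

Lemma radial_clamp_cube d w : (forall k, (d <= k)%N -> w k = 0) -> cube d (radial_clamp d w).
Proof.
move=> h2; case: (lerP (N d w) 1) => h; first by rewrite radial_clamp_id //; apply/cubeP.
by have [] := radial_clamp_sphere h2 (ltW h).
Qed.

(* Projection of the cube from a point above the face [v i = e] onto the union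
   of the other faces: apex at height 3 in direction i. *)
Definition horn_factor d i e w : R :=
  4 / Num.max 1 (Num.max (4 * supnorm (predC1 i) d w) (3 - e * w i)).
Definition horn_retr d i e w : W := fun k =>
  if k == i then e * (3 - horn_factor d i e w * (3 - e * w i))
  else horn_factor d i e w * w k.
Definition horn_push d i e (p : W * R) : W := fun k =>
  p.1 k + p.2 * (horn_retr d i e p.1 k - p.1 k).
(** As for simplicial horns: the boundary of the cube without the open face [w i = e]. *)
Definition horn d i e : set W := [set w | cube d w /\
  (w i = - e \/ exists k, [/\ (k < d)%N, k != i & `|w k| = 1])].

Lemma horn_factor_continuous d i e : continuous (horn_factor d i e).
Proof.
apply: continuous_div => [||w]; first exact: continuous_const.
  apply: continuous_maximum; first exact: continuous_const.
  apply: continuous_maximum.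
    apply: continuous_mul; first exact: continuous_const.
    exact: supnorm_continuous.
  apply: continuous_sub; first exact: continuous_const.
  by apply: continuous_mul; [exact: continuous_const|exact: continuous_coord].
by rewrite gt_eqF // lt_max ltr01.
Qed.

Lemma horn_push_continuous d i e : continuous (horn_push d i e).
Proof.
apply: continuous_seqspace => k.
have cf k' : continuous (fun p : W * R => p.1 k').
  by apply: (@continuous_comp2 _ _ _ fst (fun w : W => w k')) ; [exact: continuous_fst|exact: continuous_coord].
have ch : continuous (fun p : W * R => horn_factor d i e p.1).
  by apply: (@continuous_comp2 _ _ _ fst _) ; [exact: continuous_fst|exact: horn_factor_continuous].
have cc (a : R) : continuous (fun p : W * R => a) by exact: continuous_const.
apply: continuous_add => //; apply: continuous_mul; first exact: continuous_snd.
apply: continuous_sub => //; rewrite /horn_retr; case: (k == i).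
  apply: continuous_mul => //; apply: continuous_sub => //; apply: continuous_mul => //.
  by apply: continuous_sub => //; apply: continuous_mul.
exact: continuous_mul.
Qed.

Lemma horn_push0 d i e w : horn_push d i e (w, 0) = w.
Proof. by apply/funext => k; rewrite /horn_push mul0r addr0. Qed.

Section Horn.
Variables (d i : nat) (e : R).
Hypotheses (id : (i < d)%N) (e1 : e = 1 \/ e = -1).

Let ee : e * e = 1. Proof. by case: e1 => ->; rewrite ?mulrNN mulr1. Qed.
Let ne : `|e| = 1. Proof. by case: e1 => ->; rewrite ?normrN normr1. Qed.

Let M w := Num.max 1 (Num.max (4 * supnorm (predC1 i) d w) (3 - e * w i)).

Let tauP w : cube d w -> -1 <= e * w i <= 1.
Proof. by move=> [h _]; rewrite -ler_norml normrM ne mul1r; exact: h. Qed.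

Let nP w : cube d w -> supnorm (predC1 i) d w <= 1.
Proof. by move=> [h _]; apply/supnorm_leP => // k kd _; exact: h. Qed.

(** The factor is the largest scaling from the apex that stays in the cube: a side face is reached
    when [L] times the remaining norm is 1, the opposite face when [L * (3 - e * w i)] is 4, its
    distance from the apex. In the cube [3 - e * w i] is at least 2, so the outer maximum with 1
    only keeps the denominator positive elsewhere. *)
Let factorP w : cube d w -> let L := horn_factor d i e w in
  [/\ 1 <= L, L * supnorm (predC1 i) d w <= 1 , L * (3 - e * w i) <= 4 &
   L * supnorm (predC1 i) d w = 1 \/ L * (3 - e * w i) = 4].
Proof.
move=> cw; have /andP[t0 t1] := tauP cw; have n1 := nP cw; rewrite /=.
set n := supnorm _ _ _ in n1 *; set t := e * w i in t0 t1 *.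
have n0 : 0 <= n := supnorm_ge0 _ _ _.
have D0 : 0 < 3 - t by lra.
pose D := Num.max (4 * n) (3 - t).
have [D1 D2] : 4 * n <= D /\ 3 - t <= D by rewrite /D !le_max !lexx orbT.
have D3 : D <= 4 by rewrite ge_max; apply/andP; split; lra.
have D4 : 0 < D by lra.
have -> : horn_factor d i e w = 4 / D.
  by rewrite /horn_factor -/n -/t -/D max_r //; lra.
have E x : 4 / D * x = 4 * x / D by rewrite mulrAC.
split; rewrite ?E; last 1 first.
- clear E D1 D2 D3; rewrite {}/D in D4 *; case: (leP (4 * n) (3 - t)) => h.
    by right; rewrite mulfK // gt_eqF.
  by left; rewrite divff // gt_eqF // (lt_trans D0 h).
- by rewrite ler_pdivlMr // mul1r.
- by rewrite ler_pdivrMr // mul1r.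
- by rewrite ler_pdivrMr // ler_pM2l.
Qed.

Lemma horn_retr_horn w : cube d w -> horn d i e (horn_retr d i e w).
Proof.
move=> cw; have [L1 L2 L3 L4] := factorP cw; set L := horn_factor d i e w in L1 L2 L3 L4.
have t1 := tauP cw; have n1 := nP cw.
have L0 : 0 <= L by lra.
have cR : cube d (horn_retr d i e w).
  split=> k kd; last first.
    have ki : (k == i) = false by apply/negbTE; lia.
    by rewrite /horn_retr ki; case: cw => _ -> //; rewrite mulr0.
  rewrite /horn_retr; case: eqVneq => ki.
    rewrite normrM ne mul1r -/L ler_norml; apply/andP; split; first by lra.
    have : 1 * (3 - e * w i) <= L * (3 - e * w i) by apply: ler_wpM2r; lra.
    by lra.
  rewrite -/L normrM (ger0_norm L0); apply: le_trans L2; apply: ler_wpM2l => //.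
  by apply: le_supnorm.
split=> //; case: L4 => h; last by left; rewrite /horn_retr eqxx -/L h; lra.
right; have := supnormZ (predC1 i) d w L0; rewrite h => /(supnorm_attained ltr01).
move=> [k [kd ki wk]]; exists k; split=> //.
by rewrite /horn_retr (negbTE ki).
Qed.

Lemma horn_retr_id w : horn d i e w -> horn_retr d i e w = w.
Proof.
move=> [cw h]; have [L1 L2 L3 _] := factorP cw; set L := horn_factor d i e w in L1 L2 L3.
have L0 : 0 <= L by lra.
have L4 : L = 1.
  apply/eqP; rewrite eq_le L1 andbT; case: h => [h|[k [kd ki wk]]].
    by move: L3; rewrite h mulrN ee; lra.
  have n1 : 1 <= supnorm (predC1 i) d w by rewrite -wk; exact: le_supnorm.
  by apply: le_trans L2; rewrite -{1}(mulr1 L) ler_wpM2l.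
apply/funext => k; rewrite /horn_retr -/L L4; case: eqVneq => [->|_]; last by rewrite mul1r.
by rewrite mul1r opprB addrC subrK mulrA ee mul1r.
Qed.

Lemma horn_push_cube w t : cube d w -> unit_itv t -> cube d (horn_push d i e (w, t)).
Proof.
move=> cw; rewrite /unit_itv /= => /andP[t0 t1]; have [[h1 h2] _] := horn_retr_horn cw.
case: cw => c1 c2; split=> k kd; last by rewrite /horn_push /= h2 // c2 //; lra.
have := h1 _ kd; have := c1 _ kd; rewrite /horn_push /= !ler_norml.
move: (w k) (horn_retr d i e w k) => a b /andP[a0 a1] /andP[b0 b1].
by apply/andP; split; nra.
Qed.

Lemma horn_push1 w : horn_push d i e (w, 1) = horn_retr d i e w.
Proof. by apply/funext => k; rewrite /horn_push mul1r addrC subrK. Qed.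

Lemma horn_push_id w t : horn d i e w -> horn_push d i e (w, t) = w.
Proof. by move=> h; apply/funext => k; rewrite /horn_push horn_retr_id // subrr mulr0 addr0. Qed.

End Horn.
End Cubes.

(** * Gluing homotopies along an attached cell *)

Section Gluing.
Variables (R : realType) (T V Z : topologicalType).
Notation I := (@unit_itv R).

(** A relative homeomorphism in disguise: [phi] maps [E] into [P] and is injective, with values off
    [P], on the rest of the compact set [D]. Besides cubes, [D] will be a cube with a hole. *)
Definition attached (P : set T) (D E : set V) (phi : V -> T) :=
  [/\ clc D phi, compact D, closed P, E `<=` D & [/\ forall v, E v -> P (phi v),
      forall v, D v -> ~ E v -> ~ P (phi v) &
      forall v w, D v -> D w -> ~ E v -> ~ E w -> phi v = phi w -> v = w]].

Lemma attached_closed (P : set T) (D E : set V) (phi : V -> T) : hausdorff_space T ->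
  attached P D E phi -> closed (P `|` phi @` D).
Proof.
move=> hT [cphi kD cP sED _]; apply: closedU => //; apply: compact_closed => //.
exact: clc_compact.
Qed.

(** A homotopy on [P] and one on [D] that agree over [E] define one on the union; compactness of
    [D * I] gives continuity on the image of [D] by descent. The point [v0] is the default value of
    a choice of preimages. *)
Lemma glue_cell (v0 : V) (P : set T) (D E : set V) (phi : V -> T) (FP : T * R -> Z) (FD : V * R -> Z) :
  hausdorff_space T -> attached P D E phi ->
  clc (P `*` I) FP -> clc (D `*` I) FD ->
  (forall v t, E v -> I t -> FP (phi v, t) = FD (v, t)) ->
  exists F : T * R -> Z, [/\ clc ((P `|` phi @` D) `*` I) F,
    forall x t, P x -> F (x, t) = FP (x, t) &
    forall v t, D v -> I t -> F (phi v, t) = FD (v, t)].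
Proof.
move=> hT [cphi kD cP sED [EP DP inj]] cFP cFD comp.
pose inv x := xget v0 [set v | D v /\ phi v = x].
have invP v : D v -> ~ E v -> inv (phi v) = v.
  move=> Dv Ev; apply: xget_unique => // u [Du uv]; apply: inj => //.
  by move=> Eu; apply: (DP v) => //; rewrite -uv; exact: EP.
pose F p := if `[< P p.1 >] then FP p else FD (inv p.1, p.2).
have FD_ v t : D v -> I t -> F (phi v, t) = FD (v, t).
  move=> Dv It; rewrite /F /=; case: asboolP => Pv.
    by apply: comp => //; apply: contrapT => Ev; exact: DP Pv.
  by rewrite invP // => Ev; apply: Pv; exact: EP.
have FP_ x t : P x -> F (x, t) = FP (x, t) by move=> Px; rewrite /F /= asboolT.
exists F; split=> //.
rewrite (_ : _ `*` _ = P `*` I `|` (fun p => (phi p.1, p.2)) @` (D `*` I)); last first.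
  apply/seteqP; split=> -[x t] /=.
    move=> [[Px|[v Dv <-]] It]; [by left|right]; exists (v, t) => //.
  move=> [[Px It]|[[v u] /= [Dv Iu] [<- <-]]]; split=> //; [by left|by right; exists v].
apply: clcU; first by apply: (clc_eq cFP) => -[x t] [/= Px _]; rewrite FP_.
apply: clc_descend.
- by apply: hausdorff_prod => //; exact: Rhausdorff.
- by apply: compact_setX => //; exact: unit_itv_compact.
- have cDI : closed (D `*` I) := clc_closed cFD.
  apply: clc_pair; last by apply: continuous_clc => //; exact: continuous_snd.
  apply: (@clc_comp _ _ _ _ _ fst phi _ cphi) => [|p []//].
  by apply: continuous_clc => //; exact: continuous_fst.
- by apply: (clc_eq cFD) => -[v t] [/= Dv It]; rewrite FD_.
Qed.

End Gluing.

(** * Deforming away a pair of cells with one free face *)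

Section PairDeformation.
Variables (R : realType) (T : topologicalType) (d : nat).
Notation I := (@unit_itv R).
Notation W := (seqspace R).
Notation N := (supnorm (R:=R) xpredT d.+1).
Notation clamp := (@radial_clamp R d.+1).
Hypothesis hT : hausdorff_space T.
Variables (B : set T) (psi phi : W -> T) (h : W * R -> T).
Let P := B `|` psi @` cube d.
Let X := P `|` phi @` cube d.+1.
Hypothesis att_psi : attached B (cube d) (sphere_of_cube d) psi.
Hypothesis att_phi : attached P (cube d.+1) (sphere_of_cube d.+1) phi.

(** Bottom and walls of the cylinder over the big cube. *)
Let S : set (W * R) := cube d.+1 `*` [set 0] `|` sphere_of_cube d.+1 `*` I.
(** The homotopy [h] moves the attaching map of the big cell inside [P] until the face [w 0 = 1]
    covers the small cell by [psi] itself and all other faces lie in [B]. After that the pair would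
    be an elementary collapse. *)
Hypothesis ch : clc (sphere_of_cube d.+1 `*` I) h.
Hypothesis h0 : forall w, sphere_of_cube d.+1 w -> h (w, 0) = phi w.
Hypothesis hP : forall w t, sphere_of_cube d.+1 w -> I t -> P (h (w, t)).
Hypothesis h1_face : forall w, sphere_of_cube d.+1 w -> w 0%N = 1 ->
  h (w, 1) = psi (fun k => w k.+1).
Hypothesis h1_horn : forall w, horn d.+1 0 1 w -> B (h (w, 1)).

Let hh (p : W * R) : T := if p.2 == 0 then phi p.1 else h p.

Let c0 : closed [set (0 : R)].
Proof. by apply: compact_closed; [exact: Rhausdorff|exact: compact_set1]. Qed.

Let chh : clc S hh.
Proof.
have [cphi _ _ _ _] := att_phi.
apply: clcU.
  have cC : closed ((cube d.+1 : set W) `*` [set (0:R)]) by apply: closed_setX => //; exact: cube_closed.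
  apply: (@clc_eq _ _ _ (phi \o fst)).
    apply: (@clc_comp _ _ _ _ _ fst phi _ cphi) => [|p []//].
    by apply: continuous_clc => //; exact: continuous_fst.
  by move=> [w t] [/= _ ->]; rewrite /hh eqxx.
apply: (clc_eq ch) => -[w t] [/= sw It]; rewrite /hh /=; case: eqVneq => // ->.
exact: h0.
Qed.

Let hhX p : S p -> X (hh p).
Proof.
case: p => w t [[/= cw ->]|[/= sw It]]; rewrite /hh /=.
  by rewrite eqxx; right; exists w.
case: eqP => _; first by right; exists w => //; case: sw.
by left; exact: hP.
Qed.

Let hh_sphere w t : sphere_of_cube d.+1 w -> hh (w, t) = h (w, t).
Proof. by move=> sw; rewrite /hh /=; case: eqVneq => // ->; rewrite h0. Qed.

(** A point of the cylinder given by a scaled, clamped vector and a time cut off at 0. It lies on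
    [S] as soon as the time is positive only where the clamp is active. *)
Let rad (v : W) (a t : R) : W * R := (clamp (fun k => a * v k), Num.max 0 t).

Let rad_continuous (Y : topologicalType) (f : Y -> W) (a t : Y -> R) :
  continuous f -> continuous a -> continuous t -> continuous (fun y => rad (f y) (a y) (t y)).
Proof.
move=> cf ca ct; apply: continuous_pair; last by apply: continuous_maximum => //; exact: continuous_const.
apply: (@continuous_comp2 _ _ _ (fun y => (fun k => a y * f y k) : W) (clamp));
  last exact: radial_clamp_continuous.
apply: continuous_seqspace => k; apply: continuous_mul => //.
by apply: (@continuous_comp2 _ _ _ f (fun w : W => w k)) => //; exact: continuous_coord.
Qed.

Let cubeN v : cube d.+1 v -> 0 <= N v <= 1.
Proof. by move=> /cubeP [hN _]; rewrite supnorm_ge0. Qed.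

Let rad_S v a t : cube d.+1 v -> 0 <= a -> t <= 1 -> (0 < t -> 1 <= a * N v) -> S (rad v a t).
Proof.
move=> cv a0 t1 H; have [_ z] := cv.
have z' k : (d.+1 <= k)%N -> a * v k = 0 by move=> kd; rewrite z // mulr0.
rewrite /rad /S; case: (lerP t 0) => ht; [left|right]; split=> //=.
- exact: radial_clamp_cube.
- by apply: radial_clamp_sphere => //; rewrite supnormZ //; exact: H.
- by rewrite /unit_itv /= t1 ltW.
Qed.

Let clamp_sphere v a : sphere_of_cube d.+1 v -> 1 <= a ->
  clamp (fun k => a * v k) = v.
Proof.
move=> [_ Nv] a1; apply/funext => k; rewrite /radial_clamp supnormZ; last by lra.
by rewrite Nv mulr1 max_r // mulrAC divff ?mul1r // gt_eqF //; lra.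
Qed.

(** The characteristic map of the big cell for the deformed attaching map: [phi] at double speed on
    the inner half, then a collar along [h]. *)
Let phi' (v : W) : T := hh (rad v 2 (2 * N v - 1)).

Let cphi' : clc (cube d.+1) phi'.
Proof.
apply: (@clc_comp _ _ _ _ _ (fun v : W => rad v 2 (2 * N v - 1)) hh _ chh).
  apply: continuous_clc; first exact: cube_closed.
  apply: (rad_continuous (f := fun x => x)); [exact: continuous_identity|exact: continuous_const|].
  apply: continuous_sub; last exact: continuous_const.
  by apply: continuous_mul; [exact: continuous_const|exact: supnorm_continuous].
by move=> v cv; have := cubeN cv => ?; apply: rad_S => //; lra.
Qed.

Let phi'X v : cube d.+1 v -> X (phi' v).
Proof. by move=> cv; have := cubeN cv => ?; apply/hhX/rad_S => //; lra. Qed.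

Let phi'_sphere v : sphere_of_cube d.+1 v -> phi' v = h (v, 1).
Proof.
move=> sv; rewrite /phi' /rad clamp_sphere //; last by lra.
case: (sv) => _ ->; rewrite mulr1 hh_sphere // max_r; last by lra.
by congr (h (_, _)); lra.
Qed.

Let cons1 (y : W) : W := fun k => if k is k'.+1 then y k' else 1.

Let push (p : W * R) := horn_push d.+1 0 1 p.

Let cons1_continuous : continuous cons1.
Proof.
by apply: continuous_seqspace => -[|k]; [exact: continuous_const|exact: continuous_coord].
Qed.

Let cons1_cube y : cube d y -> cube d.+1 (cons1 y).
Proof.
move=> [h1 h2]; split=> -[|k] kd //=; [by rewrite normr1|exact: h1|exact: h2].
Qed.

Let push_cube v t : cube d.+1 v -> I t -> cube d.+1 (push (v, t)).
Proof. by move=> cv It; apply: horn_push_cube => //; left. Qed.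

(** The collapse on [P]: [B] is fixed, and the small cell, seen as the free face [w 0 = 1] of
    [phi'], is pushed through the big cell onto the horn. On the boundary of the small cell the push
    is stationary, so the two parts agree. *)
Let K_exists : exists K : T * R -> T, [/\ clc (P `*` I) K,
   forall x t, B x -> K (x, t) = x &
   forall y t, cube d y -> I t -> K (psi y, t) = phi' (push (cons1 y, t))].
Proof.
have [cpsi _ cB _ _] := att_psi.
have [||y t sy It|K [cK KB KD]] := @glue_cell R T W T (fun=> 0) B (cube d) (sphere_of_cube d) psi
   (fun p => p.1) (fun p => phi' (push (cons1 p.1, p.2))) hT att_psi.
- by apply: continuous_clc; [apply: closed_setX => //; exact: unit_itv_closed|exact: continuous_fst].
- apply: (@clc_comp _ _ _ _ _ (fun p : W * R => push (cons1 p.1, p.2)) phi' _ cphi').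
    apply: continuous_clc; first by apply: closed_setX; [exact: cube_closed|exact: unit_itv_closed].
    apply: (@continuous_comp2 _ _ _ (fun p : W * R => (cons1 p.1, p.2)) push); last exact: horn_push_continuous.
    apply: continuous_pair; last exact: continuous_snd.
    by apply: (@continuous_comp2 _ _ _ fst cons1); [exact: continuous_fst|exact: cons1_continuous].
  by move=> [y t] [/= cy It]; apply: push_cube => //; exact: cons1_cube.
- have [cy [k kd yk]] := sphere_of_cubeP sy; have c1 := cons1_cube cy.
  have hc : horn d.+1 0 1 (cons1 y) by split=> //; right; exists k.+1.
  have sc : sphere_of_cube d.+1 (cons1 y) by apply: (@sphere_of_cubeI _ _ _ k.+1).
  rewrite /= /push horn_push_id //; last by left.
  by rewrite phi'_sphere // h1_face.
by exists K.
Qed.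

(** The collapse is available for [phi'], not for [phi]. So a first stage [G1] inserts into the big
    cell a collar that runs along [h] and back, which makes [phi'] visible on the inner half; the
    second stage [G2] collapses this half and moves the outer collar, which lies in [P], by [K]. *)
Lemma pair_deform : deforms_into R X B.
Proof.
have [K [cK KB KD]] := K_exists.
have [cphi kD cP sub _] := att_phi.
have cI := @unit_itv_closed R.
have cQ := @cube_closed R d.+1.
have cX : closed X := attached_closed hT att_phi.
have c1 (a : R) : continuous (fun _ : W * R => a) by exact: continuous_const.
have cN : continuous (fun p : W * R => N p.1).
  by apply: (@continuous_comp2 _ _ _ fst (supnorm xpredT d.+1)); [exact: continuous_fst|exact: supnorm_continuous].
have KX x t : P x -> I t -> X (K (x, t)).
  move=> [Bx|[y cy <-]] It; first by rewrite KB //; left; left.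
  by rewrite KD //; apply/phi'X/push_cube => //; exact: cons1_cube.
have K1 x : P x -> B (K (x, 1)).
  move=> [Bx|[y cy <-]]; first by rewrite KB.
  rewrite KD //; last exact: unit_itv1.
  rewrite /push horn_push1; have hn : horn d.+1 0 1 (horn_retr d.+1 0 1 (cons1 y)).
    by apply: horn_retr_horn => //; [left|exact: cons1_cube].
  rewrite phi'_sphere; first exact: h1_horn.
  case: (hn) => cr [e|[k [kd _ e]]]; last exact: sphere_of_cubeI e.
  by apply: (@sphere_of_cubeI _ _ _ 0) => //; rewrite e normrN normr1.
have K0 x : P x -> K (x, 0) = x.
  move=> [Bx|[y cy <-]]; first by rewrite KB.
  rewrite KD //; last exact: unit_itv0.
  rewrite /push horn_push0.
  rewrite phi'_sphere; last by apply: (@sphere_of_cubeI _ _ _ 0) => //=; [exact: cons1_cube|rewrite normr1].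
  rewrite h1_face //; apply: (@sphere_of_cubeI _ _ _ 0) => //=; [exact: cons1_cube|by rewrite normr1].
have hornB w : horn d.+1 0 1 w -> B (phi' w).
  move=> hw; rewrite phi'_sphere; first exact: h1_horn.
  case: (hw) => cr [e|[k [kd _ e]]]; last exact: sphere_of_cubeI e.
  by apply: (@sphere_of_cubeI _ _ _ 0) => //; rewrite e normrN normr1.
(* The radius up to which [phi] is drawn shrinks from 1 to 1/4. At [l = 1] the time [tm] rises from
   0 to 1 for norms between 1/4 and 1/2 and returns to 0 at norm 1; hence the inner half shows
   [phi'] and the outer part [h] reversed. The maximum with 1/4 keeps [rho] positive for all [l]. *)
pose rho (l : R) := Num.max (1 - 3 / 4 * l) 4^-1.
have rho_gt0 l : 0 < rho l by rewrite lt_max invr_gt0 ltr0n orbT.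
have rhoE l : I l -> rho l = 1 - 3 / 4 * l.
  by rewrite /unit_itv /= => ?; rewrite /rho max_l //; lra.
pose tm (p : W * R) := Num.min (2 * (1 - N p.1)) (4 * (N p.1 - rho p.2)).
have radS p : cube d.+1 p.1 -> I p.2 -> S (rad p.1 (rho p.2)^-1 (tm p)).
  case: p => v l /= cv Il; have := cubeN cv => Nv; have rl := rhoE _ Il.
  move: Il; rewrite /unit_itv /= => Il.
  apply: rad_S => //; first by rewrite invr_ge0 ltW.
    by rewrite /tm /= ge_min; apply/orP; case: (lerP (N v) 2^-1) => ?; [right|left]; lra.
  rewrite /tm /= lt_min => /andP[_ h4]; rewrite mulrC ler_pdivlMr // mul1r; lra.
have [||v l sv Il|G1 [cG1 G1P G1D]] := @glue_cell R T W T (fun=> 0) P (cube d.+1) (sphere_of_cube d.+1) phi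
   (fun p => p.1) (fun p => hh (rad p.1 (rho p.2)^-1 (tm p))) hT att_phi.
- by apply: continuous_clc; [exact: closed_setX|exact: continuous_fst].
- apply: (@clc_comp _ _ _ _ _ (fun p : W * R => rad p.1 (rho p.2)^-1 (tm p)) hh _ chh).
    apply: continuous_clc; first exact: closed_setX.
    have crho : continuous (fun p : W * R => rho p.2).
      apply: continuous_maximum; last exact: c1.
      apply: continuous_sub; first exact: c1.
      by apply: continuous_mul; [exact: c1|exact: continuous_snd].
    apply: rad_continuous; first exact: continuous_fst.
      have -> : (fun p : W * R => (rho p.2)^-1) = (fun p => 1 / rho p.2) by apply/funext => p; rewrite div1r.
      by apply: continuous_div => [||p]; [exact: c1|exact: crho|rewrite gt_eqF].
    apply: continuous_minimum; apply: continuous_mul => //; apply: continuous_sub => //.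
  by move=> [v l] [/= cv Il]; exact: (radS (v, l)).
- have := rhoE _ Il => rl; move: Il; rewrite /unit_itv /= => Il.
  rewrite /rad clamp_sphere //; last by rewrite -[leLHS]invr1 lef_pV2 ?posrE // rl; lra.
  rewrite hh_sphere // /tm /=; case: (sv) => cv ->.
  by rewrite subrr mulr0 min_l ?maxxx ?h0 //; lra.
(* On the inner half the horn push in the coordinates of [phi'], on the outer half the collar along
   reversed [h], carried by [K]. *)
pose f2 (p : W * R) := if N p.1 <= 2^-1 then phi' (push ((fun k => 2 * p.1 k) : W, p.2))
   else K (h (rad p.1 2 (2 - 2 * N p.1)), p.2).
have dbl_cube v : cube d.+1 v -> N v <= 2^-1 -> cube d.+1 (fun k => 2 * v k).
  move=> [_ z] Nv; apply: cubeZ => //; by lra.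
have rad_sphere v : cube d.+1 v -> 2^-1 <= N v -> (sphere_of_cube d.+1 `*` I) (rad v 2 (2 - 2 * N v)).
  move=> cv Nv; have := cubeN cv => ?; split.
    apply: radial_clamp_sphere; last by rewrite supnormZ; lra.
    by case: cv => _ z k /z ->; rewrite mulr0.
  by rewrite /unit_itv /= ge_max !le_max lexx /=; lra.
(* At norm 1/2 a point is on the face [w 0 = 1], where [K] was defined by the same push, or on the
   horn, where both sides stand still. *)
have agree v t : cube d.+1 v -> N v = 2^-1 -> I t ->
   phi' (push ((fun k => 2 * v k) : W, t)) = K (h (rad v 2 (2 - 2 * N v)), t).
  move=> cv Nv It; set u : W := fun k => 2 * v k.
  have Nu : N u = 1 by rewrite supnormZ // Nv divff.
  have cu : cube d.+1 u by apply: dbl_cube; rewrite ?Nv.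
  have su : sphere_of_cube d.+1 u by [].
  have -> : rad v 2 (2 - 2 * N v) = (u, 1).
    by rewrite /rad -/u radial_clamp_id ?Nu // Nv max_r; [congr pair; lra|lra].
  have [_ [k kd uk]] := sphere_of_cubeP su.
  have [u0|u0] := pselect (u 0%N = 1).
    rewrite h1_face // KD //; last first.
      by case: cu => c_1 c_2; split=> j jd; [exact: c_1|exact: c_2].
    by congr (phi' (push (_, _))); apply/funext => -[|j].
  have hu : horn d.+1 0 1 u.
    split=> //; case: k kd uk => [_ uk|k kd uk]; last by right; exists k.+1.
    left; have : `|u 0%N| ^+ 2 = 1 by rewrite uk expr1n.
    rewrite real_normK ?num_real // => /eqP; rewrite sqrf_eq1 => /orP[/eqP|/eqP] //.
  rewrite /push horn_push_id //; last by left.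
  by rewrite phi'_sphere // KB //; exact: h1_horn.
have [|v t sv It|G2 [cG2 G2P G2D]] := @glue_cell R T W T (fun=> 0) P (cube d.+1) (sphere_of_cube d.+1) phi
   K f2 hT att_phi cK.
- rewrite (_ : cube d.+1 `*` I = (cube d.+1 `&` [set v | [set r | r <= 2^-1] (N v)]) `*` I `|`
     (cube d.+1 `&` [set v | [set r | 2^-1 <= r] (N v)]) `*` I); last first.
    apply/seteqP; split=> -[v t] /=.
      by move=> [cv It]; case: (lerP (N v) 2^-1) => hv; [left|right]; split=> //; split=> //=; exact: ltW.
    by move=> [] [[cv _] It].
  apply: clcU.
    have cC : closed ((cube d.+1 `&` [set v | [set r | r <= 2^-1] (N v)]) `*` I).
      by apply: closed_setX => //; apply: closedI => //; apply: supnorm_closed; exact: closed_le.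
    apply: (@clc_eq _ _ _ (phi' \o (fun p : W * R => push ((fun k => 2 * p.1 k) : W, p.2)))).
      apply: clc_comp cphi' _; last first.
        by move=> [v t] [/= [cv Nv] It]; apply: push_cube => //; exact: dbl_cube.
      apply: continuous_clc => //.
      apply: (@continuous_comp2 _ _ _ (fun p : W * R => ((fun k => 2 * p.1 k) : W, p.2)) push); last exact: horn_push_continuous.
      apply: continuous_pair; last exact: continuous_snd.
      apply: continuous_seqspace => k; apply: continuous_mul => //.
      by apply: (@continuous_comp2 _ _ _ fst (fun w : W => w k)); [exact: continuous_fst|exact: continuous_coord].
    by move=> [v t] [/= [cv /= Nv] It]; rewrite /f2 /= Nv.
  have cC : closed ((cube d.+1 `&` [set v | [set r | 2^-1 <= r] (N v)]) `*` I).
    by apply: closed_setX => //; apply: closedI => //; apply: supnorm_closed; exact: closed_ge.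
  apply: (@clc_eq _ _ _ (K \o (fun p : W * R => (h (rad p.1 2 (2 - 2 * N p.1)), p.2)))).
    apply: clc_comp cK _; last first.
      by move=> [v t] [/= [cv Nv] It]; split=> //; have [/= ? ?] := rad_sphere _ cv Nv; exact: hP.
    apply: clc_pair; last by apply: continuous_clc => //; exact: continuous_snd.
    apply: (@clc_comp _ _ _ _ _ (fun p : W * R => rad p.1 2 (2 - 2 * N p.1)) h _ ch); last first.
      by move=> [v t] [/= [cv Nv] It]; exact: rad_sphere.
    apply: continuous_clc => //; apply: rad_continuous => //; first exact: continuous_fst.
    by apply: continuous_sub => //; exact: continuous_mul.
  move=> [v t] [/= [cv /= Nv] It]; rewrite /f2 /=; case: lerP => // Nv'.
  by rewrite agree //; apply/eqP; rewrite eq_le Nv'.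
- have [cv Nv] := sv; rewrite /f2 /= Nv ifF; last by apply/negbTE; rewrite -ltNge; lra.
  rewrite /rad clamp_sphere; [|by []|by lra].
  by rewrite mulr1 subrr maxxx h0.
have f2X v t : cube d.+1 v -> I t -> X (f2 (v, t)).
  move=> cv It; rewrite /f2 /=; case: lerP => Nv; first by apply/phi'X/push_cube => //; exact: dbl_cube.
  by have [/= ? ?] := rad_sphere _ cv (ltW Nv); apply: KX => //; exact: hP.
have f2B v : cube d.+1 v -> B (f2 (v, 1)).
  move=> cv; rewrite /f2 /=; case: lerP => Nv.
    apply: hornB; rewrite /push horn_push1; apply: horn_retr_horn => //; [by left|exact: dbl_cube].
  by have [/= ? ?] := rad_sphere _ cv (ltW Nv); apply: K1; exact: hP.
exists (fun p => if p.2 <= 2^-1 then G1 (p.1, 2 * p.2) else G2 (p.1, 2 * p.2 - 1)); split.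
- apply: concat_homotopy => // x [Px|[v cv <-]]; first by rewrite G1P // G2P // K0.
  rewrite G1D ?G2D //; [|exact: unit_itv0|exact: unit_itv1].
  have := cubeN cv => Nv; rewrite /f2 /tm /= rhoE; last exact: unit_itv1.
  have -> : (1 - 3 / 4 * 1 : R) = 4^-1 by lra.
  rewrite invrK; case: lerP => Nv2.
    rewrite /push horn_push0 /phi' /rad supnormZ // min_r; last by lra.
    congr (hh (_, _)); last by congr Num.max; lra.
    by congr clamp; apply/funext => k; lra.
  have [/= sr It] := rad_sphere _ cv (ltW Nv2).
  rewrite K0; last exact: hP.
  rewrite min_l; last by lra.
  have -> : 2 * (1 - N v) = 2 - 2 * N v by lra.
  have e : clamp (fun k => 4 * v k) = clamp (fun k => 2 * v k).
    apply/funext => k; rewrite /radial_clamp !supnormZ // !max_r; [|lra|lra].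
    by field; lra.
  by rewrite /rad e hh_sphere.
- move=> x Xx /=; rewrite mulr0 ifT ?invr_ge0 //.
  case: Xx => [Px|[v cv <-]]; first by rewrite G1P.
  rewrite G1D //; last exact: unit_itv0.
  have := cubeN cv => Nv; rewrite /tm /= rhoE; last exact: unit_itv0.
  rewrite mulr0 subr0 invr1 /rad.
  have -> : (fun k => 1 * v k) = v by apply/funext => k; rewrite mul1r.
  rewrite radial_clamp_id; last by lra.
  by rewrite max_l /hh ?eqxx //= ge_min; apply/orP; right; lra.
- move=> x t Xx; rewrite /unit_itv /= => It; case: ifPn => ht.
    have I2 : I (2 * t) by rewrite /unit_itv /=; lra.
    case: Xx => [Px|[v cv <-]]; first by rewrite G1P //; left.
    by rewrite G1D //; apply/hhX/(radS (v, 2 * t)).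
  have I2 : I (2 * t - 1) by rewrite /unit_itv /=; lra.
  case: Xx => [Px|[v cv <-]]; first by rewrite G2P //; exact: KX.
  by rewrite G2D //; exact: f2X.
- move=> x Xx /=; rewrite ifF; last by apply/negbTE; rewrite -ltNge; lra.
  have -> : (2 * 1 - 1 : R) = 1 by lra.
  case: Xx => [Px|[v cv <-]]; first by rewrite G2P //; exact: K1.
  by rewrite G2D //; [exact: f2B|exact: unit_itv1].
Qed.

End PairDeformation.

(** * Radial deformation of a punctured cell *)

Section Puncture.
Variables (R : realType) (T : topologicalType) (d : nat) (eps : R).
Notation I := (@unit_itv R).
Notation W := (seqspace R).
Notation N := (supnorm (R:=R) xpredT d).
Hypothesis hT : hausdorff_space T.
Hypothesis eps_gt0 : 0 < eps.

Definition annulus : set W := [set w | cube d w /\ eps <= N w].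

Lemma annulus_closed : closed annulus.
Proof.
apply: closedI; first exact: cube_closed.
exact: (@supnorm_closed R d [set r | eps <= r] (@closed_ge _ eps)).
Qed.

Lemma annulus_compact : compact annulus.
Proof. by apply: subclosed_compact (@cube_compact R d) _; [exact: annulus_closed|move=> w []]. Qed.

(** The annulus is attached along its outer sphere only, so it can be pushed radially onto that
    sphere, which is already in [P]. *)
Lemma puncture_deform (P : set T) (phi : W -> T) :
  attached P annulus (sphere_of_cube d) phi ->
  deforms_into R (P `|` phi @` annulus) P.
Proof.
move=> att; have [cphi _ cP sub [EP _ _]] := att.
(* With this factor the norm moves linearly to 1; the maximum with [eps] keeps the denominator
   positive off the annulus. *)
pose mu (p : W * R) : R := (1 - p.2) + p.2 / Num.max (N p.1) eps.
pose s (p : W * R) : W := fun k => mu p * p.1 k.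
have muE v t : annulus v -> mu (v, t) = (1 - t) + t / N v by move=> [_ ?]; rewrite /mu /= max_l.
have sA v t : annulus v -> I t -> annulus (s (v, t)) /\ N (s (v, t)) = (1 - t) * N v + t.
  move=> av; have [cv Nv] := av; rewrite /unit_itv /= => It.
  have N0 : 0 < N v := lt_le_trans eps_gt0 Nv.
  have N1 : N v <= 1 by case/cubeP: cv.
  have m0 : 0 <= mu (v, t).
    by rewrite muE // addr_ge0 ?mulr_ge0 ?invr_ge0 //; lra.
  have e : N (s (v, t)) = (1 - t) * N v + t.
    by rewrite /s supnormZ // muE //= mulrDl mulfVK // gt_eqF.
  split=> //; split; last by rewrite e; nra.
  apply/cubeP; split; first by rewrite e; nra.
  by move=> k kd; rewrite /s; case: cv => _ /(_ k kd) /= ->; rewrite mulr0.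
have [||v t sv It|F [cF FP FD]] := @glue_cell R T W T (fun=> 0) P annulus (sphere_of_cube d) phi
   (fun p => p.1) (phi \o s) hT att.
- by apply: continuous_clc; [apply: closed_setX => //; exact: unit_itv_closed|exact: continuous_fst].
- apply: clc_comp cphi _; last by move=> [v t] [/= av It]; have [] := sA v t av It.
  apply: continuous_clc; first by apply: closed_setX; [exact: annulus_closed|exact: unit_itv_closed].
  apply: continuous_seqspace => k; apply: continuous_mul; last first.
    by apply: (@continuous_comp2 _ _ _ fst (fun w : W => w k)); [exact: continuous_fst|exact: continuous_coord].
  apply: continuous_add; first by apply: continuous_sub; [exact: continuous_const|exact: continuous_snd].
  apply: continuous_div; first exact: continuous_snd.
    apply: continuous_maximum; last exact: continuous_const.
    by apply: (@continuous_comp2 _ _ _ fst (supnorm xpredT d)); [exact: continuous_fst|exact: supnorm_continuous].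
  by move=> p; rewrite gt_eqF // lt_max eps_gt0 orbT.
- congr phi; apply/funext => k; rewrite /s muE; last exact: sub.
  by case: sv => _ ->; rewrite divr1 subrK mul1r.
exists F; split=> //.
- move=> x [Px|[v av <-]]; first by rewrite FP.
  rewrite FD //; last exact: unit_itv0.
  by congr phi; apply/funext => k; rewrite /s muE // subr0 mul0r addr0 mul1r.
- move=> x t [Px|[v av <-]] It; first by rewrite FP //; left.
  by rewrite FD //; right; exists (s (v, t)) => //; have [] := sA v t av It.
- move=> x [Px|[v av <-]]; first by rewrite FP.
  rewrite FD //; last exact: unit_itv1.
  have [[cs _] e] := sA v 1 av (unit_itv1 R).
  by apply: EP; split=> //; rewrite e subrr mul0r add0r.
Qed.

End Puncture.

(** * The cube modulo its boundary is a sphere *)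

Section CubeToSphere.
Variables (R : realType) (d : nat).
Notation W := (seqspace R).
Notation N := (supnorm (R:=R) xpredT d).

Definition sumsq (w : W) : R := \sum_(k < d) w k ^+ 2.
Let den (w : W) : R := sumsq w + (1 - N w) ^+ 2.

(* Inverse stereographic projection of w / (1 - |w|), from the base point. *)
Definition sphere_row (w : W) : 'rV[R]_d.+1 :=
  \row_(j < d.+1) if j == ord0 then (sumsq w - (1 - N w) ^+ 2) / den w
                  else 2 * (1 - N w) * w j.-1 / den w.

Let sumsq_ge0 w : 0 <= sumsq w.
Proof. by apply: sumr_ge0 => k _; exact: sqr_ge0. Qed.

Let den_gt0 w : 0 < den w.
Proof.
rewrite lt_def addr_ge0 ?sqr_ge0 // andbT paddr_eq0 ?sqr_ge0 //.
apply/negP => /andP[]; rewrite psumr_eq0 => [/allP h|k _]; last exact: sqr_ge0.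
rewrite sqrf_eq0 subr_eq0 => /eqP N1.
have [k [kd _ wk]] := supnorm_attained ltr01 (esym N1).
have := h (Ordinal kd) (mem_index_enum _); rewrite /= sqrf_eq0 => /eqP e.
by move: wk; rewrite e normr0 => /esym/eqP; rewrite oner_eq0.
Qed.

Lemma sphere_rowP w : sphere R d (sphere_row w).
Proof.
rewrite /sphere /= big_ord_recl mxE eqxx.
under eq_bigr => k _ do rewrite mxE lift0 /= mulrAC exprMn.
rewrite -mulr_sumr -/(sumsq w).
have : den w != 0 by rewrite gt_eqF.
by rewrite /den; move: (sumsq w) (N w) => a b nz; field.
Qed.

Definition cube_to_sphere (w : W) : sphere_space R d :=
  exist (fun v => v \in sphere R d) _ (mem_set (sphere_rowP w)).

Lemma continuous_row (X : topologicalType) n (f : X -> 'rV[R]_n) :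
  (forall j, continuous (fun x => f x ord0 j)) -> continuous f.
Proof.
move=> cf x A [P nP PA]; apply: filterS (_ : nbhs x [set y | forall i j, P i j (f y i j)]).
  by move=> y /= h; apply: PA.
apply: filter_forall => i; apply: filter_forall => j; rewrite (ord1 i).
by apply: cf; move: (nP i j); rewrite (ord1 i).
Qed.

Lemma sumsq_continuous : continuous sumsq.
Proof.
pose f s (w : W) : R := \sum_(k <- s) w (@nat_of_ord d k) ^+ 2.
suff: forall s, continuous (f s) by apply.
elim=> [|k s IH].
  have -> : f [::] = cst 0 by apply/funext => w; rewrite /f big_nil.
  exact: continuous_const.
have -> : f (k :: s) = (fun w : W => w k * w k + f s w).
  by apply/funext => w; rewrite /f big_cons expr2.
apply: continuous_add => //.
by apply: continuous_mul; exact: continuous_coord.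
Qed.

Lemma cube_to_sphere_continuous : continuous cube_to_sphere.
Proof.
apply: (@continuous_comp_initial (sphere_space R d)).
have cn : continuous (fun w : W => (1 - N w)).
  by apply: continuous_sub; [exact: continuous_const|exact: supnorm_continuous].
have cn2 : continuous (fun w : W => (1 - N w) ^+ 2).
  by apply: continuous_mul; exact: cn.
have cd : continuous den by apply: continuous_add => //; exact: sumsq_continuous.
apply: continuous_row => j.
have -> : (fun w => (set_val \o cube_to_sphere) w ord0 j) = (fun w =>
  if j == ord0 then (sumsq w - (1 - N w) ^+ 2) / den w
                  else 2 * (1 - N w) * w j.-1 / den w).
  by apply/funext => w /=; rewrite mxE.
case: eqP => _; apply: continuous_div => //; try by move=> w; rewrite gt_eqF.
  by apply: continuous_sub => //; exact: sumsq_continuous.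
apply: continuous_mul; last exact: continuous_coord.
by apply: continuous_mul => //; exact: continuous_const.
Qed.

Lemma cube_to_sphere_base w : sphere_of_cube d w -> cube_to_sphere w = sphere_base R d.
Proof.
move=> [_ N1]; apply: val_inj; apply/rowP => j /=; rewrite !mxE N1 subrr.
have := den_gt0 w; rewrite /den N1 subrr => h.
case: eqP => _; last by rewrite mulr0 !mul0r.
by rewrite expr0n /= subr0 addr0 divff //; rewrite expr0n addr0 in h; rewrite gt_eqF.
Qed.

Let row_open w : open_cube d w -> forall k, (k < d)%N -> forall j : 'I_d.+1, j = k.+1 :> nat ->
  sphere_row w ord0 j / (1 - sphere_row w ord0 ord0) = w k / (1 - N w).
Proof.
move=> [_ Nw] k kd j jk; rewrite !mxE eqxx.
have -> : (j == ord0) = false by apply/negbTE/eqP => /(congr1 val) /=; rewrite jk.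
have := den_gt0 w; rewrite jk /= /den; move: (N w) Nw (sumsq w) (w k) => n n1 q x h.
have h1 : (q - (1 - n) ^+ 2) / (q + (1 - n) ^+ 2) = 1 - 2 * (1 - n) ^+ 2 / (q + (1 - n) ^+ 2).
  by field; rewrite gt_eqF.
rewrite h1 subKr; field.
by rewrite !gt_eqF //; lra.
Qed.

(** Stereographic projection gives back [w k / (1 - N w)]. Taking norms determines [N w], because x
    / (1 - x) is injective, and then [w]. *)
Lemma cube_to_sphere_inj w w' : open_cube d w -> open_cube d w' ->
  cube_to_sphere w = cube_to_sphere w' -> w = w'.
Proof.
move=> ow ow' /(congr1 val) /= e.
have q k : (k < d)%N -> w k / (1 - N w) = w' k / (1 - N w').
  by move=> kd; rewrite -(row_open ow kd (j := lift ord0 (Ordinal kd))) // e (row_open ow' kd).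
have [Nw Nw'] : N w < 1 /\ N w' < 1 by case: ow ow' => ? ? [].
have a0 (u : W) : N u < 1 -> 0 <= (1 - N u)^-1 by move=> ?; rewrite invr_ge0; lra.
have : N w / (1 - N w) = N w' / (1 - N w').
  rewrite mulrC -(supnormZ _ _ _ (a0 _ Nw)) [RHS]mulrC -(supnormZ _ _ _ (a0 _ Nw')).
  by rewrite /supnorm; apply: eq_bigr => k _; rewrite mulrC q // mulrC.
have X (a b : R) : a * (1 - b) = b * (1 - a) -> a = b by lra.
have nz (u : W) : N u < 1 -> 1 - N u != 0 by move=> h; rewrite subr_eq0 gt_eqF.
move=> /eqP; rewrite eqr_div ?nz // => /eqP /X eN.
apply/funext => k; case: (ltnP k d) => kd; last first.
  by case: ow ow' => -[_ h] _ [[_ h'] _]; rewrite h // h'.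
have := q k kd; rewrite eN => /mulIf; apply; rewrite invr_eq0 nz //.
Qed.

Lemma cube_to_sphere_nbase w : open_cube d w -> cube_to_sphere w <> sphere_base R d.
Proof.
move=> [_ Nw] /(congr1 val) /rowP /(_ ord0); rewrite !mxE eqxx => /eqP.
have h := den_gt0 w; rewrite -subr_eq0 -[X in _ - X](divff (lt0r_neq0 h)) -mulrBl mulf_eq0 invr_eq0 (gt_eqF h) orbF.
by rewrite /den => /eqP; nra.
Qed.

Lemma cube_to_sphere_surj u : u <> sphere_base R d ->
  exists2 w, cube d w & cube_to_sphere w = u.
Proof.
case: u => u uP nb; have uS : sphere R d u by exact: set_mem uP.
have [u1|u1] := eqVneq (u ord0 ord0) 1; last first.
  pose c : R := u ord0 ord0.
  have c1 : c < 1.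
    rewrite lt_def eq_sym u1 /=; move: uS; rewrite /sphere /= big_ord_recl -/c => h.
    have : 0 <= \sum_(i < d) u ord0 (lift ord0 i) ^+ 2 by apply: sumr_ge0 => i _; exact: sqr_ge0.
    by nra.
  pose y : W := fun k => if insub k is Some k' then u ord0 (lift ord0 (k' : 'I_d)) / (1 - c) else 0.
  have yE (k : 'I_d) : y k = u ord0 (lift ord0 k) / (1 - c) by rewrite /y valK.
  have N0 : 0 <= N y := supnorm_ge0 _ _ _.
  have nN : 1 + N y != 0 by rewrite gt_eqF // ltr_pwDl.
  have nc : 1 - c != 0 by rewrite subr_eq0 gt_eqF.
  have i0 : 0 <= (1 + N y)^-1 by rewrite invr_ge0; lra.
  pose w : W := fun k => (1 + N y)^-1 * y k.
  have Nw : N w = N y / (1 + N y) by rewrite supnormZ // mulrC.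
  have sy : sumsq y * (1 - c) = 1 + c.
    have : sumsq y * (1 - c) ^+ 2 = 1 - c ^+ 2.
      move: uS; rewrite /sphere /= big_ord_recl -/c => h.
      have -> : 1 - c ^+ 2 = \sum_(i < d) u ord0 (lift ord0 i) ^+ 2 by move: h; lra.
      rewrite /sumsq mulr_suml.
      by apply: eq_bigr => k _; rewrite yE; field; rewrite subr_eq0 gt_eqF.
    have -> : 1 - c ^+ 2 = (1 + c) * (1 - c) by ring.
    by rewrite expr2 mulrA => /mulIf; apply; rewrite subr_eq0 gt_eqF.
  have sw : sumsq w = sumsq y / (1 + N y) ^+ 2.
    by rewrite /sumsq mulr_suml; apply: eq_bigr => k _; rewrite /w exprMn exprVn mulrC.
  have n1 : 1 - N w = (1 + N y)^-1 by rewrite Nw; field.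
  have dw : den w = 2 / (1 - c) / (1 + N y) ^+ 2.
    have {}sy : sumsq y = (1 + c) / (1 - c) by rewrite -sy mulfK // subr_eq0 gt_eqF.
    by rewrite /den n1 sw sy; field; rewrite nN nc.
  have cw : cube d w.
    apply: cubeZ => //; last by move=> k kd; rewrite /y insubF // ltnNge kd.
    by rewrite mulrC ler_pdivrMr ?mul1r ?lerDr // ltr_pwDl.
  exists w => //; apply: val_inj; apply/rowP => j /=; rewrite mxE dw n1.
  case: eqP => [->|/eqP j0].
    have {}sy : sumsq y = (1 + c) / (1 - c) by rewrite -sy mulfK // subr_eq0 gt_eqF.
    by rewrite sw sy -/c; field; rewrite nN nc.
  case: (unliftP ord0 j) j0 => [k -> _|->]; last by rewrite eqxx.
  by rewrite lift0 /= /w yE; field; rewrite nN nc.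
have u0 (k : 'I_d) : u ord0 (lift ord0 k) = 0.
  move: uS; rewrite /sphere /= big_ord_recl u1 expr1n => /eqP.
  rewrite -subr_eq0 addrC addKr psumr_eq0 => [/allP /(_ k (mem_index_enum _))|i _]; last exact: sqr_ge0.
  by rewrite /= sqrf_eq0 => /eqP.
case: nb; apply: val_inj; apply/rowP => j; rewrite /= mxE.
by case: eqP => [->//|/eqP]; case: (unliftP ord0 j) => [k -> _|->]; rewrite ?u0 ?eqxx.
Qed.

End CubeToSphere.

(** * A contractible set with disjoint cells attached is a wedge of spheres *)

Section Collapse.
Variables (R : realType) (T : topologicalType) (d k : nat).
Notation I := (@unit_itv R).
Notation W := (seqspace R).
Notation N := (supnorm (R:=R) xpredT d).
Hypotheses (hT : hausdorff_space T) (kT : compact [set: T]).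
Variables (Y : set T) (y0 : T) (phi : 'I_k -> W -> T).
Hypotheses (cY : closed Y) (contrY : contractible_to R Y y0).
Hypothesis cphi : forall i, clc (cube d) (phi i).
Hypothesis phi_sphere : forall i v, sphere_of_cube d v -> Y (phi i v).
Hypothesis phi_open : forall i v, open_cube d v -> ~ Y (phi i v).
Hypothesis phi_inj : forall i j v w, open_cube d v -> open_cube d w ->
  phi i v = phi j w -> i = j /\ v = w.
Hypothesis Yy0 : Y y0.
Hypothesis phi_cover : forall x, Y x \/ exists i v, cube d v /\ phi i v = x.

Let Wd := wedge_of_spheres R d k.
Let base : Wd := wedge_lift (@wedge_base R d k) (i := None) (tt : point_space).
Let lift (i : 'I_k) (u : sphere_space R d) : Wd :=
  wedge_lift (@wedge_base R d k) (i := Some i) u.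

Let cell_of x : exists o : option ('I_k * W), match o with
  | None => Y x
  | Some p => open_cube d p.2 /\ phi p.1 p.2 = x end.
Proof.
have [Yx|[i [v [cv vx]]]] := phi_cover x; first by exists None.
have [sv|ov] := cubeVP cv; last by exists (Some (i, v)).
by exists None; rewrite -vx; exact: phi_sphere.
Qed.

Let f x : Wd := match projT1 (cid (cell_of x)) with
  | None => base | Some p => lift p.1 (cube_to_sphere d p.2) end.

Let f_Y x : Y x -> f x = base.
Proof.
by move=> Yx; rewrite /f; case: (cid _) => /= -[[i v] /= [ov vx]|//]; case: (@phi_open i v ov); rewrite vx.
Qed.

Let lift_base i : lift i (sphere_base R d) = base.
Proof. exact: (wedge_liftE (@wedge_base R d k) (tt : wedge_family R d k None) (sphere_base R d : wedge_family R d k (Some i))). Qed.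

Let f_phi i v : cube d v -> f (phi i v) = lift i (cube_to_sphere d v).
Proof.
move=> cv; have [sv|ov] := cubeVP cv.
  by rewrite f_Y ?cube_to_sphere_base ?lift_base //; exact: phi_sphere.
rewrite /f; case: (cid _) => /= -[[j w] /= [ow wx]|Yx]; last by case: (@phi_open i v ov Yx).
by have [-> ->] := phi_inj ow ov wx.
Qed.

Let lift_inj i j u u' : u <> sphere_base R d -> lift i u = lift j u' -> i = j /\ u = u'.
Proof.
(* In the product of the summands, the coordinate [Some i] of a point of the [j]-th sphere is the
   base point unless [i] and [j] are equal. *)
move=> ub /(congr1 (@wedge_prod _ _ (@wedge_base R d k))).
have pE := @wedge_prod_pointE _ _ (@wedge_base R d k).
rewrite /wedge_prod /lift !wedge_lift_funE // => e.
have {}e := congr1 (fun F => F (Some i)) e; move: e; rewrite /= dfwithin.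
have [<-|ij] := eqVneq i j; first by rewrite dfwithin.
by rewrite dfwithout //; apply/eqP => -[/eqP]; rewrite eq_sym (negbTE ij).
Qed.

Let f_inj x x' : f x = f x' -> x = x' \/ Y x /\ Y x'.
Proof.
have cellP z : Y z \/ exists i v, open_cube d v /\ phi i v = z.
  by case: (cell_of z) => -[[i v] /= h|h]; [right; exists i, v|left].
have key i v z : open_cube d v -> f (phi i v) = f z -> phi i v = z.
  move=> ov; rewrite f_phi; last by case: ov.
  have nb := cube_to_sphere_nbase ov.
  have [Yz|[j [w [ow <-]]]] := cellP z.
    by rewrite f_Y // -(lift_base i) => /(lift_inj nb) [_ /nb].
  rewrite f_phi => [/(lift_inj nb) [<- /cube_to_sphere_inj -> //]|]; by case: ow.
have [Yx|[i [v [ov <-]]]] := cellP x; last by move=> /(key i v _ ov); left.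
have [Yx'|[j [w [ow <-]]]] := cellP x'; first by right.
by move=> /esym /(key j w _ ow) ->; left.
Qed.

Let f_surj z : exists x, f x = z.
Proof.
have : [set: Wd] z by []; rewrite /Wd /wedge_of_spheres -wedgeTE => -[[i|] _ [u _ <-]]; last first.
  by exists y0; rewrite f_Y //; case: u.
have [->|/eqP nb] := eqVneq u (sphere_base R d).
  by exists y0; rewrite f_Y // -(lift_base i).
by have [w cw <-] := cube_to_sphere_surj nb; exists (phi i w); rewrite f_phi.
Qed.

Let cover_clc (Z : topologicalType) (F : T * R -> Z) : clc (Y `*` I) F ->
  (forall i, clc ((phi i @` cube d) `*` I) F) -> clc ([set: T] `*` I) F.
Proof.
move=> FY Fphi.
have cs (s : seq 'I_k) : clc ((Y `|` [set x | exists2 i, i \in s & (phi i @` cube d) x]) `*` I) F.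
  elim: s => [|i s IH].
    rewrite (_ : Y `|` _ = Y) //.
    by apply/seteqP; split=> x; [move=> [//|[i]]|left].
  rewrite (_ : _ `*` _ = (phi i @` cube d) `*` I `|`
    (Y `|` [set x | exists2 i, i \in s & (phi i @` cube d) x]) `*` I); first exact: clcU.
  apply/seteqP; split=> -[x t].
    move=> [/= [Yx|[j js h]] It]; first by right; split=> //; left.
    move: js; rewrite inE => /orP[/eqP ji|js]; first by left; rewrite -ji.
    by right; split=> //; right; exists j.
  move=> [[h It]|[[Yx|[j js h]] It]]; split=> //; [right; exists i => //; exact: mem_head|by left|].
  by right; exists j => //; rewrite inE js orbT.
rewrite (_ : [set: T] = Y `|` [set x | exists2 i, i \in enum 'I_k & (phi i @` cube d) x]); first exact: cs.
apply/seteqP; split=> x // _; have [Yx|[i [v [cv vx]]]] := phi_cover x; first by left.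
by right; exists i; [rewrite mem_enum|exists v].
Qed.

Let f_clc : clc [set: T] f.
Proof.
have c i : clc (phi i @` cube d) f.
  apply: (clc_descend hT (@cube_compact R d) (@cphi i)).
  apply: (@clc_eq _ _ _ (lift i \o cube_to_sphere d)) => [|v cv]; last by rewrite /= f_phi.
  apply: continuous_clc; first exact: cube_closed.
  apply: continuous_comp2; first exact: cube_to_sphere_continuous.
  exact: (@wedge_lift_continuous _ (wedge_family R d k) (@wedge_base R d k) (Some i)).
apply: (@clc_at R _ _ _ (fun p : T * R => f p.1) 0 (unit_itv0 R) (@closedT T)).
apply: cover_clc => [|i].
  apply: (@clc_eq _ _ _ (fun=> base)) => [|[x t] [/= Yx _]]; last by rewrite f_Y.
  apply: continuous_clc; last exact: continuous_const.
  by apply: closed_setX => //; exact: unit_itv_closed.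
apply: (@clc_comp _ _ _ _ _ fst f _ (c i)) => [|p []//].
apply: continuous_clc; last exact: continuous_fst.
by apply: closed_setX; [exact: clc_closed (c i)|exact: unit_itv_closed].
Qed.

(** Homotopy extension for the pair of [T] and [Y]: over each cell, the identity at time 0 and the
    contraction over the boundary are extended to the cylinder by retracting it onto its bottom and
    walls. *)
Let contract_extends : exists H : T * R -> T, [/\ clc ([set: T] `*` I) H,
  forall x, H (x, 0) = x, forall x t, Y x -> I t -> Y (H (x, t)) &
  forall x, Y x -> H (x, 1) = y0].
Proof.
have [G [cG G0 GY G1]] := contrY.
pose hh i (p : W * R) := if p.2 == 0 then phi i p.1 else G (phi i p.1, p.2).
pose S : set (W * R) := cube d `*` [set 0] `|` sphere_of_cube d `*` I.
have cI := @unit_itv_closed R.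
have c1 (a : R) : continuous (fun _ : W * R => a) by exact: continuous_const.
have chh i : clc S (hh i).
  apply: clcU.
    have cC : closed ((cube d : set W) `*` [set (0:R)]).
      apply: closed_setX; first exact: cube_closed.
      by apply: compact_closed; [exact: Rhausdorff|exact: compact_set1].
    apply: (@clc_eq _ _ _ (phi i \o fst)); last by move=> [w t] [/= _ ->]; rewrite /hh eqxx.
    apply: (@clc_comp _ _ _ _ _ fst (phi i) _ (@cphi i)) => [|p []//].
    by apply: continuous_clc => //; exact: continuous_fst.
  have cC : closed ((sphere_of_cube d : set W) `*` I) by apply: closed_setX => //; exact: sphere_of_cube_closed.
  apply: (@clc_eq _ _ _ (G \o (fun p : W * R => (phi i p.1, p.2)))).
    apply: clc_comp cG _; last by move=> [w t] [/= sw It]; split=> //; exact: phi_sphere.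
    apply: clc_pair; last by apply: continuous_clc => //; exact: continuous_snd.
    apply: (@clc_comp _ _ _ _ _ fst (phi i) _ (@cphi i)) => [|p [[]]//].
    by apply: continuous_clc => //; exact: continuous_fst.
  move=> [w t] [/= sw It]; rewrite /hh /=; case: eqVneq => // ->; rewrite G0 //.
  exact: phi_sphere.
(* The retraction in one formula: scale by 1 + t, clamp to the cube and turn the excess of the norm
   over 1 into time. It is the identity on the bottom and on the walls. *)
pose ex (p : W * R) : W * R := (radial_clamp d ((fun k => (1 + p.2) * p.1 k) : W),
  Num.max 0 ((1 + p.2) * N p.1 - 1)).
have cex : continuous ex.
  have c1t : continuous (fun p : W * R => 1 + p.2) by apply: continuous_add => //; exact: continuous_snd.
  apply: continuous_pair.
    apply: (@continuous_comp2 _ _ _ (fun p : W * R => (fun k => (1 + p.2) * p.1 k) : W) (@radial_clamp R d));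
      last exact: radial_clamp_continuous.
    apply: continuous_seqspace => j; apply: continuous_mul => //.
    by apply: (@continuous_comp2 _ _ _ fst (fun w : W => w j)); [exact: continuous_fst|exact: continuous_coord].
  apply: continuous_maximum => //; apply: continuous_sub => //; apply: continuous_mul => //.
  by apply: (@continuous_comp2 _ _ _ fst (supnorm xpredT d)); [exact: continuous_fst|exact: supnorm_continuous].
have exS v t : cube d v -> I t -> S (ex (v, t)).
  move=> cv; rewrite /unit_itv /= => It; have [N1 z] := proj1 (cubeP _ _) cv.
  have N0 := supnorm_ge0 xpredT d v.
  have z' j : (d <= j)%N -> (1 + t) * v j = 0 by move=> jd; rewrite z // mulr0.
  rewrite /S /ex /=; case: (lerP ((1 + t) * N v - 1) 0) => h; [left|right]; split=> //=.
  - exact: radial_clamp_cube.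
  - by apply: radial_clamp_sphere => //; rewrite supnormZ; lra.
  - by rewrite /unit_itv /=; nra.
have ex_sphere i v t : sphere_of_cube d v -> I t -> hh i (ex (v, t)) = G (phi i v, t).
  move=> sv; rewrite /unit_itv /= => It; have [_ N1] := sv.
  have -> : ex (v, t) = (v, t).
    rewrite /ex /= N1 (_ : (1 + t) * 1 - 1 = t); last by ring.
    rewrite max_r; last by lra.
    congr pair; apply/funext => j; rewrite /radial_clamp supnormZ; last by lra.
    rewrite N1 mulr1 max_r; last by lra.
    by rewrite mulrAC divff ?mul1r // gt_eqF //; lra.
  by rewrite /hh /=; case: eqVneq => // ->; rewrite G0 //; exact: phi_sphere.
pose H (p : T * R) := match projT1 (cid (cell_of p.1)) with
  | None => G p | Some q => hh q.1 (ex (q.2, p.2)) end.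
have H_Y x t : Y x -> H (x, t) = G (x, t).
  by move=> Yx; rewrite /H; case: (cid _) => /= -[[i v] /= [ov vx]|//]; case: (@phi_open i v ov); rewrite vx.
have H_phi i v t : cube d v -> I t -> H (phi i v, t) = hh i (ex (v, t)).
  move=> cv It; have [sv|ov] := cubeVP cv.
    by rewrite H_Y ?ex_sphere //; exact: phi_sphere.
  rewrite /H; case: (cid _) => /= -[[j w] /= [ow wx]|Yx]; last by case: (@phi_open i v ov Yx).
  by have [-> ->] := phi_inj ow ov wx.
have I0 := unit_itv0 R.
exists H; split.
- apply: cover_clc => [|i]; first by apply: (clc_eq cG) => -[x t] [/= Yx _]; rewrite H_Y.
  rewrite (_ : _ `*` _ = (fun p : W * R => (phi i p.1, p.2)) @` (cube d `*` I)); last first.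
    apply/seteqP; split=> [[x t] [[v cv /= vx] It]|_ [[v t] [/= cv It] <-]].
      by exists (v, t) => //=; rewrite vx.
    by split=> //; exists v.
  have cQ : closed ((cube d : set W) `*` I) by apply: closed_setX => //; exact: cube_closed.
  apply: clc_descend.
  + by apply: hausdorff_prod => //; exact: Rhausdorff.
  + by apply: compact_setX; [exact: cube_compact|exact: unit_itv_compact].
  + apply: clc_pair; last by apply: continuous_clc => //; exact: continuous_snd.
    apply: (@clc_comp _ _ _ _ _ fst (phi i) _ (@cphi i)) => [|p []//].
    by apply: continuous_clc => //; exact: continuous_fst.
  + apply: (@clc_eq _ _ _ (hh i \o ex)).
      apply: clc_comp (chh i) _; first exact: continuous_clc.
      by move=> [v t] [/= cv It]; exact: exS.
    by move=> [v t] [/= cv It]; rewrite H_phi.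
- move=> x; have [Yx|[i [v [cv <-]]]] := phi_cover x; first by rewrite H_Y ?G0.
  rewrite H_phi //; have [N1 _] := proj1 (cubeP _ _) cv.
  rewrite /hh /ex /= addr0 mul1r max_l ?eqxx; last by lra.
  have -> : (fun k => 1 * v k) = v by apply/funext => j; rewrite mul1r.
  by rewrite radial_clamp_id.
- by move=> x t Yx It; rewrite H_Y //; exact: GY.
- by move=> x Yx; rewrite H_Y // G1.
Qed.

(** The map [f] collapses [Y] to the base point. Since [H] at time 1 is constant on [Y], it factors
    through [f], and the factor is a homotopy inverse; both homotopies are [H] run backwards. The
    section [sec] is an arbitrary choice of preimages: only composites that are constant on the
    fibres of [f] are formed with it, and their continuity descends along [f]. *)
Lemma collapse_contractible : homotopy_equivalent R T Wd.
Proof.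
have [H [cH H0 HY H1]] := contract_extends.
have fT : f @` setT = [set: Wd].
  by apply/seteqP; split=> z // _; have [x <-] := f_surj z; exists x.
have wH : hausdorff_space Wd.
  apply: wedge_hausdorff => -[i|] /=; last exact: discrete_hausdorff.
  apply: (@hausdorff_inj (sphere_space R d) 'rV[R]_d.+1 set_val).
  - exact: initial_continuous.
  - exact: val_inj.
  - exact: norm_hausdorff.
pose sec z := xget y0 [set x | f x = z].
have fsec z : f (sec z) = z by apply: (@xgetPex _ y0 [set x | f x = z]); exact: f_surj.
have cT : closed [set: T] by exact: closedT.
have cI := @unit_itv_closed R.
have sec1 x : H (sec (f x), 1) = H (x, 1).
  by have [->//|[Ys Yx]] := f_inj (fsec (f x)); rewrite !H1.
have secY x t : I t -> f (H (sec (f x), t)) = f (H (x, t)).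
  by move=> It; have [->//|[Ys Yx]] := f_inj (fsec (f x)); rewrite (f_Y (HY _ _ Ys It)) (f_Y (HY _ _ Yx It)).
have cH1 : clc [set: T] (fun x => H (x, 1)) by apply: clc_at => //; exact: unit_itv1.
have cf := clcT_continuous f_clc.
have cI1 (X : topologicalType) : closed ([set: X] `*` I) by apply: closed_setX => //; exact: closedT.
have rev (X : topologicalType) : continuous (fun p : X * R => (p.1, 1 - p.2)).
  apply: continuous_pair; first exact: continuous_fst.
  by apply: continuous_sub; [exact: continuous_const|exact: continuous_snd].
have IE (X : topologicalType) : [set p : X * R | 0 <= p.2 <= 1] = setT `*` I.
  by apply/seteqP; split=> p /=; [|move=> []].
have revI (t : R) : I t -> I (1 - t) by rewrite /unit_itv /=; lra.
exists f, (fun z => H (sec z, 1)); split.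
- exact: cf.
- apply: clcT_continuous; rewrite -fT; apply: (clc_descend wH kT f_clc).
  by apply: (clc_eq cH1) => x _; rewrite /= sec1.
- exists (fun p => H (p.1, 1 - p.2)); split.
  + rewrite IE; apply/clcP; first exact: cI1.
    apply: (@clc_comp _ _ _ _ _ (fun p : T * R => (p.1, 1 - p.2)) H _ cH).
      by apply: continuous_clc; [exact: cI1|exact: rev].
    by move=> [x t] [/= _ It]; split=> //; exact: revI.
  + by move=> x; rewrite /= subr0 sec1.
  + by move=> x; rewrite /= subrr H0.
- exists (fun p => f (H (sec p.1, 1 - p.2))); split.
  + rewrite IE; apply/clcP; first exact: cI1.
    rewrite -fT (_ : _ `*` _ = (fun p : T * R => (f p.1, p.2)) @` (setT `*` I)); last first.
      apply/seteqP; split=> [[z t] [[x _ /= xz] It]|_ [[x t] [/= _ It] <-]].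
        by exists (x, t) => //=; rewrite xz.
      by split=> //; exists x.
    apply: clc_descend.
    * by apply: hausdorff_prod => //; exact: Rhausdorff.
    * by apply: compact_setX => //; exact: unit_itv_compact.
    * apply: continuous_clc; first exact: cI1.
      apply: continuous_pair; last exact: continuous_snd.
      by apply: (@continuous_comp2 _ _ _ fst f) => //; exact: continuous_fst.
    * apply: (@clc_eq _ _ _ (f \o (H \o (fun p : T * R => (p.1, 1 - p.2))))).
        apply: clc_comp f_clc _ => //; apply: clc_comp cH _.
          by apply: continuous_clc; [exact: cI1|exact: rev].
        by move=> [x t] [/= _ It]; split=> //; exact: revI.
      by move=> [x t] [/= _ It]; rewrite secY //; exact: revI.
  + by move=> z; rewrite /= subr0.
  + by move=> z; rewrite /= subrr H0 fsec.
Qed.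

End Collapse.

Arguments rx0 {_} _.
Arguments rx1 {_} _.
Arguments ry0 {_} _.
Arguments ry1 {_} _.
Arguments Rect {_} _ _ _ _.
Arguments closed_rect {_} _.
Arguments open_rect {_} _.
Arguments rect_boundary {_} _.
Arguments nondegenerate {_} _.
Arguments pdist {_} _ _.
Arguments hausdorff_dist {_} _ _.
Arguments is_tiling {_} N t.
Arguments skeleton {_} N t.

(* Opaque: the boolean equality should not unfold when memberships are simplified. *)
Fact rect_has_eq (R : realType) : hasDecEq (rect R).
Proof. exact: gen_eqMixin. Qed.
HB.instance Definition _ (R : realType) := rect_has_eq R.
HB.instance Definition _ (R : realType) := gen_choiceMixin (rect R).

(** * Tilings as lists of rectangles, determined by their skeleta *)

Section RectangleLists.
Variable R : realType.
Implicit Types (r q : rect R) (L M : seq (rect R)) (p : R * R).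

(* Half-open rectangles: they are empty when degenerate, and a tiling is a
   partition of the half-open square. *)
Definition in_half_open p r : bool :=
  (rx0 r <= p.1 < rx1 r) && (ry0 r <= p.2 < ry1 r).
Definition tiles L := forall p, count (in_half_open p) L = in_half_open p (unit_square R) :> nat.
Definition ndg r : bool := (rx0 r < rx1 r) && (ry0 r < ry1 r).
Definition valid_rect r : bool :=
  [&& 0 <= rx0 r, rx0 r <= rx1 r, rx1 r <= 1, 0 <= ry0 r, ry0 r <= ry1 r & ry1 r <= 1].
Definition separated q r :=
  [|| rx1 q <= rx0 r, rx1 r <= rx0 q, ry1 q <= ry0 r | ry1 r <= ry0 q].
Definition skel L : set (R * R) :=
  rect_boundary (unit_square R) `|` [set p | exists2 r, r \in L & rect_boundary r p].

Lemma in_half_open_ndg p r : in_half_open p r -> ndg r.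
Proof.
by move=> /andP[/andP[a b] /andP[c e]]; rewrite /ndg (le_lt_trans a b) (le_lt_trans c e).
Qed.

Lemma tiles_perm L M : perm_eq L M -> tiles L -> tiles M.
Proof. by move=> /permP LM tL p; rewrite -LM. Qed.

Lemma tiles_filter L : tiles L -> tiles [seq r <- L | ndg r].
Proof.
move=> tL p; rewrite -tL count_filter; apply: eq_count => r /=.
by case: (boolP (in_half_open p r)) => //= /in_half_open_ndg.
Qed.

Lemma tiles_mem_eq L r q p : tiles L -> r \in L -> q \in L ->
  in_half_open p r -> in_half_open p q -> r = q.
Proof.
move=> tL rL qL pr pq; apply/eqP; apply: contraT => nrq.
have qL' : q \in rem r L by move: qL; rewrite (perm_mem (perm_to_rem rL)) inE eq_sym (negbTE nrq).
have := tL p; rewrite (permP (perm_to_rem rL)) /= (permP (perm_to_rem qL')) /= pr pq.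
by case: (in_half_open p (unit_square R)).
Qed.

Lemma tiles_in_unit L r p : tiles L -> r \in L -> in_half_open p r ->
  in_half_open p (unit_square R).
Proof.
move=> tL rL pr; have := tL p; case: (in_half_open p (unit_square R)) => // /eqP.
by rewrite -leqn0 leqNgt -has_count; case: hasP => // -[]; exists r.
Qed.

Lemma corner_in_half_open r : ndg r -> in_half_open (rx0 r, ry0 r) r.
Proof. by move=> /andP[a b]; rewrite /in_half_open /= !lexx a b. Qed.

Lemma tiles_valid L r : tiles L -> r \in L -> ndg r -> valid_rect r.
Proof.
move=> tL rL /[dup] nr /andP[x01 y01].
have := tiles_in_unit tL rL (corner_in_half_open nr).
rewrite /in_half_open /= => /andP[/andP[x0 x1] /andP[y0 y1]].
rewrite /valid_rect x0 y0 (ltW x01) (ltW y01) /= andbC.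
apply/andP; split; rewrite leNgt; apply/negP => h.
  have /(tiles_in_unit tL rL) : in_half_open (rx0 r, 1) r by rewrite /in_half_open /= lexx x01 h ltW.
  by rewrite /in_half_open /= ltxx !andbF.
have /(tiles_in_unit tL rL) : in_half_open (1, ry0 r) r by rewrite /in_half_open /= lexx y01 h ltW.
by rewrite /in_half_open /= ltxx !andbF.
Qed.

Lemma tiles_exists L p : tiles L -> in_half_open p (unit_square R) ->
  exists2 r, r \in L & in_half_open p r.
Proof.
move=> tL pu; have : (0 < count (in_half_open p) L)%N by rewrite tL pu.
by rewrite -has_count => /hasP.
Qed.

Lemma eventually_all (T : eqType) (s : seq T) (P : T -> R -> Prop) :
  (forall x, x \in s -> exists2 e : R, 0 < e & forall e' : R, 0 < e' < e -> P x e') ->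
  exists2 e : R, 0 < e & forall x (e' : R), x \in s -> 0 < e' < e -> P x e'.
Proof.
elim: s => [|x s IH] H; first by exists 1.
have [e e0 He] := H x (mem_head _ _).
have [|e1 e10 He1] := IH; first by move=> y ys; apply: H; rewrite inE ys orbT.
exists (Num.min e e1); first by rewrite lt_min e0.
move=> y e' /[swap] /andP[e'0]; rewrite lt_min => /andP[h1 h2].
by rewrite inE => /orP[/eqP ->|ys]; [apply: He|apply: He1]; rewrite ?e'0.
Qed.

Lemma tiles_cover L p : tiles L -> closed_rect (unit_square R) p ->
  exists r, [/\ r \in L, ndg r & closed_rect r p].
Proof.
move=> tL [/= /andP[px0 px1] /andP[py0 py1]]; apply: contrapT => H.
(* Points on the upper and right sides of the square lie in no half-open tile. They are approached
   from inside the half-open square: a rectangle whose closure misses [p] misses [q e] for all small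
   [e]. *)
pose q (e : R) := ((1 - e) * p.1, (1 - e) * p.2).
have [r rL|e e0 He] := @eventually_all _ L (fun r e => ~~ in_half_open (q e) r).
  case: (boolP (ndg r)) => nr; last first.
    by exists 1 => // e' _; apply: contra nr; exact: in_half_open_ndg.
  have : ~ (rx0 r <= p.1 <= rx1 r /\ ry0 r <= p.2 <= ry1 r) by move=> h; apply: H; exists r.
  have [h1|h1] := ltP p.1 (rx0 r).
    exists 1 => // e' /andP[? ?]; apply/negP => /andP[/= /andP[h _] _]; nra.
  have [h2|h2] := ltP (rx1 r) p.1.
    exists (p.1 - rx1 r); first lra.
    by move=> e' /andP[? ?]; apply/negP => /andP[/= /andP[_ h] _]; nra.
  have [h3|h3] := ltP p.2 (ry0 r).
    exists 1 => // e' /andP[? ?]; apply/negP => /andP[/= _ /andP[h _]]; nra.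
  have [h4|h4] := ltP (ry1 r) p.2.
    exists (p.2 - ry1 r); first lra.
    by move=> e' /andP[? ?]; apply/negP => /andP[/= _ /andP[_ h]]; nra.
  by move=> nh; exfalso; apply: nh; split; apply/andP; split.
pose e' : R := Num.min (e / 2) 2^-1.
have e'0 : 0 < e' by rewrite lt_min; apply/andP; split; lra.
have e'1 : e' <= 2^-1 by rewrite ge_min lexx orbT.
have e'e : e' <= e / 2 by rewrite ge_min lexx.
have [|r rL qr] := @tiles_exists L (q e') tL.
  by rewrite /in_half_open /=; apply/andP; split; apply/andP; split; nra.
have : ~~ in_half_open (q e') r by apply: He => //; rewrite e'0 /=; lra.
by rewrite qr.
Qed.

Lemma separated_disjoint q r p : separated q r -> closed_rect q p -> open_rect r p -> False.
Proof.
by move=> /or4P h [/= /andP[? ?] /andP[? ?]] [/= /andP[? ?] /andP[? ?]]; case: h => h; lra.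
Qed.

Lemma tiles_separated L r q : tiles L -> r \in L -> q \in L -> r <> q ->
  ndg r -> ndg q -> separated q r.
Proof.
move=> tL rL qL nrq /andP[rx ry] /andP[qx qy]; rewrite /separated.
apply: contraT; rewrite !negb_or -!ltNge => /and4P[h1 h2 h3 h4].
case: nrq; pose p := (Num.max (rx0 r) (rx0 q), Num.max (ry0 r) (ry0 q)).
by apply: (@tiles_mem_eq L r q p tL rL qL); rewrite /in_half_open /= !le_max !gt_max !lexx ?orbT
  ?rx ?ry ?qx ?qy ?h1 ?h2 ?h3 ?h4.
Qed.

Lemma tiles_uniq L : tiles L -> all ndg L -> uniq L.
Proof.
move=> tL /allP nL; apply/negPn/negP => nu.
have [r rL] : exists2 r, r \in L & (1 < count_mem r L)%N.
  apply: contrapT => H; apply: (negP nu); apply: (@count_mem_uniq _ L) => r.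
  case: (boolP (r \in L)) => rL; last exact/count_memPn.
  apply/eqP; rewrite eqn_leq -has_count has_pred1 rL andbT leqNgt; apply/negP => h.
  by apply: H; exists r.
have pr := corner_in_half_open (nL r rL); apply/negP; rewrite -leqNgt.
have : (count_mem r L <= count (in_half_open (rx0 r, ry0 r)) L)%N.
  by apply: sub_count => q /= /eqP ->.
by rewrite tL (tiles_in_unit tL rL pr).
Qed.

(** Here [q] may be degenerate: a segment must not enter the interior of a nondegenerate rectangle.
    Partition counts alone do not see such segments. *)
Definition separated_list L := forall r q, r \in L -> q \in L -> ndg r -> q = r \/ separated q r.

Lemma tiles_separated_list L : tiles L -> all ndg L -> separated_list L.
Proof.
move=> tL /allP nL r q rL qL nr; have [->|/eqP h] := eqVneq q r; first by left.
by right; apply: tiles_separated tL rL qL _ nr (nL q qL) => e; apply: h.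
Qed.

Lemma rect_boundary_closed r p : rect_boundary r p -> closed_rect r p.
Proof. by case. Qed.

Lemma valid_rect_sub r p : valid_rect r -> closed_rect r p -> closed_rect (unit_square R) p.
Proof.
move=> /and5P[a b c e /andP[f g]] [/andP[h i] /andP[j k]]; split=> /=; apply/andP; split; lra.
Qed.

(** A boundary point of a degenerate rectangle lies in some closed nondegenerate one by covering and
    not in its interior by separation, hence on its boundary. *)
Lemma skel_filter L : tiles L -> all valid_rect L -> separated_list L ->
  skel [seq r <- L | ndg r] = skel L.
Proof.
move=> tL /allP vL sL; apply/seteqP; split=> p [bp|[r rL br]]; [by left| |by left|].
  by right; exists r => //; move: rL; rewrite mem_filter => /andP[].
have [r' [r'L nr' cr']] := tiles_cover tL (valid_rect_sub (vL r rL) (rect_boundary_closed br)).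
right; case: (sL r' r r'L rL nr') => [e|s].
  by exists r => //; rewrite mem_filter rL e nr'.
exists r'; first by rewrite mem_filter nr'.
split=> // o; exact: separated_disjoint s (rect_boundary_closed br) o.
Qed.

Lemma skel_disjoint_open L r p : tiles L -> all ndg L -> r \in L -> skel L p -> open_rect r p -> False.
Proof.
move=> tL nL rL; have nr := allP nL r rL; have vr := tiles_valid tL rL nr.
move=> [[_ n]|[q qL bq]] o.
  apply: n; move: vr => /and5P[a b c e /andP[f g]]; case: o => /andP[? ?] /andP[? ?].
  by split=> /=; apply/andP; split; lra.
case: (tiles_separated_list tL nL rL qL nr) => [e|s].
  by case: bq => _; rewrite e; apply.
exact: separated_disjoint s (rect_boundary_closed bq) o.
Qed.

Lemma rect_boundaryP r p : rect_boundary r p <-> closed_rect r p /\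
  [\/ p.1 = rx0 r, p.1 = rx1 r, p.2 = ry0 r | p.2 = ry1 r].
Proof.
split=> -[[/andP[h1 h2] /andP[h3 h4]] H]; (split; first by split; apply/andP).
  have [e|e] := eqVneq p.1 (rx0 r); first by constructor 1.
  have [e1|e1] := eqVneq p.1 (rx1 r); first by constructor 2.
  have [e2|e2] := eqVneq p.2 (ry0 r); first by constructor 3.
  have [e3|e3] := eqVneq p.2 (ry1 r); first by constructor 4.
  exfalso; apply: H; split; apply/andP; split; rewrite lt_neqAle.
  - by rewrite eq_sym e.
  - by rewrite e1.
  - by rewrite eq_sym e2.
  - by rewrite e3.
by move=> [/andP[? ?] /andP[? ?]]; case: H => H; lra.
Qed.

(** If corresponding sides differed, one of them would meet the interior of the other rectangle on
    the horizontal or vertical line through [c]. *)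
Lemma rect_eq_of_overlap r r' c : open_rect r c -> open_rect r' c ->
  (forall p, rect_boundary r p -> ~ open_rect r' p) ->
  (forall p, rect_boundary r' p -> ~ open_rect r p) -> r = r'.
Proof.
case: r r' c => [a b e f] [a' b' e' f'] [x y] [/= /andP[h1 h2] /andP[h3 h4]] [/= /andP[g1 g2] /andP[g3 g4]] H1 H2.
have K (u v : R) : (u < v -> False) -> (v < u -> False) -> u = v.
  by move=> p q; case: (ltgtP u v) => // [/p|/q].
have bd (u v s t z w : R) : u <= z -> z <= v -> s <= w -> w <= t ->
    [\/ z = u, z = v, w = s | w = t] -> rect_boundary (Rect u v s t) (z, w).
  by move=> ? ? ? ? H; apply/rect_boundaryP; split=> //; split; apply/andP.
have op (u v s t z w : R) : u < z -> z < v -> s < w -> w < t -> open_rect (Rect u v s t) (z, w).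
  by move=> ? ? ? ?; split; apply/andP.
congr Rect; apply: K => h.
- by apply: (H2 (a', y)); [apply: bd; try lra; constructor 1|apply: op; lra].
- by apply: (H1 (a, y)); [apply: bd; try lra; constructor 1|apply: op; lra].
- by apply: (H1 (b, y)); [apply: bd; try lra; constructor 2|apply: op; lra].
- by apply: (H2 (b', y)); [apply: bd; try lra; constructor 2|apply: op; lra].
- by apply: (H2 (x, e')); [apply: bd; try lra; constructor 3|apply: op; lra].
- by apply: (H1 (x, e)); [apply: bd; try lra; constructor 3|apply: op; lra].
- by apply: (H1 (x, f)); [apply: bd; try lra; constructor 4|apply: op; lra].
- by apply: (H2 (x, f')); [apply: bd; try lra; constructor 4|apply: op; lra].
Qed.

(** The tile [r'] of [M] at the lower left corner of [r] overlaps [r]. No boundary of either tiling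
    enters the interior of a tile of the other, as the skeleta agree, so the two tiles coincide. *)
Lemma skel_sub L M : tiles L -> tiles M -> all ndg L -> all ndg M -> skel L = skel M ->
  {subset L <= M}.
Proof.
move=> tL tM nL nM LM r rL; have nr := allP nL r rL.
have pu := tiles_in_unit tL rL (corner_in_half_open nr).
have [r' r'M pr'] := tiles_exists tM pu; suff -> : r = r' by [].
move: pr' => /andP[/= /andP[h1 h2] /andP[h3 h4]].
move: (nr) => /andP[x01 y01].
(* A common interior point: halfway from the corner of [r] to the nearer of the two upper right ends
   in each direction. *)
pose c := ((rx0 r + Num.min (rx1 r) (rx1 r')) / 2, (ry0 r + Num.min (ry1 r) (ry1 r')) / 2).
have m1 : rx0 r < Num.min (rx1 r) (rx1 r') by rewrite lt_min x01.
have m2 : ry0 r < Num.min (ry1 r) (ry1 r') by rewrite lt_min y01.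
have [m3 m4] : Num.min (rx1 r) (rx1 r') <= rx1 r /\ Num.min (rx1 r) (rx1 r') <= rx1 r'.
  by rewrite !ge_min !lexx orbT.
have [m5 m6] : Num.min (ry1 r) (ry1 r') <= ry1 r /\ Num.min (ry1 r) (ry1 r') <= ry1 r'.
  by rewrite !ge_min !lexx orbT.
apply: (@rect_eq_of_overlap _ _ c).
- by split; rewrite /c /=; apply/andP; split; lra.
- by split; rewrite /c /=; apply/andP; split; lra.
- move=> p bp o; apply: (skel_disjoint_open tM nM r'M _ o).
  by rewrite -LM; right; exists r.
- move=> p bp o; apply: (skel_disjoint_open tL nL rL _ o).
  by rewrite LM; right; exists r'.
Qed.

Lemma skel_inj L M : tiles L -> tiles M -> all ndg L -> all ndg M -> skel L = skel M ->
  perm_eq L M.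
Proof.
move=> tL tM nL nM LM; apply: uniq_perm; [exact: tiles_uniq|exact: tiles_uniq|move=> r].
by apply/idP/idP; apply: skel_sub.
Qed.

Lemma skel_perm L M : perm_eq L M -> skel L = skel M.
Proof.
move=> /perm_mem LM; apply/seteqP; split=> p [?|[r rL br]]; try by left.
  by right; exists r => //; rewrite -LM.
by right; exists r => //; rewrite LM.
Qed.

Lemma tiling_tiles N (t : 'I_N -> rect R) : is_tiling N t ->
  let L := [seq t i | i <- enum 'I_N] in
  [/\ tiles L, all ndg L, size L = N & skel L = skeleton N t].
Proof.
move=> [nt dt ct] L.
have nL : all ndg L by apply/allP => _ /mapP[i _ ->]; apply/andP; exact: nt.
have sub i p : closed_rect (t i) p -> closed_rect (unit_square R) p.
  by rewrite -ct => h; exists i.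
have unitP i p : in_half_open p (t i) -> in_half_open p (unit_square R).
  move=> /andP[/andP[h1 h2] /andP[h3 h4]]; have [n1 n2] := nt i.
  have [/= /andP[u1 _] /andP[u2 _]] : closed_rect (unit_square R) (rx0 (t i), ry0 (t i)).
    by apply: (sub i); split=> /=; rewrite lexx ltW.
  have [/= /andP[_ u3] /andP[_ u4]] : closed_rect (unit_square R) (rx1 (t i), ry1 (t i)).
    by apply: (sub i); split=> /=; rewrite lexx ltW.
  by rewrite /in_half_open /=; apply/andP; split; apply/andP; split; lra.
split=> //; last first.
- apply/seteqP; split=> p [h|]; try by left.
    by move=> [_ /mapP[i _ ->] b]; right; exists i.
  by move=> [i _ b]; right; exists (t i) => //; apply: map_f; rewrite mem_enum.
- by rewrite size_map size_enum_ord.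
move=> p; rewrite count_map enumT.
have -> : count (preim t (in_half_open p)) (Finite.enum 'I_N) = #|[pred i | in_half_open p (t i)]|.
  by rewrite cardE -size_filter; congr size; apply: eq_filter.
have uni i j : in_half_open p (t i) -> in_half_open p (t j) -> i = j.
  move=> /andP[/andP[h1 h2] /andP[h3 h4]] /andP[/andP[g1 g2] /andP[g3 g4]].
  apply/eqP; apply: contraT => ij; have := dt i j ij => /seteqP[] h _; exfalso.
  pose mx := Num.min (rx1 (t i)) (rx1 (t j)); pose my := Num.min (ry1 (t i)) (ry1 (t j)).
  have m1 : p.1 < mx by rewrite lt_min h2.
  have m2 : p.2 < my by rewrite lt_min h4.
  have [m3 m4] : mx <= rx1 (t i) /\ mx <= rx1 (t j) by rewrite !ge_min !lexx orbT.
  have [m5 m6] : my <= ry1 (t i) /\ my <= ry1 (t j) by rewrite !ge_min !lexx orbT.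
  by apply: (h ((p.1 + mx) / 2, (p.2 + my) / 2)); split; split=> /=; apply/andP; split; lra.
case: (boolP (in_half_open p (unit_square R))) => pu; last first.
  rewrite eq_card0 // => i; rewrite !inE; apply/negbTE; apply: contra pu; exact: unitP.
suff [i pi] : exists i, in_half_open p (t i).
  apply/eqP; rewrite (@eq_card _ _ (pred1 i)) ?card1 // => j; rewrite !inE.
  by apply/idP/eqP => [pj|->//]; exact: uni.
apply: contrapT => H; move: pu => /andP[/= /andP[p1 p2] /andP[p3 p4]].
(* A closed tile containing points arbitrarily close to [p] in the direction (1, 1) contains [p] in
   the half-open sense; closed tiles do cover these nearby points. *)
have [i _|e e0 He] := @eventually_all _ (enum 'I_N) (fun i (e : R) => ~ closed_rect (t i) (p.1 + e, p.2 + e)).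
  clear ct; have : ~~ in_half_open p (t i) by apply/negP => h; apply: H; exists i.
  rewrite /in_half_open !negb_and -!leNgt -!ltNge => /orP[] /orP[] h.
  - by exists (rx0 (t i) - p.1); [lra|move=> e' /andP[? ?] [/= /andP[? ?] _]; lra].
  - by exists 1 => // e' /andP[? ?] [/= /andP[? ?] _]; lra.
  - by exists (ry0 (t i) - p.2); [lra|move=> e' /andP[? ?] [_ /= /andP[? ?]]; lra].
  - by exists 1 => // e' /andP[? ?] [_ /= /andP[? ?]]; lra.
pose m := Num.min (e / 2) (Num.min (1 - p.1) (1 - p.2)).
have m0 : 0 < m by rewrite !lt_min; apply/and3P; split; lra.
have m1 : m <= e / 2 by rewrite ge_min lexx.
have m2 : m <= Num.min (1 - p.1) (1 - p.2) by rewrite ge_min lexx orbT.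
have [m3 m4] : m <= 1 - p.1 /\ m <= 1 - p.2 by move: m2; rewrite le_min => /andP.
have : closed_rect (unit_square R) (p.1 + m, p.2 + m).
  by split=> /=; apply/andP; split; lra.
rewrite -ct => -[i _ ci]; apply: (He i m) ci; first by rewrite mem_enum.
by rewrite m0 /=; lra.
Qed.

Lemma tiles_tiling L : tiles L -> all ndg L ->
  is_tiling (size L) (tnth (in_tuple L)) /\ skel L = skeleton (size L) (tnth (in_tuple L)).
Proof.
move=> tL nL; have uL := tiles_uniq tL nL.
have mL i : tnth (in_tuple L) i \in L by exact: mem_tnth.
split; last first.
  apply/seteqP; split=> p [h|]; try by left.
    by move=> [r /(tnthP (in_tuple L)) [i ->] b]; right; exists i.
  by move=> [i _ b]; right; exists (tnth (in_tuple L) i).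
split.
- by move=> i; apply/andP; exact: (allP nL).
- move=> i j ij; rewrite -subset0 => p [[/andP[h1 h2] /andP[h3 h4]] [/andP[g1 g2] /andP[g3 g4]]].
  have e : tnth (in_tuple L) i = tnth (in_tuple L) j.
    by apply: (@tiles_mem_eq L _ _ p tL) => //; rewrite /in_half_open ?h2 ?h4 ?g2 ?g4 !ltW.
  by move: ij; rewrite ((tuple_uniqP (in_tuple L) uL) _ _ e) eqxx.
- apply/seteqP; split=> p.
    move=> [i _ ci]; apply: valid_rect_sub ci; apply: tiles_valid tL (mL i) _.
    exact: (allP nL).
  move=> /(tiles_cover tL) [r [/(tnthP (in_tuple L)) [i ->] _ c]].
  by exists i.
Qed.

End RectangleLists.
Arguments ndg {R} r.
Arguments valid_rect {R} r.
Arguments in_half_open {R} p r.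

(** * Skeleta under the Hausdorff distance *)

Section HausdorffTopology.
Variable R : realType.
Implicit Types (r : rect R) (L M : seq (rect R)) (p : R * R) (K : set (R * R)) (e : R).

Lemma pdist_ge0 p p' : 0 <= pdist p p'.
Proof. exact: sqrtr_ge0. Qed.

Lemma pdist_sym p p' : pdist p p' = pdist p' p.
Proof. by rewrite /pdist -[in LHS](sqrrN (p.1 - _)) -[in LHS](sqrrN (p.2 - _)) !opprB. Qed.

Lemma coord_le_pdist p p' : `|p.1 - p'.1| <= pdist p p' /\ `|p.2 - p'.2| <= pdist p p'.
Proof. by split; rewrite -sqrtr_sqr ler_sqrt ?addr_ge0 ?sqr_ge0 // ?lerDl ?lerDr sqr_ge0. Qed.

Lemma pdist_le p p' : pdist p p' <= `|p.1 - p'.1| + `|p.2 - p'.2|.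
Proof.
rewrite /pdist -[leRHS]ger0_norm ?addr_ge0 // -sqrtr_sqr ler_sqrt ?sqr_ge0 //.
rewrite -(real_normK (num_real (p.1 - _))) -(real_normK (num_real (p.2 - _))).
have := normr_ge0 (p.1 - p'.1); have := normr_ge0 (p.2 - p'.2).
by move: `|_| `|_| => a b ? ?; nra.
Qed.

Lemma hausdorff_dist_sym K K' : hausdorff_dist K K' = hausdorff_dist K' K.
Proof.
have s (A : set (R * R)) p : [set pdist p0 p | p0 in A] = [set pdist p q | q in A].
  by apply/seteqP; split=> _ [q Aq <-]; exists q => //; rewrite pdist_sym.
rewrite /hausdorff_dist maxC; congr Num.max; congr sup; apply/seteqP.
  by split=> _ [p Kp <-]; exists p => //; rewrite s.
by split=> _ [p Kp <-]; exists p => //; rewrite s.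
Qed.

Let infset K p := [set pdist p q | q in K].

Let infset_lb K p : lbound (infset K p) 0.
Proof. by move=> _ [q _ <-]; exact: pdist_ge0. Qed.

Lemma hausdorff_dist_le K K' e : K !=set0 -> K' !=set0 ->
  (forall p, K p -> exists2 q, K' q & pdist p q <= e) ->
  (forall p, K' p -> exists2 q, K q & pdist p q <= e) -> hausdorff_dist K K' <= e.
Proof.
have key A B : A !=set0 -> (forall p, A p -> exists2 q, B q & pdist p q <= e) ->
    sup [set inf [set pdist p q | q in B] | p in A] <= e.
  move=> [a Aa] H; apply: ge_sup; first by exists (inf (infset B a)), a.
  move=> _ [p Ap <-]; have [q Bq pq] := H p Ap; apply: le_trans pq.
  by apply: ge_inf; [exists 0; exact: infset_lb|exists q].
move=> n1 n2 h1 h2; rewrite ge_max; apply/andP; split; first exact: key.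
rewrite (_ : [set _ | _ in K'] = [set inf [set pdist p q | q in K] | p in K']); first exact: key.
have s p : [set pdist p0 p | p0 in K] = [set pdist p q | q in K].
  by apply/seteqP; split=> _ [q Aq <-]; exists q => //; rewrite pdist_sym.
by apply/seteqP; split=> _ [p Kp <-]; exists p => //; rewrite s.
Qed.

(** Lying in the unit square bounds the infima by 2, so that the supremum in the definition is
    genuine and dominates the infimum at [p]. *)
Lemma hausdorff_dist_lt K K' e p : K !=set0 -> K' !=set0 ->
  K `<=` closed_rect (unit_square R) -> K' `<=` closed_rect (unit_square R) ->
  hausdorff_dist K K' < e -> K p -> exists2 q, K' q & pdist p q < e.
Proof.
move=> n1 [q0 Kq0] s1 s2; rewrite gt_max => /andP[h _] Kp.
have hi x : infset K' x !=set0 by exists (pdist x q0), q0.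
have le2 x : K x -> inf (infset K' x) <= 2.
  move=> Kx; apply: (@le_trans _ _ (pdist x q0)).
    by apply: ge_inf; [exists 0; exact: infset_lb|exists q0].
  apply: le_trans (pdist_le _ _) _.
  have [/= /andP[? ?] /andP[? ?]] := s1 _ Kx; have [/= /andP[? ?] /andP[? ?]] := s2 _ Kq0.
  have -> : 2 = 1 + 1 :> R by lra.
  by apply: lerD; rewrite ler_norml; apply/andP; split; lra.
have : inf (infset K' p) < e.
  apply: le_lt_trans h; apply: ub_le_sup; last by exists p.
  by exists 2 => _ [x Kx <-]; exact: le2.
move=> /(inf_lt (hi p)) [_ [q Kq <-] lt]; by exists q.

Qed.

Definition near_rect e r (q : rect R) := [/\ `|rx0 r - rx0 q| <= e, `|rx1 r - rx1 q| <= e,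
  `|ry0 r - ry0 q| <= e & `|ry1 r - ry1 q| <= e].
Definition near_list e L M := size L = size M /\ forall i, (i < size L)%N ->
  near_rect e (nth (unit_square R) L i) (nth (unit_square R) M i).

Lemma near_rect_sym e r q : near_rect e r q -> near_rect e q r.
Proof. by move=> [a b c f]; split; rewrite distrC. Qed.

Lemma near_list_sym e L M : near_list e L M -> near_list e M L.
Proof. by move=> [s h]; split=> // i; rewrite -s => /h /near_rect_sym. Qed.

Lemma boundary_near e r q p : valid_rect r -> valid_rect q -> near_rect e r q ->
  rect_boundary r p -> exists2 p', rect_boundary q p' & `|p.1 - p'.1| <= e /\ `|p.2 - p'.2| <= e.
Proof.
move=> /and5P[_ x01 _ _ /andP[y01 _]] /and5P[_ x01' _ _ /andP[y01' _]] [h1 h2 h3 h4].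
move=> /rect_boundaryP [[/andP[a1 a2] /andP[a3 a4]] side].
(* The nearby point is on the same side of [q], with the other coordinate clamped to the extent of
   [q]. *)
pose cl (a b x : R) := if x < a then a else if b < x then b else x.
have clP (a b x : R) : a <= b -> a <= cl a b x <= b.
  by rewrite /cl => ab; case: ltP => ?; [|case: ltP => ?]; apply/andP; split; lra.
have clN (a b x a' b' : R) : a <= x -> x <= b -> a' <= b' -> `|a - a'| <= e -> `|b - b'| <= e ->
    `|x - cl a' b' x| <= e.
  rewrite /cl !ler_norml => ? ? ? /andP[? ?] /andP[? ?].
  by case: ltP => ?; [|case: ltP => ?]; apply/andP; split; lra.
case: side => s.
- exists (rx0 q, cl (ry0 q) (ry1 q) p.2); last by rewrite s /=; split=> //; exact: clN h3 h4.
  by apply/rect_boundaryP; split; [split=> /=; rewrite ?lexx //; exact: clP|constructor 1].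
- exists (rx1 q, cl (ry0 q) (ry1 q) p.2); last by rewrite s /=; split=> //; exact: clN h3 h4.
  by apply/rect_boundaryP; split; [split=> /=; rewrite ?lexx ?andbT //; exact: clP|constructor 2].
- exists (cl (rx0 q) (rx1 q) p.1, ry0 q); last by rewrite s /=; split=> //; exact: clN h1 h2.
  by apply/rect_boundaryP; split; [split=> /=; rewrite ?lexx //; exact: clP|constructor 3].
- exists (cl (rx0 q) (rx1 q) p.1, ry1 q); last by rewrite s /=; split=> //; exact: clN h1 h2.
  by apply/rect_boundaryP; split; [split=> /=; rewrite ?lexx ?andbT //; exact: clP|constructor 4].
Qed.

Lemma skel_near e L M p : 0 <= e -> all valid_rect L -> all valid_rect M -> near_list e L M ->
  skel L p -> exists2 q, skel M q & pdist p q <= 2 * e.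
Proof.
move=> e0 /allP vL /allP vM [s h] [bp|[r rL bp]].
  by exists p; [left|rewrite /pdist !subrr expr0n addr0 sqrtr0; lra].
have iL : (index r L < size L)%N by rewrite index_mem.
have v2 : valid_rect (nth (unit_square R) M (index r L)) by apply: vM; rewrite mem_nth // -s.
have hr := h _ iL; rewrite nth_index // in hr.
have [p' bp' [h1 h2]] := boundary_near (vL r rL) v2 hr bp.
exists p'; first by right; exists (nth (unit_square R) M (index r L)) => //; rewrite mem_nth // -s.
by apply: le_trans (pdist_le _ _) _; lra.
Qed.

Lemma unit_boundary00 : rect_boundary (unit_square R) (0, 0).
Proof. by apply/rect_boundaryP; split; [split=> /=; rewrite lexx ler01|constructor 1]. Qed.

Lemma skel_nonempty L : skel L !=set0.
Proof. by exists (0, 0); left; exact: unit_boundary00. Qed.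

Lemma skel_sub_unit L : all valid_rect L -> skel L `<=` closed_rect (unit_square R).
Proof.
move=> /allP vL p [[]//|[r rL /rect_boundary_closed]]; exact: valid_rect_sub (vL _ rL).
Qed.

Lemma hausdorff_near e L M : 0 <= e -> all valid_rect L -> all valid_rect M -> near_list e L M ->
  hausdorff_dist (skel L) (skel M) <= 2 * e.
Proof.
move=> e0 vL vM LM; apply: hausdorff_dist_le; try exact: skel_nonempty.
  by move=> p; exact: skel_near.
by move=> p; apply: skel_near => //; exact: near_list_sym.
Qed.

Lemma rect_boundary_set_closed r : closed (rect_boundary r).
Proof.
rewrite /rect_boundary setDE; apply: closedI.
  rewrite (_ : closed_rect r = `[rx0 r, rx1 r]%classic `*` `[ry0 r, ry1 r]%classic).
    by apply: closed_setX; exact: interval_closed.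
  by apply/seteqP; split=> p; rewrite /closed_rect /= !in_itv.
apply: open_closedC.
rewrite (_ : open_rect r = `]rx0 r, rx1 r[%classic `*` `]ry0 r, ry1 r[%classic).
  rewrite (_ : _ `*` _ = fst @^-1` `]rx0 r, rx1 r[%classic `&` snd @^-1` `]ry0 r, ry1 r[%classic) //.
  by apply: openI; apply: open_comp => [p _|]; [exact: cvg_fst|exact: interval_open|exact: cvg_snd|exact: interval_open].
by apply/seteqP; split=> p; rewrite /open_rect /= !in_itv.
Qed.

Lemma skel_closed L : closed (skel L).
Proof.
apply: closedU; first exact: rect_boundary_set_closed.
elim: L => [|r L IH].
  by rewrite (_ : [set p | _] = set0); [exact: closed0|apply/seteqP; split=> p [] ?].
rewrite (_ : [set p | _] = rect_boundary r `|` [set p | exists2 r, r \in L & rect_boundary r p]).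
  by apply: closedU => //; exact: rect_boundary_set_closed.
apply/seteqP; split=> p.
  by move=> [q]; rewrite inE => /orP[/eqP ->|qL] b; [left|right; exists q].
by move=> [b|[q qL b]]; [exists r => //; exact: mem_head|exists q => //; rewrite inE qL orbT].
Qed.

Variable n : nat.
Notation T := (tiling_space R n).

Lemma tiling_space_list (x : T) : exists L, [/\ tiles L, all ndg L, (size L <= n)%N & sval x = skel L].
Proof.
case: x => K /= [N [t [Nn [tt ->]]]].
by have [a b c e] := tiling_tiles tt; exists [seq t i | i <- enum 'I_N]; rewrite c e.
Qed.

Lemma tiling_space_sub (x : T) : sval x !=set0 /\ sval x `<=` closed_rect (unit_square R).
Proof.
have [L [tL nL _ ->]] := tiling_space_list x; split; first exact: skel_nonempty.
apply: skel_sub_unit; apply/allP => r rL; exact: tiles_valid tL rL (allP nL r rL).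
Qed.

Lemma tiling_space_hausdorff : hausdorff_space T.
Proof.
pose md (p q : R * R) : R := Num.max `|p.1 - q.1| `|p.2 - q.2|.
have tri (p q q' : R * R) : md p q' <= md p q + pdist q q'.
  have [h1 h2] := coord_le_pdist q q'; rewrite ge_max; apply/andP; split.
    apply: le_trans (ler_distD q.1 _ _) _; apply: lerD => //; by rewrite le_max lexx.
  by apply: le_trans (ler_distD q.2 _ _) _; apply: lerD => //; rewrite le_max lexx orbT.
have sep (x y : T) p : sval x p -> ~ sval y p -> exists A B : set T,
    [/\ open A, open B, A x, B y & A `&` B = set0].
  move=> xp yp; have [L [_ _ _ yL]] := tiling_space_list y.
  have /nbhs_ballP [e /= e0 H] : nbhs p (~` sval y).
    by apply: open_nbhs_nbhs; split=> //; apply: closed_openC; rewrite yL; exact: skel_closed.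
  have far q : sval y q -> e <= md p q.
    move=> yq; rewrite leNgt; apply/negP; rewrite gt_max => /andP[h1 h2].
    by have := H q; apply => //; split.
  exists [set z : T | exists2 q, sval z q & md p q < e / 3].
  (* The margin [eta], which depends on [z], makes the condition of staying away from [p] an open
     one. *)
  exists [set z : T | exists2 eta : R, 0 < eta & forall q, sval z q -> e / 3 + eta <= md p q].
  split=> /=.
  - move=> z [q zq pq]; exists (e / 3 - md p q); first by rewrite subr_gt0.
    move=> z' zz'; have [nz sz] := tiling_space_sub z; have [nz' sz'] := tiling_space_sub z'.
    have [q' z'q' qq'] := hausdorff_dist_lt nz nz' sz sz' zz' zq.
    by exists q' => //; apply: le_lt_trans (tri p q q') _; lra.
  - move=> z [eta eta0 Hz]; exists (eta / 2); first by lra.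
    move=> z' zz'; have [nz sz] := tiling_space_sub z; have [nz' sz'] := tiling_space_sub z'.
    exists (eta / 2) => [|q' z'q']; first by lra.
    rewrite hausdorff_dist_sym in zz'.
    have [q zq qq'] := hausdorff_dist_lt nz' nz sz' sz zz' z'q'.
    by have := tri p q' q; have := Hz q zq; lra.
  - by exists p => //; rewrite /md !subrr normr0 maxxx divr_gt0.
  - by exists (e / 3) => [|q yq]; [lra|have := far q yq; lra].
  - apply/seteqP; split=> z // [[q zq h1] [eta eta0 h2]].
    by have := h2 q zq; lra.
rewrite open_hausdorff => x y xy.
have [p [[xp yp]|[yp xp]]] : exists p, (sval x p /\ ~ sval y p) \/ (sval y p /\ ~ sval x p).
  apply: contrapT => H; move: xy => /eqP; apply.
  have e : sval x = sval y.
    apply/seteqP; split=> p xp; apply: contrapT => yp; apply: H; exists p; [by left|by right].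
  by case: x y e {H} => [a ax] [b bx] /= e; move: ax bx; rewrite e => ax bx; congr exist; exact: Prop_irrelevance.
  have [A [B [oA oB Ax By AB]]] := sep x y p xp yp.
  by exists (A, B); [split; exact: mem_set|split=> //; apply/eqP].
have [A [B [oA oB Ax By AB]]] := sep y x p yp xp.
by exists (B, A); [split; exact: mem_set|split=> //; apply/eqP; rewrite setIC].
Qed.

Lemma lipschitz_clc d (g : seqspace R -> T) (C : R) : 0 < C ->
  (forall w w' e, cube d w -> cube d w' -> 0 < e -> (forall k, (k < d)%N -> `|w k - w' k| <= e) ->
    hausdorff_dist (sval (g w)) (sval (g w')) <= C * e) -> clc (cube d) g.
Proof.
move=> C0 H; apply/clcP; first exact: cube_closed.
apply/subspace_continuousP => w cw U /=; rewrite nbhsE => -[V [oV Vw] VU].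
have [e e0 He] := oV _ Vw.
have e'0 : 0 < e / (2 * C) by rewrite divr_gt0 // mulr_gt0.
have near_w : nbhs w [set w' | forall k : 'I_d, `|w k - w' k| < e / (2 * C)].
  apply: (@filter_forall _ _ (fun (k : 'I_d) => [set w' | `|w k - w' k| < e / (2 * C)]) (nbhs w)) => k.
  have h := @nbhsx_ballx R R (w k) _ e'0.
  exact: (@continuous_coord R k w _ h).
apply: filterS near_w => w' hw' cw'; apply/VU/He.
apply: le_lt_trans (H w w' (e / (2 * C)) cw cw' e'0 _) _.
  by move=> k kd; exact: ltW (hw' (Ordinal kd)).
by rewrite (_ : C * (e / (2 * C)) = e / 2); [lra|field; rewrite gt_eqF].
Qed.

End HausdorffTopology.

(** * Operations and codes *)

Inductive op := Hcut of nat | Strip of nat & nat | Sigma.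
HB.instance Definition _ := gen_eqMixin op.
HB.instance Definition _ := gen_choiceMixin op.

(* A code describes a tiling by peeling off rectangles at the right side; the
   last operation is the head of the list. The rectangles along the right side are
   numbered from bottom to top: [Hcut k] cuts the k-th one by a horizontal line,
   [Strip k i] cuts off the right ends of i of them, from the k-th on, and replaces
   these by one rectangle, and [Sigma] squeezes the tiling and adds a rectangle of
   full height. Reading left coordinates from bottom to top, [first_peak c] is the
   index of the first one that is not smaller than its successor. *)
Definition first_peak (c : seq op) : nat :=
  match c with Hcut k :: _ => k | Strip k _ :: _ => k | _ => 0 end.
Fixpoint right_count (c : seq op) : nat :=
  match c with
  | [::] => 1
  | Hcut _ :: c' => (right_count c').+1
  | Strip _ i :: c' => (right_count c' - i).+1
  | Sigma :: _ => 1
  end.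
(** The bounds on [k] make the new first peak sit at [k]: left coordinates must ascend up to the
    rectangle that is cut, or up to the one below the strip. A strip in front of the whole right
    side is excluded, as that is the task of [Sigma]. *)
Definition admissible (o : op) (c : seq op) : bool :=
  match o with
  | Hcut k => (k <= first_peak c)%N
  | Strip k i => [&& (k <= (first_peak c).+1)%N, (0 < i)%N, (k + i <= right_count c)%N & (i < right_count c)%N]
  | Sigma => true
  end.
Fixpoint code_ok (c : seq op) : bool :=
  if c is o :: c' then admissible o c' && code_ok c' else true.

(** * Tilings built from codes *)

Section States.
Variable R : realType.
Implicit Types (r q : rect R) (A B L M : seq (rect R)) (p : R * R) (s : R).
Notation u := (unit_square R).
(** The first list holds the rectangles along the right side from bottom to top, the second all
    others. *)
Definition state := (seq (rect R) * seq (rect R))%type.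
Implicit Type S : state.

Definition left_coord A j := rx0 (nth u A j).
Definition max_left A : R := foldr (fun r m => Num.max (rx0 r) m) 0 A.
(** The [i] rectangles to be trimmed together with the neighbours below and above. For [k = 0] there
    is none below, so one element fewer is taken. *)
Definition window k i A := take (i.+2 - (k == 0%N)) (drop k.-1 A).
(** The left end of a strip ranges from the largest left coordinate in the window to the right side.
    Counting the neighbours in makes the strip a strict peak at interior parameters. *)
Definition strip_left k i s A : R := max_left (window k i A) + s * (1 - max_left (window k i A)).
Definition cut_low s r := Rect (rx0 r) (rx1 r) (ry0 r) (ry0 r + s * (ry1 r - ry0 r)).
Definition cut_high s r := Rect (rx0 r) (rx1 r) (ry0 r + s * (ry1 r - ry0 r)) (ry1 r).
Definition trim a r := Rect (rx0 r) a (ry0 r) (ry1 r).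
Definition squeeze s r := Rect (s * rx0 r) (s * rx1 r) (ry0 r) (ry1 r).

Definition apply_op o s S : state :=
  let: (A, B) := S in
  match o with
  | Hcut k => (take k A ++ cut_low s (nth u A k) :: cut_high s (nth u A k) :: drop k.+1 A, B)
  | Strip k i =>
      let M := take i (drop k A) in let a := strip_left k i s A in
      (take k A ++ Rect a 1 (ry0 (head u M)) (ry1 (last u M)) :: drop (k + i) A,
       map (trim a) M ++ B)
  | Sigma => ([:: Rect s 1 0 1], map (squeeze s) (A ++ B))
  end.

Definition half (x : R) : R := (x + 1) / 2.

Fixpoint build (c : seq op) (w : nat -> R) : state :=
  if c is o :: c' then apply_op o (half (w 0)) (build c' (fun k => w k.+1)) else ([:: u], [::]).

Definition rects S := S.1 ++ S.2.

Fixpoint stack (y : R) A (y' : R) : Prop :=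
  if A is r :: A' then ry0 r = y /\ stack (ry1 r) A' y' else y = y'.

Lemma stack_cat y A B y' : stack y (A ++ B) y' <-> exists2 z, stack y A z & stack z B y'.
Proof.
elim: A y => [|r A IH] y /=.
  by split=> [h|[z -> //]]; exists y.
split=> [[-> /IH [z h1 h2]]|[z [-> h1] h2]]; first by exists z.
by split=> //; apply/IH; exists z.
Qed.

Lemma stack_ends y A y' : stack y A y' -> A != [::] -> ry0 (head u A) = y /\ ry1 (last u A) = y'.
Proof.
elim: A y => //= r A IH y [<- h] _; split=> //.
by case: A h IH => [//|q A] h IH; case: (IH _ h isT).
Qed.

Lemma max_left_ge A r : r \in A -> rx0 r <= max_left A.
Proof.
elim: A => //= q A IH; rewrite inE => /orP[/eqP ->|/IH h]; first by rewrite le_max lexx.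
by rewrite le_max h orbT.
Qed.

Lemma max_left_ge0 A : 0 <= max_left A.
Proof. by elim: A => //= r A IH; rewrite le_max IH orbT. Qed.

Lemma max_left_le A (b : R) : 0 <= b -> (forall r, r \in A -> rx0 r <= b) -> max_left A <= b.
Proof.
move=> b0; elim: A => //= r A IH H; rewrite ge_max H ?mem_head //=.
by apply: IH => q qA; apply: H; rewrite inE qA orbT.
Qed.

Lemma max_left_attained A : max_left A = 0 \/ exists2 r, r \in A & max_left A = rx0 r.
Proof.
elim: A => [|r A IH] /=; first by left.
case: leP => h; last by right; exists r => //; exact: mem_head.
by case: IH => [->|[q qA ->]]; [left|right; exists q => //; rewrite inE qA orbT].
Qed.

Lemma window_nth k i A j : (k.-1 <= j <= k + i)%N -> (j < size A)%N -> nth u A j \in window k i A.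
Proof.
move=> /andP[h1 h2] h3; rewrite /window.
have e : nth u A j = nth u (take (i.+2 - (k == 0%N)) (drop k.-1 A)) (j - k.-1).
  rewrite nth_take; last by case: k h1 h2 => [|k] /=; lia.
  by rewrite nth_drop subnKC.
rewrite e mem_nth // size_take size_drop.
by case: ifP => _; case: k h1 h2 {e} => [|k] /=; lia.
Qed.

Lemma mem_window k i A r : r \in window k i A ->
  exists j, [/\ (k.-1 <= j <= k + i)%N, (j < size A)%N & r = nth u A j].
Proof.
move=> /(nthP u) [j]; rewrite /window size_take size_drop => hj.
rewrite nth_take ?nth_drop => [<-|]; last by move: hj; case: ifP; lia.
exists (k.-1 + j)%N; case: k hj => [|k] /= hj; split=> //.
- by move: hj; rewrite subn1 /=; case: ifP; lia.
- by move: hj; case: ifP; lia.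
- by move: hj; rewrite subn0; case: ifP; lia.
- by move: hj; case: ifP; lia.
Qed.

Definition slopes_weak k A :=
  (forall j, (j < k)%N -> left_coord A j <= left_coord A j.+1) /\
  ((k.+1 < size A)%N -> left_coord A k.+1 <= left_coord A k).
(** Only the ascent becomes strict in open cells: after [Hcut] the peak and its successor have equal
    left coordinates. *)
Definition slopes_strict k A :=
  (forall j, (j < k)%N -> left_coord A j < left_coord A j.+1) /\
  ((k.+1 < size A)%N -> left_coord A k.+1 <= left_coord A k).

Record good c S : Prop := Good {
  good_count : size S.1 = right_count c;
  good_size : size (rects S) = (size c).+1;
  good_stack : stack 0 S.1 1;
  good_right : forall r, r \in S.1 -> rx1 r = 1;
  good_tiles : tiles (rects S);
  good_valid : all valid_rect (rects S);
  good_peak : (first_peak c < right_count c)%N;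
  good_slopes : slopes_weak (first_peak c) S.1 }.

Lemma in_half_open_cut p s r : 0 <= s <= 1 -> ry0 r <= ry1 r ->
  (in_half_open p r = in_half_open p (cut_low s r) + in_half_open p (cut_high s r) :> nat)%N.
Proof.
move=> /andP[s0 s1] y01; rewrite /in_half_open /=; case: (_ <= p.1 < _) => //=.
have h1 : ry0 r <= ry0 r + s * (ry1 r - ry0 r) by rewrite lerDl mulr_ge0 // subr_ge0.
have h2 : ry0 r + s * (ry1 r - ry0 r) <= ry1 r by nra.
move: (ry0 r + _) h1 h2 => c h1 h2.
case: (ltP p.2 c) => hc.
  by rewrite (lt_le_trans hc h2) ?andbT ?andbF /=; case: (ry0 r <= p.2).
by rewrite (le_trans h1 hc) ?andbF ?andbT.
Qed.

Lemma stack_le y A y' : (forall r, r \in A -> ry0 r <= ry1 r) -> stack y A y' -> y <= y'.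
Proof.
elim: A y => [|r A IH] y H /=; first by move=> ->.
move=> [<- h]; apply: le_trans (H r (mem_head _ _)) _; apply: IH h => q qA.
by apply: H; rewrite inE qA orbT.
Qed.

(** The line at [a] splits every half-open rectangle of the stack in two, and the right parts add up
    to a single rectangle. *)
Lemma count_trim p a b y A y' : a <= b ->
  (forall r, r \in A -> [/\ ry0 r <= ry1 r, rx1 r = b & rx0 r <= a]) -> stack y A y' ->
  (count (in_half_open p) A =
   count (in_half_open p) (map (trim a) A) + in_half_open p (Rect a b y y'))%N.
Proof.
move=> ab; elim: A y => [|r A IH] y H /=.
  by move=> ->; rewrite /in_half_open /=; case: (leP y' p.2); rewrite ?andbF //= => ->; rewrite andbF.
move=> [<- h]; have [y01 rb ra] := H r (mem_head _ _).
have H' q : q \in A -> [/\ ry0 q <= ry1 q, rx1 q = b & rx0 q <= a].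
  by move=> qA; apply: H; rewrite inE qA orbT.
rewrite (IH _ H' h); have y12 : ry1 r <= y' by apply: stack_le h => q /H' [].
suff : (in_half_open p r + in_half_open p (Rect a b (ry1 r) y') =
        in_half_open p (trim a r) + in_half_open p (Rect a b (ry0 r) y'))%N by lia.
rewrite /in_half_open /= rb; case: (ltP p.1 a) => pa /=.
  by rewrite (lt_le_trans pa ab) ?andbT ?andbF /= -[RHS]/(_ + 0)%N addn0; case: (rx0 r <= p.1).
rewrite ?andbF (le_trans ra pa) /=; case: (p.1 < b) => //=.
case: (ltP p.2 (ry1 r)) => hc; first by rewrite (lt_le_trans hc y12) ?andbT ?andbF /=; case: (ry0 r <= p.2).
by rewrite (le_trans y01 hc) ?andbF ?andbT.
Qed.

Lemma count_squeeze p s L : 0 <= s <= 1 -> tiles L ->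
  (count (in_half_open p) (map (squeeze s) L) + in_half_open p (Rect s 1 0 1) = in_half_open p u)%N.
Proof.
move=> /andP[s0 s1] tL; rewrite count_map.
have [->|sn] := eqVneq s 0.
  rewrite (eq_count (a2 := pred0)) ?count_pred0 // => r /=.
  by rewrite /in_half_open /= !mul0r; case: (leP 0 p.1); rewrite ?andbF //= => ->; rewrite andbF.
have sp : 0 < s by rewrite lt_def sn.
rewrite (eq_count (a2 := in_half_open (p.1 / s, p.2))) => [|r]; last first.
  by rewrite /in_half_open /= ler_pdivlMr // ltr_pdivrMr // ![_ * s]mulrC.
rewrite tL /in_half_open /= ler_pdivlMr // mul0r ltr_pdivrMr // mul1r.
case: (0 <= p.2 < 1); rewrite ?andbF ?andbT //=.
case: (ltP p.1 s) => h; first by rewrite (lt_le_trans h s1) ?andbT ?andbF /= addn0.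
by rewrite (le_trans s0 h) ?andbF ?andbT.
Qed.

End States.

(** * Invariants of closed and of open cells *)

Section Invariants.
Variable R : realType.
Implicit Types (r : rect R) (A B L M : seq (rect R)) (p : R * R) (s : R) (S : state R).
Notation u := (unit_square R).

Lemma split_nth A k : (k < size A)%N -> A = take k A ++ nth u A k :: drop k.+1 A.
Proof. by move=> h; rewrite -drop_nth // cat_take_drop. Qed.

Lemma split_three A k i : A = take k A ++ take i (drop k A) ++ drop (k + i) A.
Proof. by rewrite addnC -drop_drop cat_take_drop cat_take_drop. Qed.

Lemma good_left c S r : good c S -> r \in S.1 -> [/\ 0 <= rx0 r, rx0 r <= 1, 0 <= ry0 r, ry0 r <= ry1 r & ry1 r <= 1].
Proof.
move=> g rA; have /and5P[a b _ e /andP[f h]] : valid_rect r.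
  by apply: (allP (good_valid g)); rewrite mem_cat rA.
by split=> //; rewrite -(good_right g rA).
Qed.

Lemma good_max_left c S L : good c S -> {subset L <= S.1} -> 0 <= max_left L <= 1.
Proof.
move=> g LA; rewrite max_left_ge0 max_left_le // => r /LA rA.
by have [] := good_left g rA.
Qed.

(** The rectangles to be trimmed occupy the heights from [y] to [y']; the stacks below and above
    complete the right side. *)
Record strip_spec k i s (S : state R) (y y' : R) : Prop := StripSpec {
  strip_size1 : size (take k S.1) = k;
  strip_size2 : size (take i (drop k S.1)) = i;
  strip_max : 0 <= max_left (window k i S.1) <= 1;
  strip_ge : max_left (window k i S.1) <= strip_left k i s S.1;
  strip_le1 : strip_left k i s S.1 <= 1;
  strip_left_ge : forall j, (k.-1 <= j <= k + i)%N -> (j < size S.1)%N -> left_coord S.1 j <= max_left (window k i S.1);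
  strip_stack1 : stack 0 (take k S.1) y;
  strip_stack2 : stack y (take i (drop k S.1)) y';
  strip_stack3 : stack y' (drop (k + i) S.1) 1;
  strip_y : ry0 (head u (take i (drop k S.1))) = y;
  strip_y' : ry1 (last u (take i (drop k S.1))) = y';
  strip_mid_le : forall r, r \in take i (drop k S.1) -> rx0 r <= max_left (window k i S.1);
  strip_ys : [/\ 0 <= y, y <= y' & y' <= 1] }.

Lemma window_sub k i A : {subset window k i A <= A}.
Proof. by move=> r /mem_take /mem_drop. Qed.

Lemma strip_facts c S k i s : good c S -> admissible (Strip k i) c -> 0 <= s <= 1 ->
  exists y y', strip_spec k i s S y y'.
Proof.
move=> g /and4P[h1 h2 h3 h4] /andP[s0 s1].
have sA := good_count g; set A := S.1 in sA.
have mm : 0 <= max_left (window k i A) <= 1 by apply: (good_max_left g); exact: window_sub.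
have := good_stack g; rewrite -/A [X in stack 0 X _](split_three A k i).
move=> /stack_cat [y st1 /stack_cat [y' st2 st3]].
have sz1 : size (take k A) = k by rewrite size_takel // sA; lia.
have sz2 : size (take i (drop k A)) = i by rewrite size_takel // size_drop sA; lia.
have nM : take i (drop k A) != [::] by rewrite -size_eq0 sz2 -lt0n.
have [e1 e2] := stack_ends st2 nM.
have MA r : r \in take i (drop k A) -> r \in A by move=> /mem_take /mem_drop.
have wl j : (k.-1 <= j <= k + i)%N -> (j < size A)%N -> left_coord A j <= max_left (window k i A).
  by move=> ? ?; apply: max_left_ge; exact: window_nth.
exists y, y'; move/andP: (mm) => [m0 m1]; split=> //; rewrite -/A //.
- by rewrite lerDl mulr_ge0 // subr_ge0.
- by rewrite /strip_left; nra.
- move=> r /(nthP u) [j]; rewrite sz2 => ji <-; rewrite nth_take // nth_drop.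
  by apply: wl; [lia|rewrite sA; lia].
have y01 : y <= y' by apply: stack_le st2 => r /MA rA; have [] := good_left g rA.
split=> //.
- rewrite -e1; have [] // := @good_left c S (head u (take i (drop k A))) g.
  by apply: MA; rewrite -nth0 mem_nth // sz2.
- rewrite -e2; have [] // := @good_left c S (last u (take i (drop k A))) g.
  by apply: MA; rewrite -nth_last mem_nth // sz2 prednK.
Qed.

Lemma good_strip c S k i s : good c S -> admissible (Strip k i) c -> 0 <= s <= 1 ->
  good (Strip k i :: c) (apply_op (Strip k i) s S).
Proof.
case: S => A B g adm s01; have /and4P[h1 h2 h3 h4] := adm.
have N1 : (k < (right_count c - i).+1)%N by lia.
have N2 j : (j.+1 < k)%N -> (j < first_peak c)%N by lia.
have N3 j : (j < k)%N -> (k <= j.+1)%N -> [/\ j.+1 = k, (k.-1 <= j <= k + i)%N & (j < right_count c)%N] by split; lia.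
have N4 : (k.-1 <= k + i <= k + i)%N by lia.
have [y [y' sp]] := strip_facts g adm s01.
have sA := good_count g; have sAB := good_size g; rewrite /rects /= size_cat in sA sAB.
case: sp => /= sz1 sz2 mm mge a1 wl st1 st2 st3 e1 e2 ml [y0 y01 y1].
set a := strip_left k i s A in mge a1 *.
set M := take i (drop k A) in sz2 st2 e1 e2 ml *.
set m := max_left _ in mm mge wl ml; move/andP: mm => [m0 m1].
have MA r : r \in M -> r \in A by move=> /mem_take /mem_drop.
have A1A r : r \in take k A -> r \in A by move=> /mem_take.
have A2A r : r \in drop (k + i) A -> r \in A by move=> /mem_drop.
have vr := allP (good_valid g).
rewrite /apply_op -/M -/a e1 e2.
split=> /=.
- by rewrite size_cat sz1 /= size_drop sA; move: h3; clear; lia.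
- by rewrite /rects /= !size_cat /= size_map sz1 sz2 size_drop sA; move: sAB h3; rewrite sA; clear; lia.
- by apply/stack_cat; exists y.
- move=> r; rewrite mem_cat inE => /orP[/A1A rA|/orP[/eqP -> //|/A2A rA]];
    exact: (good_right g).
- move=> p; rewrite /rects /= !(count_cat, map_cat) /=.
  rewrite -(good_tiles g p) /rects /= count_cat [in RHS](split_three A k i) !count_cat -/M.
  rewrite (@count_trim _ p a 1 y M y') //.
    move: (count _ (take k A)) (nat_of_bool (in_half_open p _)) (count _ (drop _ A)).
    by move: (count _ (map (trim a) M)) (count _ B); clear; lia.
  move=> r rM; have [] := good_left g (MA r rM) => _ _ _ h _; split=> //.
    exact: (good_right g (MA r rM)).
  exact: le_trans (ml r rM) mge.
- apply/allP => r; rewrite /rects /= !mem_cat in_cons -!orbA.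
  move=> /or4P[/A1A rA|/eqP ->|/A2A rA|/orP[/mapP[q qM ->]|rB]].
  + by apply: vr; rewrite mem_cat rA.
  + by rewrite /valid_rect /= (le_trans m0 mge) a1 y0 y01 y1 lexx.
  + by apply: vr; rewrite mem_cat rA.
  + have := vr q; rewrite mem_cat (MA q qM) => /(_ isT) /and5P[b1 b2 b3 b4 /andP[b5 b6]].
    by rewrite /valid_rect /= b1 b4 b5 b6 a1 (le_trans (ml q qM) mge).
  + by apply: vr; rewrite mem_cat rB orbT.
- exact: N1.
have nl j : (j < k)%N -> left_coord (take k A ++ Rect a 1 y y' :: drop (k + i) A) j = left_coord A j.
  by move=> jk; rewrite /left_coord nth_cat sz1 jk nth_take.
have nk : left_coord (take k A ++ Rect a 1 y y' :: drop (k + i) A) k = a.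
  by rewrite /left_coord nth_cat sz1 ltnn subnn.
have nk1 : left_coord (take k A ++ Rect a 1 y y' :: drop (k + i) A) k.+1 = left_coord A (k + i).
  by rewrite /left_coord nth_cat sz1 ltnNge leqnSn /= subSnn /= nth_drop addn0.
split=> [j jk|].
  rewrite (nl j jk); case: (ltnP j.+1 k) => jk1.
    by rewrite (nl _ jk1); have [sl _] := good_slopes g; apply: sl; exact: N2.
  have [jk2 n1 n2] := N3 j jk jk1.
  rewrite jk2 nk; apply: le_trans mge; by apply: wl; rewrite ?sA.
rewrite size_cat sz1 /= size_drop sA => hk; rewrite nk nk1; apply: le_trans mge.
by apply: wl => //=; rewrite sA; move: hk; clear; lia.
Qed.

Lemma good_hcut c S k s : good c S -> admissible (Hcut k) c -> 0 <= s <= 1 ->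
  good (Hcut k :: c) (apply_op (Hcut k) s S).
Proof.
case: S => A B g /= h1 s01; have N2 j : (j < k)%N -> (j < first_peak c)%N by lia.
have N1 : (k < (right_count c).+1)%N by have := good_peak g; lia.
have sA := good_count g; have sAB := good_size g; rewrite /rects /= size_cat in sA sAB.
have pk := good_peak g; have kA : (k < size A)%N by rewrite sA; lia.
set r := nth u A k; have rA : r \in A by exact: mem_nth.
have [x0 x1 y0 y01 y1] := good_left g rA; have rr := good_right g rA.
have sz1 : size (take k A) = k by rewrite size_takel // ltnW.
have EA := split_nth kA; rewrite -/r in EA.
have A1A q : q \in take k A -> q \in A by move=> /mem_take.
have A2A q : q \in drop k.+1 A -> q \in A by move=> /mem_drop.
have vr := allP (good_valid g).
have cb : ry0 r <= ry0 r + s * (ry1 r - ry0 r) <= ry1 r by move/andP: s01 => [? ?]; apply/andP; split; nra.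
split=> /=.
- by rewrite size_cat sz1 /= size_drop; move: kA; rewrite sA; clear; lia.
- by rewrite /rects /= !size_cat /= sz1 size_drop; move: kA sAB; clear; lia.
- have st := good_stack g; rewrite /= EA in st.
  by move/stack_cat: st => [z st1 [st2 st3]]; apply/stack_cat; exists z.
- move=> q; rewrite mem_cat !inE => /orP[/A1A qA|/or3P[/eqP ->|/eqP ->|/A2A qA]] //=;
    exact: (good_right g).
- move=> p; rewrite /rects /= !count_cat /= -(good_tiles g p) /rects /= count_cat [in RHS]EA count_cat /= -/r.
  rewrite (in_half_open_cut p s01 y01).
  move: (count _ (take k A)) (nat_of_bool (in_half_open p (cut_low s r))).
  move: (nat_of_bool (in_half_open p (cut_high s r))).
  by move: (count _ (drop _ A)) (count _ B); clear; lia.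
- apply/allP => q; rewrite /rects /= !mem_cat !inE -!orbA.
  move=> /or4P[/A1A qA|/eqP ->|/eqP ->|/orP[/A2A qA|qB]].
  + by apply: vr; rewrite mem_cat qA.
  + by move/andP: cb => [? ?]; rewrite /valid_rect /= x0 rr x1 lexx y0 /=; apply/andP; split=> //; lra.
  + by move/andP: cb => [? ?]; rewrite /valid_rect /= x0 rr x1 lexx /=; apply/and3P; split=> //; lra.
  + by apply: vr; rewrite mem_cat qA.
  + by apply: vr; rewrite mem_cat qB orbT.
- exact: N1.
set A' := _ ++ _.
have nl j : (j <= k)%N -> left_coord A' j = left_coord A j.
  rewrite leq_eqVlt /left_coord nth_cat sz1 => /orP[/eqP ->|jk]; first by rewrite ltnn subnn.
  by rewrite jk nth_take.
split=> [j jk|_].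
  by rewrite !nl // 1?ltnW //; have [sl _] := good_slopes g; apply: sl; exact: N2.
by rewrite [leRHS]nl // /left_coord nth_cat sz1 ltnNge leqnSn /= subSnn.
Qed.

Lemma good_sigma c S s : good c S -> 0 <= s <= 1 -> good (Sigma :: c) (apply_op Sigma s S).
Proof.
case: S => A B g s01; have sAB := good_size g; rewrite /rects /= in sAB.
move/andP: (s01) => [s0 s1].
split=> //=.
- by rewrite /rects /= size_map sAB.
- by move=> r; rewrite inE => /eqP ->.
- move=> p; rewrite /rects /= -(count_squeeze p s01 (good_tiles g)) addnC //.
- apply/andP; split; first by rewrite /valid_rect /= s0 s1 !lexx ler01.
  apply/allP => _ /mapP[q qL ->].
  have /and5P[b1 b2 b3 b4 /andP[b5 b6]] := allP (good_valid g) q qL.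
  by rewrite /valid_rect /= b4 b5 b6 !andbT; apply/and3P; split; nra.
Qed.

Lemma good_apply o c S s : good c S -> admissible o c -> 0 <= s <= 1 -> good (o :: c) (apply_op o s S).
Proof.
case: o => [k|k i|]; [exact: good_hcut|exact: good_strip|move=> g _; exact: good_sigma].
Qed.

Lemma good_start : good [::] (([:: u], [::]) : state R).
Proof.
split=> //=.
- by move=> r; rewrite inE => /eqP ->.
- by move=> p; rewrite /= addn0.
- by rewrite /rects /= /valid_rect /= !lexx ler01.
Qed.

Lemma half_itv (x : R) : `|x| <= 1 -> 0 <= half x <= 1.
Proof. by rewrite ler_norml /half => /andP[? ?]; apply/andP; split; lra. Qed.

Lemma half_oitv (x : R) : `|x| < 1 -> 0 < half x < 1.
Proof. by rewrite ltr_norml /half => /andP[? ?]; apply/andP; split; lra. Qed.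

Definition in_box d (w : nat -> R) := forall k, (k < d)%N -> `|w k| <= 1.
Definition in_obox d (w : nat -> R) := forall k, (k < d)%N -> `|w k| < 1.

Lemma obox_box d w : in_obox d w -> in_box d w.
Proof. by move=> h k kd; exact/ltW/h. Qed.

Lemma good_build c w : code_ok c -> in_box (size c) w -> good c (build c w).
Proof.
elim: c w => [|o c IH] w /=; first by move=> _ _; exact: good_start.
move=> /andP[adm ok] bw; apply: good_apply => //; first by apply: IH => // k kd; exact: bw.
exact/half_itv/bw.
Qed.

(* The strict inequalities that hold in open cells. *)
Record regular c S : Prop := Regular {
  regular_good : good c S;
  regular_ndg : all ndg (rects S);
  regular_slopes : slopes_strict (first_peak c) S.1;
  regular_head : if c is Strip _ _ :: _ then ((first_peak c).+1 < size S.1)%N ->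
    left_coord S.1 (first_peak c).+1 < left_coord S.1 (first_peak c) else True }.

Lemma regular_apply o c S s : regular c S -> admissible o c -> 0 < s < 1 ->
  regular (o :: c) (apply_op o s S).
Proof.
move=> rg adm s01; have g := regular_good rg; have s01' : 0 <= s <= 1 by move/andP: s01 => [/ltW -> /ltW ->].
have g' := good_apply g adm s01'; have nd := allP (regular_ndg rg).
have [sl1 sl2] := regular_slopes rg; move/andP: s01 => [s0 s1].
case: o adm g' => [k|k i|] adm g'.
- have N2 j : (j < k)%N -> (j < first_peak c)%N by move: adm; rewrite /=; clear; lia.
  case: S rg g g' nd sl1 sl2 => A B rg g g' nd sl1 sl2.
  have sA := good_count g; have pk := good_peak g; rewrite /= in sA adm.
  have kA : (k < size A)%N by rewrite sA; apply: leq_ltn_trans pk.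
  set r := nth u A k; have rA : r \in A by exact: mem_nth.
  have /andP[nx ny] : ndg r by apply: nd; rewrite mem_cat rA.
  have sz1 : size (take k A) = k by rewrite size_takel // ltnW.
  split=> //.
    apply/allP => q; rewrite /rects /= -/r !mem_cat !inE -!orbA.
    move=> /or4P[/mem_take qA|/eqP ->|/eqP ->|/orP[/mem_drop qA|qB]].
    + by apply: nd; rewrite mem_cat qA.
    + by rewrite /ndg /= nx ltrDl mulr_gt0 // subr_gt0.
    + by rewrite /ndg /= nx; nra.
    + by apply: nd; rewrite mem_cat qA.
    + by apply: nd; rewrite mem_cat qB orbT.
  split; last by case: (good_slopes g').
  have nl j : (j <= k)%N -> left_coord (apply_op (Hcut k) s (A, B)).1 j = left_coord A j.
    rewrite /= leq_eqVlt /left_coord nth_cat sz1 => /orP[/eqP ->|jk]; first by rewrite ltnn subnn.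
    by rewrite jk nth_take.
  by move=> j jk; rewrite !nl //; [exact/sl1/N2|exact: ltnW].
- have /and4P[h1 h2 h3 h4] := adm.
  have N2 j : (j.+1 < k)%N -> (j < first_peak c)%N by move: h1; clear; lia.
  have N3 j : (j < k)%N -> (k <= j.+1)%N -> [/\ j.+1 = k, (k.-1 <= j <= k + i)%N & (j < right_count c)%N].
    by move: h1 h2 h3; clear; split; lia.
  have N4 : (k.-1 <= k + i <= k + i)%N by clear; lia.
  have [y [y' sp]] := strip_facts g adm s01'.
  have ya : y < y'.
    case: sp => _ sz2 _ _ _ _ _ st2 _ _ _ _ _;     case: (take i (drop k S.1)) sz2 st2 (fun r => @mem_take i _ (drop k S.1) r) => [e|q M] /=; first by move: h2; rewrite -e.
    move=> _ [<- h] sub; have nM r : r \in q :: M -> ndg r.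
      by move=> /sub /mem_drop rA; apply: nd; rewrite mem_cat rA.
    have /andP[_ nq] := nM q (mem_head _ _); apply: lt_le_trans nq _.
    by apply: stack_le h => r rM; have /nM /andP[_ /ltW] : r \in q :: M by rewrite inE rM orbT.
  case: S rg g g' nd sl1 sl2 sp => A B rg g g' nd sl1 sl2 sp.
  have sA := good_count g; rewrite /= in sA.
  case: sp => /= sz1 sz2 mm mge a1 wl st1 st2 st3 e1 e2 ml [y0 y01 y1].
  have m1 : max_left (window k i A) < 1.
    case: (max_left_attained (window k i A)) => [->|[q /window_sub qA ->]]; first exact: ltr01.
    by rewrite -(good_right g qA); have /nd /andP[] : q \in rects (A, B) by rewrite mem_cat qA.
  have alt : strip_left k i s A < 1 by rewrite /strip_left; nra.
  have agt : max_left (window k i A) < strip_left k i s A by rewrite ltrDl mulr_gt0 // subr_gt0.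
  set a := strip_left k i s A in mge a1 alt agt g' *.
  have nl j : (j < k)%N -> left_coord (apply_op (Strip k i) s (A, B)).1 j = left_coord A j.
    by move=> jk; rewrite /= /left_coord nth_cat sz1 jk nth_take.
  have nk : left_coord (apply_op (Strip k i) s (A, B)).1 k = a.
    by rewrite /= /left_coord nth_cat sz1 ltnn subnn.
  have nk1 : left_coord (apply_op (Strip k i) s (A, B)).1 k.+1 = left_coord A (k + i).
    by rewrite /= /left_coord nth_cat sz1 ltnNge leqnSn /= subSnn /= nth_drop addn0.
  split=> //.
  + apply/allP => r; rewrite /rects /= e1 e2 -/a !mem_cat inE -!orbA.
    move=> /or4P[/mem_take rA|/eqP ->|/mem_drop rA|/orP[/mapP[q qM ->]|rB]].
    * by apply: nd; rewrite mem_cat rA.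
    * by rewrite /ndg /= alt.
    * by apply: nd; rewrite mem_cat rA.
    * have /andP[_ qy] : ndg q by apply: nd; rewrite mem_cat (mem_drop (mem_take qM)).
      by rewrite /ndg /= qy andbT (le_lt_trans (ml q qM)).
    * by apply: nd; rewrite mem_cat rB orbT.
  + split; last by case: (good_slopes g').
    move=> j jk; rewrite (nl j jk); case: (ltnP j.+1 k) => jk1.
      by rewrite (nl _ jk1); exact/sl1/N2.
    have [jk2 n1 n2] := N3 j jk jk1.
    rewrite jk2 nk; apply: le_lt_trans agt; by apply: wl; rewrite ?sA.
  + rewrite [first_peak _]/= nk nk1 => hk; apply: le_lt_trans agt; apply: wl => //=.
    by move: hk; rewrite /= size_cat sz1 /= size_drop sA; clear; lia.
- case: S rg g g' nd sl1 sl2 => A B rg g g' nd sl1 sl2; split=> //.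
  apply/allP => r; rewrite /rects /= inE => /orP[/eqP ->|/mapP[q qL ->]].
    by rewrite /ndg /= s1 ltr01.
  by have /andP[nx ny] := nd q qL; rewrite /ndg /= ny ltr_pM2l // nx.
Qed.

Lemma regular_build c w : code_ok c -> in_obox (size c) w -> regular c (build c w).
Proof.
elim: c w => [|o c IH] w /=.
  by move=> _ _; split=> //; [exact: good_start|rewrite /rects /= /ndg /= ltr01].
move=> /andP[adm ok] bw; apply: regular_apply => //; first by apply: IH => // k kd; exact: bw.
exact/half_oitv/bw.
Qed.

End Invariants.

(** * Comparing two codes of the same tiling *)

Section Comparison.
Variable R : realType.
Implicit Types (r q : rect R) (A B L M : seq (rect R)) (S T : state R).
Notation u := (unit_square R).

Lemma stack_lt y A y' : all ndg A -> stack y A y' -> A != [::] -> y < y'.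
Proof.
case: A => //= r A /andP[/andP[_ yr] nA] [<- st] _; apply: lt_le_trans yr _.
by apply: stack_le st => q /(allP nA) /andP[_ /ltW].
Qed.

(** The lowest rectangles of the two stacks share a point at height [y], hence are equal, and both
    stacks go on from the same height. *)
Lemma stack_unique L (b y y' : R) A B : tiles L -> {subset A <= L} -> {subset B <= L} ->
  all ndg A -> all ndg B -> (forall r, r \in A -> rx1 r = b) -> (forall r, r \in B -> rx1 r = b) ->
  stack y A y' -> stack y B y' -> A = B.
Proof.
move=> tL; elim: A y B => [|r A IH] y [|q B] //= AL BL nA nB bA bB.
- by move=> -> [e st]; have := @stack_lt y' (q :: B) y' nB (conj e st) isT; rewrite ltxx.
- by move=> [e st] ey; have := @stack_lt y (r :: A) y' nA (conj e st) isT; rewrite ey ltxx.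
move=> [er str] [eq stq].
have [rL qL] : r \in L /\ q \in L by split; [apply: AL|apply: BL]; exact: mem_head.
move/andP: nA => [/andP[rx ry] nA]; move/andP: nB => [/andP[qx qy] nB].
have rq : r = q.
  apply: (@tiles_mem_eq _ L r q (Num.max (rx0 r) (rx0 q), y) tL) => //.
    by rewrite /in_half_open /= le_max lexx gt_max rx bA ?mem_head // -(bB q) ?mem_head // qx -er lexx ry.
  by rewrite /in_half_open /= le_max lexx orbT gt_max qx bB ?mem_head // -(bA r) ?mem_head // rx -eq lexx qy.
congr cons => //; apply: (IH (ry1 r)) => //.
- by move=> x xA; apply: AL; rewrite inE xA orbT.
- by move=> x xB; apply: BL; rewrite inE xB orbT.
- by move=> x xA; apply: bA; rewrite inE xA orbT.
- by move=> x xB; apply: bB; rewrite inE xB orbT.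
- by rewrite rq.
Qed.

Lemma right_side_unique c S L A B : good c S -> tiles L -> all ndg L ->
  perm_eq (rects S) L -> perm_eq (A ++ B) L -> stack 0 A 1 -> (forall r, r \in A -> rx1 r = 1) ->
  S.1 = A /\ perm_eq S.2 B.
Proof.
move=> g tL nL SL AL st r1.
have sub1 : {subset S.1 <= L} by move=> r rS; rewrite -(perm_mem SL) mem_cat rS.
have sub2 : {subset A <= L} by move=> r rS; rewrite -(perm_mem AL) mem_cat rS.
have e : S.1 = A.
  apply: (stack_unique tL sub1 sub2 _ _ (good_right g) r1 (good_stack g) st).
    by apply/allP => r /sub1; exact: (allP nL).
  by apply/allP => r /sub2; exact: (allP nL).
split=> //; have := perm_trans SL (etrans (perm_sym _ _) AL).
by rewrite /rects e perm_cat2l.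
Qed.

Lemma half_inj : injective (@half R).
Proof. by rewrite /half => x y e; lra. Qed.

Lemma affine_inj (m s s' : R) : m < 1 -> m + s * (1 - m) = m + s' * (1 - m) -> s = s'.
Proof. by move=> m1 /addrI /mulIf; apply; rewrite subr_eq0 gt_eqF. Qed.

Lemma squeeze_inj (s : R) : 0 < s -> injective (squeeze s).
Proof.
move=> s0 [a b c d] [a' b' c' d'] [] e1 e2 -> ->.
by congr Rect; apply: (@mulfI _ s) => //; rewrite gt_eqF.
Qed.

Lemma hcut_peel k s s' S T c c' : (k < size S.1)%N -> (k < size T.1)%N -> good c S -> regular c' T ->
  0 <= s <= 1 ->
  (apply_op (Hcut k) s S).1 = (apply_op (Hcut k) s' T).1 ->
  perm_eq (apply_op (Hcut k) s S).2 (apply_op (Hcut k) s' T).2 ->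
  perm_eq (rects S) (rects T) /\ s = s'.
Proof.
case: S T => A B [A' B'] /= kA kA' g rg s01.
move=> /eqP; rewrite eqseq_cat ?size_takel // 1?ltnW // => /andP[/eqP e1 /eqP [a1 a2 a3 a4 _ _ _ a8 e3]] pB.
have e : nth u A k = nth u A' k.
  move: (nth u A k) (nth u A' k) a1 a2 a3 a8 => [x0 x1 y0 y1] [z0 z1 t0 t1] /=.
  by move=> -> -> -> ->.
have /andP[_ ny] : ndg (nth u A' k) by apply: (allP (regular_ndg rg)); rewrite mem_cat mem_nth.
have AA : A = A' by rewrite (split_nth kA) (split_nth kA') e1 e e3.
split; first by rewrite /rects /= AA perm_cat2l.
move: a4; rewrite e => /addrI /mulIf; apply; rewrite subr_eq0.
by rewrite gt_eqF.
Qed.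

Lemma trim1_inj (a : R) A B : (forall r, r \in A -> rx1 r = 1) -> (forall r, r \in B -> rx1 r = 1) ->
  map (trim a) A = map (trim a) B -> A = B.
Proof.
elim: A B => [|r A IH] [|q B] //= A1 B1 [e1 e2 e3 e].
congr cons.
  have := A1 r (mem_head _ _); have := B1 q (mem_head _ _).
  by move: r q e1 e2 e3 {A1 B1} => [x0 x1 y0 y1] [z0 z1 t0 t1] /= -> -> -> -> ->.
by apply: IH e => x xA; [apply: A1|apply: B1]; rewrite inE xA orbT.
Qed.

Lemma regular_max_left c T k i : regular c T -> max_left (window k i T.1) < 1.
Proof.
move=> rg; case: (max_left_attained (window k i T.1)) => [->|[q /window_sub qA ->]]; first exact: ltr01.
rewrite -(good_right (regular_good rg) qA).
by have /(allP (regular_ndg rg)) /andP[] : q \in rects T by rewrite mem_cat qA.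
Qed.

(** The trimmed rectangles are recovered as the stack ending at the left side of the strip, whence
    [i = i']. Trimming is undone because they ended at 1 before, and the parameter is recovered
    because the largest left coordinate in the window is below 1 in an open cell. *)
Lemma strip_peel k i i' s s' S T c c' : good c S -> regular c' T ->
  admissible (Strip k i) c -> admissible (Strip k i') c' -> 0 <= s <= 1 -> 0 < s' < 1 ->
  (apply_op (Strip k i) s S).1 = (apply_op (Strip k i') s' T).1 ->
  perm_eq (apply_op (Strip k i) s S).2 (apply_op (Strip k i') s' T).2 ->
  [/\ i = i', perm_eq (rects S) (rects T) & s = s'].
Proof.
move=> g rg ad ad' s01 s01'; have g' := regular_good rg.
have s01'' : 0 <= s' <= 1 by move/andP: s01' => [/ltW -> /ltW ->].
have ro := regular_apply rg ad' s01'; have go := good_apply g ad s01.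
have [y [y' sp]] := strip_facts g ad s01; have [z [z' sp']] := strip_facts g' ad' s01''.
case: S T g rg go ro g' sp sp' => A B [A' B'] g rg go ro g' sp sp' e1 pB.
have /and4P[_ _ k1 _] := ad; have /and4P[_ _ k2 _] := ad'.
have sA := good_count g; have sA' := good_count g'; rewrite /= in sA sA'.
have szk : size (take k A) = size (take k A').
  by rewrite (strip_size1 sp) (strip_size1 sp').
move: (e1) => /= /eqP; rewrite eqseq_cat // => /andP[/eqP eA1 /eqP []].
rewrite (strip_y sp) (strip_y sp') (strip_y' sp) (strip_y' sp') => ea ey ey' eA2.
have tL := good_tiles (regular_good ro); have nL := regular_ndg ro.
have eM : map (trim (strip_left k i s A)) (take i (drop k A)) =
          map (trim (strip_left k i' s' A')) (take i' (drop k A')).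
  have mid (M : seq (rect R)) a x x' : stack x M x' -> stack x (map (trim a) M) x'.
    by elim: M x => //= r M IH x [<- /IH].
  have sub2 : {subset map (trim (strip_left k i' s' A')) (take i' (drop k A')) <=
     rects (apply_op (Strip k i') s' (A', B'))} by move=> r rM; rewrite /rects /= !mem_cat rM !orbT.
  have sub1 : {subset map (trim (strip_left k i s A)) (take i (drop k A)) <=
     rects (apply_op (Strip k i') s' (A', B'))}.
    by move=> r rM; rewrite mem_cat -(perm_mem pB) /= !mem_cat rM /= !orbT.
  apply: (stack_unique (b := strip_left k i s A) (y := y) (y' := y') tL sub1 sub2).
  - by apply/allP => r /sub1; exact: (allP nL).
  - by apply/allP => r /sub2; exact: (allP nL).
  - by move=> _ /mapP[r _ ->].
  - by move=> _ /mapP[r _ ->] /=; rewrite ea.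
  - exact: mid (strip_stack2 sp).
  - by rewrite ey ey'; exact: mid (strip_stack2 sp').
have ii : i = i'.
  have := congr1 size eM; rewrite !size_map.
  by have := strip_size2 sp; have := strip_size2 sp'; rewrite /= => -> ->.
move: pB; rewrite /= eM perm_cat2l => pB.
rewrite ea in eM; have {}eM : take i (drop k A) = take i' (drop k A').
  by apply: trim1_inj eM => r /mem_take /mem_drop; [exact: (good_right g)|exact: (good_right g')].
have AA : A = A' by rewrite (split_three A k i) (split_three A' k i') eA1 eM eA2.
split=> //; first by rewrite /rects /= AA perm_cat2l.
move: ea; rewrite /strip_left AA ii; apply: affine_inj.
exact: (regular_max_left k i' rg).
Qed.

(** Peaks are compared first, then [Hcut] counts less than [Strip]: degeneration goes down in this
    order. The number [i] does not enter, since the tiling determines it. *)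
Definition digit (o : op) : nat := match o with Sigma => 0 | Hcut k => k.*2.+1 | Strip k _ => k.*2.+2 end.
Fixpoint rank (b : nat) (c : seq op) : nat :=
  if c is o :: c' then (digit o * b ^ size c' + rank b c')%N else 0.

Definition sigma_headed (c : seq op) : bool := if c is Sigma :: _ then true else false.

Lemma right_count_le c : (0 < right_count c <= (size c).+1)%N.
Proof. by elim: c => //= -[k|k i|] c IH /=; lia. Qed.

Lemma digit_le o c : code_ok (o :: c) -> (digit o <= (size c).*2.+4)%N.
Proof.
have := right_count_le c; case: o => [k|k i|] //= rc /andP[adm ok].
  suff: (first_peak c <= size c)%N by lia.
  by elim: c {rc adm} ok => //= -[k'|k' i|] c IH //= /andP[adm /IH]; [|move: adm => /and4P[]]; lia.
by have /and4P[] := adm; lia.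
Qed.

Lemma rank_lt b c : ((size c).*2.+4 < b)%N -> code_ok c -> (rank b c < b ^ size c)%N.
Proof.
elim: c => [|o c IH] //= hb ok; have := digit_le ok; move: ok => /andP[_ ok].
have := IH _ ok; rewrite expnS => /(_ _) h1 h2; have {}h1 := h1 (ltac:(lia)).
move: (b ^ size c)%N (rank b c) h1 => e k h1; move: (digit o) h2 => x h2.
suff : (x * e + e <= b * e)%N by lia.
by rewrite -mulSnr leq_mul2r; apply/orP; right; lia.
Qed.

Lemma rank_digit_lt b o c o' c' : ((size c).*2.+4 < b)%N -> code_ok c' -> size c' = size c ->
  (digit o' < digit o)%N -> (rank b (o' :: c') < rank b (o :: c))%N.
Proof.
move=> hb ok e h /=; have hb' : ((size c').*2.+4 < b)%N by rewrite e.
have := rank_lt hb' ok; rewrite e; move: (b ^ size c)%N (rank b c') (rank b c) => x y z h1.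
have : (digit o' * x + x <= digit o * x)%N by rewrite -mulSnr leq_mul2r h orbT.
by lia.
Qed.

(** The point is on the closed cell of [c] and in the open cell of [c']. Left coordinates ascend
    weakly up to the peak of [c] but strictly up to that of [c'], so the latter is not higher. At
    equal peaks a [Strip] may look like a [Hcut], when its left end is level with its successor, but
    not conversely. If the digits agree, the operation is undone on both sides and the rest is
    compared. A single rectangle on the right side betrays [Sigma]. *)
Theorem build_compare b c c' (w w' : nat -> R) : ((size c).*2.+4 < b)%N ->
  code_ok c -> code_ok c' -> size c' = size c -> in_box (size c) w -> in_obox (size c) w' ->
  perm_eq (rects (build c w)) (rects (build c' w')) ->
  sigma_headed c' = sigma_headed c /\ ((c' = c /\ forall k, (k < size c)%N -> w k = w' k) \/ (rank b c' < rank b c)%N).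
Proof.
elim: c c' w w' => [|o c IH] [|o' c'] //= w w' hb.
  by move=> _ _ _ _ _ _; split=> //; left.
move=> /andP[ad ok] /andP[ad' ok'] [sz] bw bw' pm.
have gT : good c (build c (fun k => w k.+1)) by apply: good_build => // k kd; exact: bw.
have rT : regular c' (build c' (fun k => w' k.+1)).
  by apply: regular_build => //; rewrite sz => k kd; exact: bw'.
set S := build c _ in gT pm; set T := build c' _ in rT pm.
have s01 : 0 <= half (w 0) <= 1 by exact/half_itv/bw.
have s01' : 0 < half (w' 0) < 1 by exact/half_oitv/bw'.
have go := good_apply gT ad s01; have ro := regular_apply rT ad' s01'.
have nL := regular_ndg ro; have gro := regular_good ro; have tL := good_tiles gro.
have [eA pB] : (apply_op o (half (w 0)) S).1 = (apply_op o' (half (w' 0)) T).1 /\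
    perm_eq (apply_op o (half (w 0)) S).2 (apply_op o' (half (w' 0)) T).2.
  by apply: (right_side_unique go tL nL pm (perm_refl _) (good_stack gro)); exact: good_right gro.
have rc : right_count (o :: c) = right_count (o' :: c').
  by rewrite -(good_count go) -(good_count gro) eA.
have hb' : ((size c).*2.+4 < b)%N by move: hb; rewrite doubleS; clear; lia.
have recurse : o = o' -> half (w 0) = half (w' 0) -> perm_eq (rects S) (rects T) ->
    (o' :: c' = o :: c /\ forall k, (k < (size c).+1)%N -> w k = w' k) \/
    (digit o' * b ^ size c' + rank b c' < digit o * b ^ size c + rank b c)%N.
  move=> eo eh pST; have [||_ [[ec ew]|lt]] := IH c' (fun k => w k.+1) (fun k => w' k.+1) hb' ok ok' sz _ _ pST.
  - by move=> k kd; exact: bw.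
  - by move=> k kd; exact: bw'.
  - left; rewrite eo ec; split=> // -[|k] kd; [exact: half_inj|exact: ew].
  - by right; rewrite sz eo ltn_add2l.
have [_ slope] := good_slopes go; have slope1 := proj1 (good_slopes go).
have [slo' slo2'] := regular_slopes ro.
have peaks : (first_peak (o' :: c') <= first_peak (o :: c))%N.
  rewrite leqNgt; apply/negP => lt; have := slo' _ lt; rewrite -eA ltNge slope //.
  by rewrite (good_count go) rc; apply: leq_ltn_trans lt (good_peak gro).
have lower : (digit o' < digit o)%N ->
    (o' :: c' = o :: c /\ forall k, (k < (size c).+1)%N -> w k = w' k) \/
    (digit o' * b ^ size c' + rank b c' < digit o * b ^ size c + rank b c)%N.
  by move=> dl; right; exact: (rank_digit_lt hb' ok' sz dl).
have rcc := right_count_le c; have rcc' := right_count_le c'.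
case: o ad go eA pB rc recurse slope slope1 peaks lower {pm} => [k|k i|] ad go eA pB rc recurse slope slope1 peaks lower;
  case: o' ad' ro gro nL tL eA pB rc recurse slo' slo2' peaks lower => [k'|k' i'|] ad' ro gro nL tL eA pB rc recurse slo' slo2' peaks lower.
- split=> //; move: peaks => /=; rewrite leq_eqVlt => /orP[/eqP ek|lt]; last by apply: lower; move: lt; clear; rewrite /=; lia.
  rewrite {}ek in ad' ro gro eA pB recurse *.
  have kS : (k < size S.1)%N by rewrite (good_count gT); apply: leq_ltn_trans ad (good_peak gT).
  have kT : (k < size T.1)%N.
    by rewrite (good_count (regular_good rT)); apply: leq_ltn_trans ad' (good_peak (regular_good rT)).
  by have [pST es] := hcut_peel kS kT gT rT s01 eA pB; apply: recurse.
- split=> //; move: peaks => /=; rewrite leq_eqVlt => /orP[/eqP ek|lt]; last by apply: lower; move: lt; clear; rewrite /=; lia.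
  have kS : (k < size S.1)%N by rewrite (good_count gT); apply: leq_ltn_trans ad (good_peak gT).
  (* In an open cell a [Strip] is strictly ahead of its successor, whereas the halves of a
     horizontal cut are level. *)
  have := regular_head ro; rewrite -eA [first_peak _]/= ek => h; exfalso.
  have : left_coord (apply_op (Hcut k) (half (w 0)) S).1 k.+1 < left_coord (apply_op (Hcut k) (half (w 0)) S).1 k.
    apply: h; rewrite (good_count go) /= ltnS -(good_count gT) //.
  case: (S) kS => A B /= kS.
  have sz1 : size (take k A) = k by rewrite size_takel // ltnW.
  rewrite /left_coord !nth_cat sz1.
  have k1 : (k.+1 < k)%N = false by clear; lia.
  by rewrite k1 ltnn subnn subSnn /= ltxx.
- by move: rc rcc; clear; rewrite /=; lia.
- split=> //; move: peaks => /= hk; apply: lower; move: hk; clear; rewrite /=; lia.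
- split=> //; move: peaks => /=; rewrite leq_eqVlt => /orP[/eqP ek|lt]; last by apply: lower; move: lt; clear; rewrite /=; lia.
  rewrite {}ek in ad' ro gro eA pB recurse *.
  by have [ei pST es] := strip_peel gT rT ad ad' s01 s01' eA pB; rewrite ei in recurse *; apply: recurse.
- by have /and4P[_ _ _ h] := ad; move: rc h; clear; rewrite /=; lia.
- by move: rc rcc'; clear; rewrite /=; lia.
- by have /and4P[_ _ _ h] := ad'; move: rc h; clear; rewrite /=; lia.
- split=> //; apply: recurse => //.
    by case: (S) (T) eA => A B [A' B'] /= [].
  move: eA pB; rewrite /rects; case: (S) (T) => A B [A' B'] /= [e] pB.
  move: pB; rewrite e => /perm_map_inj; apply; apply: squeeze_inj; by case/andP: s01'.
Qed.

End Comparison.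

(** * Every tiling has a code *)

Section Decoding.
Variable R : realType.
Implicit Types (r q : rect R) (A B L M : seq (rect R)) (S : state R).
Notation u := (unit_square R).

(** The rectangle contains the points immediately to the left of (b, t). *)
Definition touches (b t : R) r := (rx0 r < b <= rx1 r) && (ry0 r <= t < ry1 r).

Lemma touches_exists L (b t : R) : tiles L -> 0 < b <= 1 -> 0 <= t < 1 ->
  exists2 r, r \in L & touches b t r.
Proof.
move=> tL /andP[b0 b1] t01.
have [r _|e e0 He] := @eventually_all _ _ L (fun r e => in_half_open (b - e, t) r -> touches b t r).
  have [h|h] := ltP (rx0 r) b; last first.
    by exists 1 => // e' /andP[? ?] /andP[/andP[/= ? ?] _]; lra.
  have [h1|h1] := ltP (rx1 r) b.
    exists (b - rx1 r); first lra.
    by move=> e' /andP[? ?] /andP[/andP[/= ? ?] _]; lra.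
  by exists 1 => // e' _ /andP[_ ht]; rewrite /touches h h1.
pose e' := Num.min (e / 2) b.
have e'1 : 0 < e' by rewrite lt_min b0 divr_gt0.
have [e'2 e'3] : e' <= e / 2 /\ e' <= b by rewrite !ge_min !lexx orbT.
have [|r rL pr] := @tiles_exists _ L (b - e', t) tL.
  by rewrite /in_half_open /= t01 andbT; apply/andP; split; lra.
have ee : 0 < e' < e by apply/andP; split=> //; lra.
by exists r => //; exact: (He r e' rL ee).
Qed.

Lemma touches_unique L (b t : R) r q : tiles L -> r \in L -> q \in L ->
  touches b t r -> touches b t q -> r = q.
Proof.
move=> tL rL qL /andP[/andP[a1 a2] a3] /andP[/andP[c1 c2] c3].
apply: (@tiles_mem_eq _ L r q (Num.max (rx0 r) (rx0 q), t) tL) => //; rewrite /in_half_open /=.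
  by rewrite le_max lexx gt_max a3 (lt_le_trans a1) // (lt_le_trans c1).
by rewrite le_max lexx orbT gt_max c3 (lt_le_trans a1) // (lt_le_trans c1).
Qed.

(** Climbing along the wall: the rectangle touching it at height [z] starts at [z] and ends at the
    next height to consider. The induction is on the number of rectangles that start at [z] or
    above. *)
Lemma wall_stack L (b y y' : R) : tiles L -> 0 < b <= 1 -> 0 <= y -> y < y' -> y' <= 1 ->
  (forall r t, r \in L -> y <= t < y' -> touches b t r -> [/\ rx1 r = b, y <= ry0 r & ry1 r <= y']) ->
  exists A, [/\ stack y A y', {subset A <= L} & forall r, r \in A -> rx1 r = b /\ ndg r].
Proof.
move=> tL b01 y0 yy' y'1 H.
(* The height [z] is not strictly inside the vertical extent of any rectangle touching the wall;
   this passes from [z] to the top of the next rectangle. *)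
pose nc (z : R) := forall r, r \in L -> rx0 r < b <= rx1 r -> ~ ry0 r < z < ry1 r.
have ncy : nc y.
  move=> r rL rb /andP[h1 h2].
  have [||_ h _] := H r y rL; first by rewrite lexx.
    by rewrite /touches rb (ltW h1) h2.
  by move: h1; rewrite ltNge h.
suff main n : forall z, (count (fun r => (z <= ry0 r)%R) L <= n)%N -> y <= z <= y' -> nc z ->
    exists A, [/\ stack z A y', {subset A <= L} & forall r, r \in A -> rx1 r = b /\ ndg r].
  by apply: (main (size L)); rewrite ?count_size ?lexx ?ltW.
elim: n => [|n IH] z hn /andP[yz zy'] ncz.
  have [->|nz] := eqVneq z y'; first by exists [::]; split.
  have zy : z < y' by rewrite lt_neqAle nz.
  have z01 : 0 <= z < 1 by apply/andP; split; lra.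
  have [r rL /[dup] tr /andP[rb /andP[r1 r2]]] := touches_exists tL b01 z01.
  move: hn; rewrite leqn0 => /eqP/eqP; rewrite -leqn0 leqNgt -has_count => /hasPn /(_ r rL).
  by move=> h; case: (ncz r rL rb); rewrite r2 ltNge h.
have [->|nz] := eqVneq z y'; first by exists [::]; split.
have zy : z < y' by rewrite lt_neqAle nz.
have z01 : 0 <= z < 1 by apply/andP; split; lra.
have [r rL /[dup] tr /andP[rb /andP[r1 r2]]] := touches_exists tL b01 z01.
have rz : ry0 r = z.
  apply/le_anti; rewrite r1 leNgt; apply/negP => h.
  by case: (ncz r rL rb); rewrite h.
have [|re _ ry] := H r z rL _ tr; first by rewrite yz.
have [|||A [sA AL Ab]] := IH (ry1 r).
- rewrite -ltnS; apply: leq_trans hn.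
  have -> : count (fun q => (z <= ry0 q)%R) L =
      (count (fun q => (ry1 r <= ry0 q)%R) L + count (fun q => (z <= ry0 q < ry1 r)%R) L)%N.
    elim: (L) => //= q L' ->.
    have [hq|hq] := leP (ry1 r) (ry0 q).
      by rewrite (ltW (lt_le_trans r2 hq)) /= addnA.
    by rewrite andbT add0n addnCA.
  rewrite -[X in (X <= _)%N]addn1 leq_add2l -has_count; apply/hasP; exists r => //.
  by rewrite rz lexx r2.
- by apply/andP; split=> //; lra.
- move=> q qL qb /andP[q1 q2].
  suff e : r = q by move: q2; rewrite e ltxx.
  apply: (@touches_unique L b (Num.max (ry0 q) (ry0 r)) r q) => //.
    by rewrite /touches rb le_max lexx orbT gt_max q1 rz r2.
  by rewrite /touches qb le_max lexx gt_max (lt_trans q1 q2) rz (lt_trans r2 q2).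
exists (r :: A); split=> //=.
- by move=> q; rewrite inE => /orP[/eqP ->|/AL].
- move=> q; rewrite inE => /orP[/eqP ->|/Ab //]; split=> //.
  case/andP: rb => h _; rewrite /ndg rz r2 re h //.
Qed.

Definition coded L := exists c (w : nat -> R), [/\ code_ok c, (size c).+1 = size L,
  in_obox (size c) w & perm_eq (rects (build c w)) L].

Lemma coded_apply o (s : R) c w L : code_ok c -> admissible o c -> in_obox (size c) w -> 0 < s < 1 ->
  perm_eq (rects (apply_op o s (build c w))) L -> (size c).+2 = size L -> coded L.
Proof.
move=> ok ad ow /andP[s0 s1] pL sL.
exists (o :: c), (fun k => if k is k'.+1 then w k' else 2 * s - 1); split=> //=.
- by rewrite ad.
- move=> [|k] kd; last exact: ow.
  by rewrite ltr_norml; apply/andP; split; lra.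
- by rewrite (_ : half (2 * s - 1) = s) // /half; lra.
Qed.

Definition right_wall A B := [/\ tiles (A ++ B), all ndg (A ++ B), stack 0 A 1 & forall r, r \in A -> rx1 r = 1].

Lemma coded_state A B : right_wall A B -> coded (A ++ B) ->
  exists c w, [/\ code_ok c, (size c).+1 = size (A ++ B), in_obox (size c) w,
    regular c (build c w) & (build c w).1 = A /\ perm_eq (build c w).2 B].
Proof.
move=> [tL nL st r1] [c [w [ok sc ow pL]]]; exists c, w; have rg := regular_build ok ow.
split=> //; exact: (right_side_unique (regular_good rg) tL nL pL (perm_refl _) st r1).
Qed.

(** In an open cell the first peak is a true descent or tie, so a strict ascent cannot go past
    it. *)
Lemma peak_ge c S k : regular c S -> (k < size S.1)%N ->
  (forall j, (j < k)%N -> left_coord S.1 j < left_coord S.1 j.+1) -> (k <= first_peak c)%N.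
Proof.
move=> rg kS H; rewrite leqNgt; apply/negP => lt.
have [_ sl] := regular_slopes rg; have := H _ lt; rewrite ltNge sl //.
exact: leq_ltn_trans lt kS.
Qed.

Lemma cut_lowE (s : R) r q : rx0 r = rx0 q -> rx1 r = rx1 q -> ry1 r = ry0 q ->
  s * (ry1 q - ry0 r) = ry1 r - ry0 r ->
  let m := Rect (rx0 r) (rx1 r) (ry0 r) (ry1 q) in cut_low s m = r /\ cut_high s m = q.
Proof.
case: r q => [a b c d] [a' b' c' d'] /= <- <- <- e.
by rewrite /cut_low /cut_high /= e subrKC.
Qed.

(** Level left ends at the first peak reveal a horizontal cut, which is undone by merging the two
    rectangles. The ascent up to [k] survives the merging, so the cut is admissible. *)
Lemma coded_hcut A B k : right_wall A B -> (k.+1 < size A)%N ->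
  left_coord A k.+1 = left_coord A k ->
  (forall j, (j < k)%N -> left_coord A j < left_coord A j.+1) ->
  (forall L, (size L < size (A ++ B))%N -> tiles L -> all ndg L -> coded L) -> coded (A ++ B).
Proof.
move=> [tL nL st r1] kA eK up IH.
have kA' : (k < size A)%N by exact: ltnW.
set r := nth u A k; set q := nth u A k.+1.
have EA : A = take k A ++ r :: q :: drop k.+2 A.
  by rewrite {1}(split_nth kA') (drop_nth u kA).
have rA : r \in A by exact: mem_nth.
have qA : q \in A by exact: mem_nth.
have [nr nq] : ndg r /\ ndg q by split; apply: (allP nL); rewrite mem_cat ?rA ?qA.
have ry : ry1 r = ry0 q.
  by move: st; rewrite EA => /stack_cat [z _ /= [_ [-> _]]].
move: (nr) (nq) => /andP[rx ryy] /andP[qx qyy].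
pose s : R := (ry1 r - ry0 r) / (ry1 q - ry0 r).
have d0 : 0 < ry1 q - ry0 r by rewrite subr_gt0 -ry in qyy *; exact: lt_trans qyy.
have sE : s * (ry1 q - ry0 r) = ry1 r - ry0 r by rewrite mulfVK // gt_eqF.
have s01 : 0 < s < 1.
  by apply/andP; split; [rewrite divr_gt0 // subr_gt0|rewrite ltr_pdivrMr // mul1r ltrD2r ry].
set m := Rect (rx0 r) (rx1 r) (ry0 r) (ry1 q).
have [ml mh] : cut_low s m = r /\ cut_high s m = q.
  by apply: cut_lowE => //; rewrite (r1 r) // (r1 q).
set A' := take k A ++ m :: drop k.+2 A.
have szk : size (take k A) = k by rewrite size_takel // ltnW.
have A'k : nth u A' k = m by rewrite /A' nth_cat szk ltnn subnn.
have wall' : right_wall A' B.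
  split.
  - move=> p; rewrite -(tL p) [in RHS]EA /A' !count_cat /= (@in_half_open_cut _ p s m).
    + by rewrite ml mh !addnA.
    + by case/andP: s01 => /ltW -> /ltW ->.
    + by rewrite /= -subr_ge0 ltW.
  - move: nL; rewrite [in X in X -> _]EA /A' !all_cat /= => /andP[/andP[-> /and3P[_ _ ->]] ->].
    by rewrite /ndg /= rx -subr_gt0 d0.
  - move: st; rewrite [in X in X -> _]EA /A' => /stack_cat [z z1 /= [z2 [z3 z4]]].
    by apply/stack_cat; exists z.
  - move=> x; rewrite mem_cat inE => /orP[/mem_take xA|/orP[/eqP ->|/mem_drop xA]]; [exact: r1| |exact: r1].
    exact: r1 rA.
have szA : size A = (size A').+1.
  by rewrite [in LHS]EA /A' !size_cat /= addnS.
have [c [w [ok sc ow rg [e1 e2]]]] : exists c w, [/\ code_ok c, (size c).+1 = size (A' ++ B), in_obox (size c) w,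
    regular c (build c w) & (build c w).1 = A' /\ perm_eq (build c w).2 B].
  apply: coded_state => //; case: wall' => t1 t2 _ _; apply: IH => //.
  by rewrite [ltnRHS]size_cat szA addSn -size_cat.
have A'l j : (j <= k)%N -> left_coord A' j = left_coord A j.
  rewrite leq_eqVlt /left_coord => /orP[/eqP ->|jk]; first by rewrite A'k.
  by rewrite /A' nth_cat szk jk nth_take.
apply: (@coded_apply (Hcut k) s c w) => //.
- apply: (peak_ge rg); rewrite e1; first by move: kA; rewrite szA.
  by move=> j jk; rewrite !A'l //; [exact: up|exact: ltnW].
- move: e1 e2; case: (build c w) => A0 B0 /= -> pB.
  rewrite /rects /= A'k ml mh /A' take_size_cat // drop_cat szk ltnNge leqnSn /= subSnn /= drop0.
  by rewrite -EA perm_cat2l.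
- by rewrite sc [RHS]size_cat szA addSn -size_cat.
Qed.

(** A single rectangle on the right has full height: remove it and stretch the rest by the inverse
    of its left coordinate, which is positive because there are other rectangles. *)
Lemma coded_sigma r B : right_wall [:: r] B -> (0 < size B)%N ->
  (forall L, (size L < size (r :: B))%N -> tiles L -> all ndg L -> coded L) -> coded (r :: B).
Proof.
move=> [/= tL nL [ry0r ry1r] r1] B0 IH.
have r11 : rx1 r = 1 by apply: r1; exact: mem_head.
have Er : r = Rect (rx0 r) 1 0 1 by case: (r) ry0r ry1r r11 => a b c d /= -> -> ->.
move: (nL) => /andP[nr /allP nB]; have /andP[rx _] := nr; set s := rx0 r in Er rx; rewrite r11 in rx.
have s0 : 0 < s.
  have /and5P[h _ _ _ _] := tiles_valid tL (mem_head _ _) nr.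
  rewrite lt_def h andbT; apply/eqP => es.
  have [q qB] : exists q, q \in B by case: (B) B0 => // q B' _; exists q; exact: mem_head.
  have qL : q \in r :: B by rewrite inE qB orbT.
  have := tiles_uniq tL nL; rewrite /= => /andP[/negP rB _]; apply: rB.
  rewrite (_ : r = q) //; apply: (tiles_mem_eq tL (mem_head _ _) qL _ (corner_in_half_open (nB q qB))).
  have := tiles_in_unit tL qL (corner_in_half_open (nB q qB)).
  by rewrite Er es.
have sV : 0 < s^-1 by rewrite invr_gt0.
have K : cancel (squeeze s^-1) (squeeze s).
  by case=> a b c d; rewrite /squeeze /= !mulrA divff ?mul1r // gt_eqF.
pose L := map (squeeze s^-1) B.
have tL' : tiles L.
  move=> p; rewrite count_map (eq_count (a2 := in_half_open (s * p.1, p.2))) => [|q]; last first.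
    by rewrite /in_half_open /= ![s^-1 * _]mulrC ler_pdivrMr // ltr_pdivlMr // [p.1 * s]mulrC.
  have := tL (s * p.1, p.2); rewrite /= Er /in_half_open /=.
  case: (0 <= p.2 < 1); rewrite ?andbF ?andbT /=; last by rewrite add0n.
  rewrite pmulr_rge0 // -[X in X <= s * _]mulr1 ler_pM2l //.
  have [h|h] := leP 1 p.1; last first.
    rewrite add0n => ->; rewrite andbT; case: (0 <= p.1) => //=.
    by rewrite (_ : s * p.1 < 1) //; nra.
  rewrite (_ : 0 <= p.1) /=; last by lra.
  by case: (s * p.1 < 1) => /=; lia.
have [||c [w [ok sc ow pL]]] := IH L _ tL' _.
- by rewrite size_map.
- apply/allP => _ /mapP[q qB ->]; have /andP[nx ny] := nB q qB.
  by rewrite /ndg /= ny ltr_pM2l // nx.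
apply: (@coded_apply Sigma s c w) => //.
- by rewrite s0 rx.
- case: (build c w) pL => A0 B1 /= pL; rewrite /rects /= -Er perm_cons.
  rewrite -(_ : map (squeeze s) L = B); first exact: perm_map.
  by rewrite -map_comp map_id_in // => q _ /=; rewrite K.
- by rewrite sc size_map.
Qed.

Lemma stack_ry0_ge (y : R) A y' r : all ndg A -> stack y A y' -> r \in A -> y <= ry0 r.
Proof.
elim: A y => //= q A IH y /andP[/andP[_ qy] nA] [<- st]; rewrite inE => /orP[/eqP ->//|rA].
exact: le_trans (ltW qy) (IH _ nA st rA).
Qed.

Lemma stack_uniq (y : R) A y' : all ndg A -> stack y A y' -> uniq A.
Proof.
elim: A y => //= q A IH y /andP[/andP[_ qy] nA] [_ st]; rewrite (IH _ nA st) andbT.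
by apply/negP => /(stack_ry0_ge nA st); rewrite leNgt qy.
Qed.

(* The peak rectangle is [nth u A k]: since it juts out further to the right than
   its neighbours, the rectangles on its left stay within its vertical extent. *)
Lemma peak_wall A B k : right_wall A B -> (k < size A)%N -> (1 < size A)%N ->
  slopes_strict k A -> ((k.+1 < size A)%N -> left_coord A k.+1 < left_coord A k) ->
  let r := nth u A k in exists M, [/\ stack (ry0 r) M (ry1 r), {subset M <= A ++ B} &
    forall q, q \in M -> rx1 q = rx0 r /\ ndg q].
Proof.
move=> [tL nL st r1] kA A1 [up _] dn r.
have rA : r \in A by exact: mem_nth.
have AL q : q \in A -> q \in A ++ B by move=> qA; rewrite mem_cat qA.
have ndL q : q \in A ++ B -> ndg q by exact: (allP nL).
have valL q : q \in A ++ B -> valid_rect q by move=> qL; exact: tiles_valid tL qL (ndL q qL).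
have /andP[rx ry] := ndL r (AL r rA); rewrite (r1 r rA) in rx.
have /and5P[_ _ _ y0 /andP[_ y1]] := valL r (AL r rA).
have left0 j : (j < size A)%N -> 0 <= left_coord A j.
  by move=> jA; have /and5P[h _ _ _ _] : valid_rect (nth u A j) by apply/valL/AL/mem_nth.
have a0 : 0 < rx0 r.
  case: k up dn @r kA {rA rx ry y0 y1} => [|k] up dn kA r /=.
    exact: le_lt_trans (left0 _ A1) (dn A1).
  exact: le_lt_trans (left0 _ (ltnW r)) (up _ (ltnSn k)).
have next j : (j.+1 < size A)%N -> ry1 (nth u A j) = ry0 (nth u A j.+1).
  move=> jA; have := st; rewrite [X in stack _ X _](split_nth (ltnW jA)) (drop_nth u jA).
  by move=> /stack_cat [z _ [_ [-> _]]].
(* a neighbour [p] of [r] on the right side cannot meet a rectangle [q] that ends at [rx0 r] *)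
have clash q p (t : R) : q \in A ++ B -> p \in A -> rx0 q < rx0 r <= rx1 q -> rx1 q = rx0 r ->
    rx0 p < rx0 r -> ry0 q <= t < ry1 q -> ry0 p <= t < ry1 p -> False.
  move=> qL pA /andP[qr _] qe pr tq tp; have pe := r1 p pA.
  suff e : q = p by move: rx; rewrite -qe e pe ltxx.
  apply: (@touches_unique (A ++ B) (rx0 r) t) => //; first exact: AL.
    by rewrite /touches qr qe lexx.
  by rewrite /touches pr pe ltW.
apply: wall_stack => //; first by rewrite a0 ltW.
move=> q t qL t01 /andP[/[dup] qr /andP[q1 q2] tq].
have qe : rx1 q = rx0 r.
  apply/le_anti; rewrite q2 andbT leNgt; apply/negP => h.
  suff e : q = r by move: q1; rewrite e ltxx.
  apply: (@tiles_mem_eq _ (A ++ B) q r (rx0 r, t) tL) => //; first exact: AL.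
    by rewrite /in_half_open /= tq h ltW.
  by rewrite /in_half_open /= t01 (r1 r rA) lexx rx.
move/andP: t01 => [t0 t1]; move/andP: tq => [tq0 tq1].
have /and5P[_ _ _ qy0 /andP[_ qy1]] := valL q qL.
split=> //; rewrite leNgt; apply/negP => h.
- case: k up @r kA next {dn} rA rx ry y0 y1 a0 clash qr q1 q2 qe t0 t1 h => [|k] up r kA next rA rx ry y0 y1 a0 clash qr q1 q2 qe t0 t1 h.
    have A0 : A != [::] by case: (A) kA.
    by have [e _] := stack_ends st A0; move: h; rewrite /r nth0 e ltNge qy0.
  have pA : nth u A k \in A by apply: mem_nth; exact: ltnW.
  have /andP[_ py] := ndL _ (AL _ pA); have ne := next k kA; rewrite -/r in ne.
  have pr : rx0 (nth u A k) < rx0 r by apply: up.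
  apply: (clash q _ (Num.max (ry0 q) (ry0 (nth u A k))) qL pA qr qe pr).
    by rewrite le_max lexx gt_max (le_lt_trans tq0 tq1) (lt_le_trans py) // ne; lra.
  by rewrite le_max lexx orbT gt_max py ne h.
- have [kS|kS] := ltnP k.+1 (size A); last first.
    have A0 : A != [::] by case: (A) kA.
    have [_ e] := stack_ends st A0; move: h.
    have ek : k = (size A).-1 by move: kS kA; clear; lia.
    by rewrite /r ek nth_last e ltNge qy1.
  have pA : nth u A k.+1 \in A by apply: mem_nth.
  have /andP[_ py] := ndL _ (AL _ pA); have ne := next k kS; rewrite -/r in ne.
  apply: (clash q _ (ry1 r) qL pA qr qe (dn kS)).
    by rewrite h andbT; lra.
  by rewrite ne lexx py.
Qed.

(** At a strict peak, remove the peak rectangle and prolong the stack [M] on its left up to the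
    right side. The prolonged rectangles and both neighbours start to the left of [a], so [a] is the
    value of [strip_left] at an interior parameter. *)
Lemma coded_strip A B k : right_wall A B -> (k < size A)%N -> (1 < size A)%N ->
  slopes_strict k A -> ((k.+1 < size A)%N -> left_coord A k.+1 < left_coord A k) ->
  (forall L, (size L < size (A ++ B))%N -> tiles L -> all ndg L -> coded L) -> coded (A ++ B).
Proof.
move=> wall kA A1 sl dn IH; have [M [stM ML Mx]] := peak_wall wall kA A1 sl dn.
move: wall sl => [tL nL st r1] [up _].
set r := nth u A k in stM Mx; set a := rx0 r in Mx.
have EA : A = take k A ++ r :: drop k.+1 A := split_nth kA.
have rA : r \in A by exact: mem_nth.
have nr : ndg r by apply: (allP nL); rewrite mem_cat rA.
have /andP[rx ry] := nr; rewrite -/a (r1 r rA) in rx.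
have nM : all ndg M by apply/allP => q /Mx [].
have uL := tiles_uniq tL nL.
have MB q : q \in M -> q \in B.
  move=> qM; have := ML q qM; rewrite mem_cat => /orP[qA|//].
  by have [e _] := Mx q qM; move: rx; rewrite -e r1 // ltxx.
set B0 := [seq q <- B | q \notin M].
have pB : perm_eq (M ++ B0) B.
  move: uL; rewrite cat_uniq => /and3P[_ _ uB].
  apply: uniq_perm => //.
    rewrite cat_uniq (stack_uniq nM stM) filter_uniq // andbT.
    by apply/hasPn => q; rewrite mem_filter => /andP[].
  move=> q; rewrite mem_cat mem_filter; case: (boolP (q \in M)) => //= qM.
  by rewrite MB.
have M0 : M != [::] by apply/eqP => e; move: stM ry; rewrite e /= => ->; rewrite ltxx.
have szM : (0 < size M)%N by rewrite lt0n size_eq0.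
set M' := map (trim 1) M.
have M'M : map (trim a) M' = M.
  rewrite -map_comp map_id_in // => q /Mx [<- _].
  by case: q.
set A' := take k A ++ M' ++ drop k.+1 A.
have szk : size (take k A) = k by rewrite size_takel // ltnW.
have stM' : stack (ry0 r) M' (ry1 r).
  by move: stM; rewrite /M'; elim: (M) (ry0 r) => //= q M1 IHM y [<- /IHM].
have eR : r = Rect a 1 (ry0 r) (ry1 r).
  by rewrite -(r1 r rA) /a; case: (r).
have wall' : right_wall A' B0.
  split.
  - move=> p; rewrite -(tL p) [in RHS]EA /A' !count_cat /= (permP (etrans (perm_sym _ _) pB)) count_cat.
    rewrite (@count_trim _ p a 1 (ry0 r) M' (ry1 r)) //.
    + rewrite M'M -eR; move: (count _ (take k A)) (nat_of_bool (in_half_open p r)) (count _ (drop _ A)).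
      by move: (count _ M) (count _ B0); clear; lia.
    + exact: ltW.
    + by move=> _ /mapP[q /Mx [e /andP[qx qy]] ->] /=; rewrite -e !ltW.
  - move: nL; rewrite [in X in X -> _]EA /A' !all_cat /= => /andP[/andP[-> /andP[_ ->]] /allP nB].
    rewrite andbT /=; apply/andP; split.
      apply/allP => _ /mapP[q /Mx [e /andP[qx qy]] ->]; rewrite /ndg /= qy andbT.
      by apply: lt_trans rx; rewrite -e.
    by apply/allP => q; rewrite mem_filter => /andP[_ /nB].
  - move: st; rewrite [in X in X -> _]EA /A' => /stack_cat [z z1 /= [z2 z3]].
    by apply/stack_cat; exists z => //; apply/stack_cat; exists (ry1 r) => //; rewrite -z2.
  - move=> x; rewrite !mem_cat => /or3P[/mem_take xA|/mapP[q _ ->] //|/mem_drop xA]; exact: r1.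
have szA : (size A' + 1 = size A + size M)%N.
  by rewrite [in RHS]EA /A' !size_cat /= size_map; clear; lia.
have szB : (size B = size M + size B0)%N by rewrite -(perm_size pB) size_cat.
have szL : (size (A ++ B) = (size (A' ++ B0)).+1)%N.
  by rewrite (size_cat A B) szB addnA -szA addn1 addSn -size_cat.
have [c [w [ok sc ow rg [e1 e2]]]] : exists c w, [/\ code_ok c, (size c).+1 = size (A' ++ B0), in_obox (size c) w,
    regular c (build c w) & (build c w).1 = A' /\ perm_eq (build c w).2 B0].
  by apply: coded_state => //; case: wall' => t1 t2 _ _; apply: IH => //; rewrite szL.
have A'l j : (j < k)%N -> left_coord A' j = left_coord A j.
  by move=> jk; rewrite /left_coord /A' nth_cat szk jk nth_take.
have lt_a j : (k.-1 <= j <= k + size M)%N -> (j < size A')%N -> left_coord A' j < a.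
  move=> /andP[j1 j2] jA'; have [jk|jk] := ltnP j k.
    by have ej : k = j.+1; [move: j1 jk; clear; lia|rewrite A'l // /a /r ej; apply: up; rewrite ej].
  rewrite /left_coord /A' nth_cat szk ltnNge jk /= nth_cat size_map.
  have [jM|jM] := ltnP (j - k) (size M).
    have : nth u M' (j - k) \in M' by rewrite mem_nth // size_map.
    by move=> /mapP[q /Mx [e /andP[qx _]] ->]; rewrite /= -e.
  have ej : j = (k + size M)%N by move: j2 jk jM; clear; lia.
  rewrite ej addKn subnn nth_drop addn0; apply: dn.
  by move: jA' szA; rewrite ej; clear; lia.
have w_lt : max_left (window k (size M) A') < a.
  case: (max_left_attained (window k (size M) A')) => [->|[q /mem_window [j [j1 j2 ->]] ->]]; last exact: lt_a.
  have h : (k < size A')%N by move: szA szM kA; clear; lia.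
  apply: le_lt_trans (lt_a k _ h); last by rewrite leq_pred leq_addr.
  have [t1 n1 _ _] := wall'; have hL : nth u A' k \in A' ++ B0 by rewrite mem_cat mem_nth.
  by have /and5P[] := tiles_valid t1 hL (allP n1 _ hL).
set m := max_left _ in w_lt.
pose s : R := (a - m) / (1 - m).
have m1 : 0 < 1 - m by rewrite subr_gt0 (lt_trans w_lt rx).
have s01 : 0 < s < 1.
  apply/andP; split; first by rewrite divr_gt0 // subr_gt0.
  by rewrite ltr_pdivrMr // mul1r ltrD2r.
have aE : strip_left k (size M) s A' = a.
  by rewrite /strip_left -/m mulfVK ?gt_eqF // subrKC.
apply: (@coded_apply (Strip k (size M)) s c w) => //.
- rewrite /= -(good_count (regular_good rg)) e1 szM.
  have -> : (k + size M <= size A')%N by move: szA kA; clear; lia.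
  have -> : (size M < size A')%N by move: szA A1; clear; lia.
  rewrite !andbT; suff : (k.-1 <= first_peak c)%N by clear; lia.
  have kA' : (k.-1 < size A')%N by move: szA szM kA; clear; lia.
  apply: (peak_ge rg); rewrite e1 // => j jk.
  have [j1 j2] : (j < k)%N /\ (j.+1 < k)%N by move: jk; clear; lia.
  by rewrite !A'l //; exact: up.
- have M'0 : M' != [::] by rewrite -size_eq0 size_map size_eq0.
  have [y1 y2] := stack_ends stM' M'0.
  move: e1 e2; case: (build c w) => X0 Y0 /= -> pY.
  rewrite /rects /= aE /A' drop_size_cat // take_size_cat ?size_map // take_size_cat //.
  rewrite y1 y2.
  rewrite M'M -eR [take k A ++ M' ++ _]catA drop_size_cat; last by rewrite size_cat szk size_map.
    rewrite -EA perm_cat2l; apply: perm_trans pB; by rewrite perm_cat2l.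
  by rewrite size_map.
- by rewrite sc szL.
Qed.

Lemma first_peak_exists A : A != [::] -> exists k, (k < size A)%N /\ slopes_strict k A.
Proof.
move=> A0; pose P k := (k.+1 < size A)%N ==> (left_coord A k.+1 <= left_coord A k).
have sA : (0 < size A)%N by rewrite lt0n size_eq0.
have exP : exists k, P k by exists (size A); rewrite /P ltnNge leqnSn.
case: (ex_minnP exP) => k Pk mk; exists k.
have kA : (k < size A)%N.
  suff : (k <= (size A).-1)%N by rewrite -ltnS prednK.
  by apply: mk; rewrite /P prednK // ltnn.
split=> //; split=> [j jk|kS]; last by move: Pk; rewrite /P kS.
have : ~~ P j by apply/negP => /mk; rewrite leqNgt jk.
by rewrite /P negb_imply -ltNge => /andP[].
Qed.

(** Induction on the number of rectangles. The right side is a single rectangle, or its first peak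
    is level with the successor, or strictly ahead of it; these are the traces of [Sigma], [Hcut]
    and [Strip]. *)
Theorem tiles_coded L : tiles L -> all ndg L -> coded L.
Proof.
have [n sn] := ubnP (size L); elim: n => // n IHn in L sn *; move=> tL nL.
have IH L' : (size L' < size L)%N -> tiles L' -> all ndg L' -> coded L'.
  by move=> h; apply: IHn; exact: leq_trans h sn.
have valL r : r \in L -> valid_rect r by move=> rL; exact: tiles_valid tL rL (allP nL r rL).
have [||||r t rL t01 /andP[/andP[_ h] _]|A [stA AL Ax]] := @wall_stack L 1 0 1 tL; rewrite ?ler01 ?ltr01 ?lexx //.
  by have /and5P[_ _ a b /andP[_ e]] := valL r rL; split=> //; apply/le_anti; rewrite a.
have nA : all ndg A by apply/allP => r /Ax [].
have A0 : A != [::] by apply/eqP => e; move: stA; rewrite e /= => /eqP; rewrite lt_eqF.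
set B := [seq r <- L | r \notin A]; have uL := tiles_uniq tL nL.
have pL : perm_eq (A ++ B) L.
  apply: uniq_perm => //.
    rewrite cat_uniq (stack_uniq nA stA) filter_uniq // andbT.
    by apply/hasPn => q; rewrite mem_filter => /andP[].
  move=> q; rewrite mem_cat mem_filter; case: (boolP (q \in A)) => //= qA.
  by rewrite AL.
have wall : right_wall A B.
  split=> //; first by apply: tiles_perm tL; rewrite perm_sym.
    by rewrite (perm_all _ pL).
  by move=> r /Ax [].
suff : coded (A ++ B).
  move=> [c [w [ok sc ow p]]]; exists c, w; split=> //; first by rewrite sc (perm_size pL).
  exact: perm_trans p pL.
have {}IH L' : (size L' < size (A ++ B))%N -> tiles L' -> all ndg L' -> coded L' by rewrite (perm_size pL); exact: IH.
have [A1|A1] := ltnP 1 (size A).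
  have [k [kA sl]] := first_peak_exists A0.
  (* If the peak is topmost, [left_coord A k.+1] is only the default value 0; whether or not it
     happens to agree, the operation is a [Strip]. *)
  have [e|ne] := eqVneq (left_coord A k.+1) (left_coord A k); last first.
    apply: (coded_strip wall kA A1 sl) => // kS; rewrite lt_neqAle ne /=.
    by case: sl => _; apply.
  have [kS|kS] := ltnP k.+1 (size A); first by apply: (coded_hcut wall kS e) => //; case: sl.
  apply: (coded_strip wall kA A1 sl) => // h; by move: h; rewrite ltnNge kS.
case: A A0 A1 @B wall IH {pL stA AL Ax nA} => // r [|//] _ _ B wall IH.
have [B0|B0] := posnP (size B); last exact: coded_sigma.
move/size0nil: B0 => B0; rewrite B0 in wall IH *; move: wall => [tr /andP[nr _] [y0 y1] r1].
exists [::], (fun=> 0); split=> //.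
have r11 : rx1 r = 1 by apply: r1; exact: mem_head.
have r00 : rx0 r = 0.
  have /and5P[h _ _ _ _] := tiles_valid tr (mem_head _ _) nr.
  have := tr (0, 0); rewrite /= !addn0 /in_half_open /= lexx ltr01 /= => e.
  apply/le_anti; rewrite h andbT.
  by case: (rx0 r <= 0) e.
by rewrite /= (_ : r = u) //; case: r r00 r11 y0 y1 {nr tr r1 IH} @B B0 => a b c d /= -> -> -> ->.
Qed.

End Decoding.

(** * Characteristic maps of the cells *)

Section CellMaps.
Variable R : realType.
Implicit Types (r q : rect R) (A B L M : seq (rect R)) (S T : state R) (e s : R).
Notation u := (unit_square R).

Lemma near_list_cons e r q A B :
  near_list e (r :: A) (q :: B) <-> near_rect e r q /\ near_list e A B.
Proof.
split=> [[[sAB] h]|[rq [sAB h]]].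
  by split; [exact: (h 0)|split=> // i iA; exact: (h i.+1)].
by split=> /= [|[|i] iA]; [rewrite sAB|exact: rq|exact: h].
Qed.

Lemma near_list_cat e A A' B B' : near_list e A A' -> near_list e B B' ->
  near_list e (A ++ B) (A' ++ B').
Proof.
elim: A A' => [|r A IH] [|q A'] //; try by case.
by move=> /near_list_cons [rq AA] BB /=; apply/near_list_cons; split=> //; exact: IH.
Qed.

Lemma near_list_take e k A A' : near_list e A A' -> near_list e (take k A) (take k A').
Proof.
elim: A A' k => [|r A IH] [|q A'] [|k] //; try by case.
by move=> /near_list_cons [rq AA] /=; apply/near_list_cons; split=> //; exact: IH.
Qed.

Lemma near_list_drop e k A A' : near_list e A A' -> near_list e (drop k A) (drop k A').
Proof.
elim: A A' k => [|r A IH] [|q A'] [|k] //; try by case.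
by move=> /near_list_cons [rq AA] /=; exact: IH.
Qed.

Lemma near_list_map e e' (f g : rect R -> rect R) A A' : near_list e A A' ->
  (forall r q, r \in A -> q \in A' -> near_rect e r q -> near_rect e' (f r) (g q)) ->
  near_list e' (map f A) (map g A').
Proof.
elim: A A' => [|r A IH] [|q A'] //; try by case.
move=> /near_list_cons [rq AA] H /=; apply/near_list_cons; split.
  by apply: H => //; exact: mem_head.
by apply: IH => // x y xA yA; apply: H; rewrite inE ?xA ?yA orbT.
Qed.

Lemma near_rect_le e e' r q : e <= e' -> near_rect e r q -> near_rect e' r q.
Proof. by move=> ee [a b c d]; split; apply: le_trans ee. Qed.

Lemma near_list_le e e' A B : e <= e' -> near_list e A B -> near_list e' A B.
Proof. by move=> ee [s h]; split=> // i iA; exact: near_rect_le ee (h i iA). Qed.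

Lemma near_rect_nth e k A A' : 0 <= e -> near_list e A A' -> near_rect e (nth u A k) (nth u A' k).
Proof.
move=> e0 [s h]; have [kA|kA] := ltnP k (size A); first exact: h.
by rewrite !nth_default -?s //; split; rewrite subrr normr0.
Qed.

Lemma max_left_near e A A' : 0 <= e -> near_list e A A' -> `|max_left A - max_left A'| <= e.
Proof.
move=> e0; elim: A A' => [|r A IH] [|q A'] //; try by case.
  by rewrite subrr normr0.
move=> /near_list_cons [[h _ _ _] /IH h2] /=.
apply: le_trans (_ : Num.max `|rx0 r - rx0 q| `|max_left A - max_left A'| <= _).
  case: (leP (rx0 r) (max_left A)) => a; case: (leP (rx0 q) (max_left A')) => b;
  rewrite le_max ?lexx ?orbT // !ler_norml; case: (lerP 0 (rx0 r - rx0 q)) => c; case: (lerP 0 (max_left A - max_left A')) => d;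
  by rewrite ?(ger0_norm c) ?(ltr0_norm c) ?(ger0_norm d) ?(ltr0_norm d); lra.
by rewrite ge_max h h2.
Qed.

(** Every new coordinate is a point of an interval between old ones, so each operation adds to the
    error at most the error of its own parameter. The total Lipschitz constant is the length of the
    code. *)
Lemma convex_near (e e' s s' a b a' b' : R) : 0 <= s <= 1 -> `|a - a'| <= e -> `|b - b'| <= e ->
  `|s - s'| <= e' -> 0 <= b' - a' <= 1 -> `|a + s * (b - a) - (a' + s' * (b' - a'))| <= e + e'.
Proof.
move=> /andP[s0 s1] ha hb hs /andP[d0 d1].
have -> : a + s * (b - a) - (a' + s' * (b' - a')) =
  (1 - s) * (a - a') + s * (b - b') + (s - s') * (b' - a') by ring.
apply: le_trans (ler_normD _ _) _; apply: lerD.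
  apply: le_trans (ler_normD _ _) _; rewrite !normrM (ger0_norm s0) ger0_norm; last by lra.
  have : (1 - s) * `|a - a'| <= (1 - s) * e by apply: ler_wpM2l; lra.
  have : s * `|b - b'| <= s * e by apply: ler_wpM2l; lra.
  by lra.
rewrite normrM (ger0_norm d0) -[leRHS]mulr1; apply: ler_pM => //.
Qed.

Lemma apply_op_near o c S T s s' e e' : good c S -> good c T -> admissible o c ->
  0 <= s <= 1 -> 0 <= s' <= 1 -> 0 <= e -> `|s - s'| <= e' ->
  near_list e S.1 T.1 -> near_list e S.2 T.2 ->
  near_list (e + e') (apply_op o s S).1 (apply_op o s' T).1 /\
  near_list (e + e') (apply_op o s S).2 (apply_op o s' T).2.
Proof.
case: S T => A B [A' B'] gS gT ad s01 s01' e0 hs /= nA nB.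
have e'0 : 0 <= e' := le_trans (normr_ge0 _) hs.
have ee : e <= e + e' by rewrite lerDl.
have zero (x : R) : `|x - x| <= e + e' by rewrite subrr normr0 addr_ge0.
have zero' (x : R) : `|x - x| <= e by rewrite subrr normr0.
have lr (x y : R) : `|x - y| <= e -> `|x - y| <= e + e' by move=> h; exact: le_trans ee.
case: o ad => [k|k i|] ad /=.
- have [h1 h2 h3 h4] := near_rect_nth k e0 nA.
  have kT : (k < size A')%N by rewrite (good_count gT); exact: leq_ltn_trans ad (good_peak gT).
  have [] := good_left gT (mem_nth u kT) => _ _ y0 y01 y1.
  have cut : `|ry0 (nth u A k) + s * (ry1 (nth u A k) - ry0 (nth u A k)) -
     (ry0 (nth u A' k) + s' * (ry1 (nth u A' k) - ry0 (nth u A' k)))| <= e + e'.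
    by apply: convex_near => //; apply/andP; split; lra.
  split; last exact: near_list_le nB.
  apply: near_list_cat; first by apply: near_list_le ee _; exact: near_list_take.
  apply/near_list_cons; split; first by split; [exact: lr|exact: lr|exact: lr|exact: cut].
  apply/near_list_cons; split; first by split; [exact: lr|exact: lr|exact: cut|exact: lr].
  by apply: near_list_le ee _; exact: near_list_drop.
- have [y [y' sp]] := strip_facts gS ad s01; have [z [z' sp']] := strip_facts gT ad s01'.
  have nM := near_list_take i (near_list_drop k nA).
  have mn : `|max_left (window k i A) - max_left (window k i A')| <= e.
    by apply: max_left_near => //; apply: near_list_take; exact: near_list_drop.
  have an : `|strip_left k i s A - strip_left k i s' A'| <= e + e'.
    apply: convex_near => //; have /andP[m0 m1] := strip_max sp'; apply/andP; split; rewrite /= in m0 m1; lra.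
  split; last first.
    apply: near_list_cat; last exact: near_list_le nB.
    apply: near_list_map nM _ => r q _ _ [h1 h2 h3 h4].
    by split; [exact: lr|exact: an|exact: lr|exact: lr].
  have [_ _ hh _] := near_rect_nth 0 e0 nM.
  have [_ _ _ hl] := near_rect_nth (size (take i (drop k A))).-1 e0 nM.
  have [szM _] := nM; rewrite nth_last szM nth_last in hl.
  rewrite !nth0 in hh.
  apply: near_list_cat; first by apply: near_list_le ee _; exact: near_list_take.
  apply/near_list_cons; split; first by split; [exact: an|exact: zero|exact: lr|exact: lr].
  by apply: near_list_le ee _; exact: near_list_drop.
- split; first by apply/near_list_cons; split=> //; split; rewrite ?zero // (le_trans hs) // lerDr.
  apply: near_list_map (near_list_cat nA nB) _ => r q rS qT [h1 h2 h3 h4].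
  have /and5P[x0 x01 x1 _ _] := allP (good_valid gT) q qT.
  have sc (x x' : R) : `|x - x'| <= e -> 0 <= x' <= 1 -> `|s * x - s' * x'| <= e + e'.
    move=> xx x'01; have := @convex_near e e' s s' 0 x 0 x' s01 (zero' 0) xx hs.
    by rewrite !subr0 !add0r; apply.
  split; [apply: sc h1 _|apply: sc h2 _|exact: lr|exact: lr]; apply/andP; split; move: x0 x01 x1; clear; lra.
Qed.

Lemma half_near (x y : R) e : `|x - y| <= e -> `|half x - half y| <= e.
Proof. by move=> h; rewrite /half; move: h; rewrite !ler_norml => /andP[? ?]; apply/andP; split; lra. Qed.

Lemma build_near c (w w' : nat -> R) e : code_ok c -> in_box (size c) w -> in_box (size c) w' -> 0 <= e ->
  (forall k, (k < size c)%N -> `|w k - w' k| <= e) ->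
  near_list ((size c)%:R * e) (build c w).1 (build c w').1 /\
  near_list ((size c)%:R * e) (build c w).2 (build c w').2.
Proof.
elim: c w w' => [|o c IH] w w' /=.
  by move=> _ _ _ e0 _; rewrite mul0r; split=> //; apply/near_list_cons; split=> //; split; rewrite subrr normr0.
move=> /andP[ad ok] bw bw' e0 h.
have bk (v : nat -> R) : in_box (size c).+1 v -> in_box (size c) (fun k => v k.+1) by move=> H k kd; exact: H.
have [n1 n2] := IH _ _ ok (bk w bw) (bk w' bw') e0 (fun k kd => h k.+1 kd).
rewrite -addn1 natrD mulrDl mul1r; apply: (apply_op_near (c := c)) => //.
- by apply: good_build => //; exact: bk.
- by apply: good_build => //; exact: bk.
- exact/half_itv/bw.
- exact/half_itv/bw'.
- by rewrite mulr_ge0.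
- exact/half_near/h.
Qed.

Lemma rects_near c (w w' : nat -> R) e : code_ok c -> in_box (size c) w -> in_box (size c) w' -> 0 <= e ->
  (forall k, (k < size c)%N -> `|w k - w' k| <= e) ->
  near_list ((size c)%:R * e) (rects (build c w)) (rects (build c w')).
Proof. by move=> ok bw bw' e0 h; have [n1 n2] := build_near ok bw bw' e0 h; exact: near_list_cat. Qed.

Lemma build_ext c (w w' : nat -> R) : (forall k, (k < size c)%N -> w k = w' k) -> build c w = build c w'.
Proof.
elim: c w w' => //= o c IH w w' h; rewrite h //; congr apply_op.
by apply: IH => k kd; exact: h.
Qed.

Lemma shrink_obox d (w : nat -> R) (t : R) : in_box d w -> 0 < t <= 1 -> in_obox d (fun k => (1 - t) * w k).
Proof.
move=> bw /andP[t0 t1] k kd; rewrite normrM ger0_norm; last by lra.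
have := bw k kd; have := normr_ge0 (w k); move: `|w k| => x x0 x1; nra.
Qed.

(* By continuity from the open cell, where all rectangles are nondegenerate. *)
Lemma build_separated c (w : nat -> R) : code_ok c -> in_box (size c) w ->
  separated_list (rects (build c w)).
Proof.
move=> ok bw r q rL qL _; set L := rects _ in rL qL.
have [->|rq] := eqVneq q r; [by left|right].
apply: contrapT => /negP; rewrite /separated !negb_or -!ltNge => /and4P[h1 h2 h3 h4].
set i := index r L; set j := index q L.
have iL : (i < size L)%N by rewrite index_mem.
have jL : (j < size L)%N by rewrite index_mem.
have ij : i != j by apply/eqP => e; move/eqP: rq; apply; rewrite -(nth_index u qL) -/j -e nth_index.
pose D := Num.min (Num.min (rx1 q - rx0 r) (rx1 r - rx0 q)) (Num.min (ry1 q - ry0 r) (ry1 r - ry0 q)).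
have D0 : 0 < D by rewrite !lt_min !subr_gt0 h1 h2 h3 h4.
have [[d1 d2] [d3 d4]] : (D <= rx1 q - rx0 r /\ D <= rx1 r - rx0 q) /\ (D <= ry1 q - ry0 r /\ D <= ry1 r - ry0 q).
  by rewrite /D !ge_min !lexx ?orbT.
pose N : R := (size c)%:R.
have N0 : 0 <= N by exact: ler0n.
(* Each coordinate moves by at most [D / 4], so overlaps of width [D] survive in the open cell,
   where overlaps are impossible. *)
pose t : R := Num.min 1 (D / (4 * (N + 1))).
have t0 : 0 < t by rewrite lt_min ltr01 divr_gt0 // mulr_gt0 //; lra.
have t1 : t <= 1 by rewrite ge_min lexx.
have tD : N * t <= D / 4.
  have : t <= D / (4 * (N + 1)) by rewrite ge_min lexx orbT.
  rewrite ler_pdivlMr; last by lra.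
  by move=> h; lra.
pose w' k := (1 - t) * w k.
have ow : in_obox (size c) w' by apply: shrink_obox => //; rewrite t0.
have nr : near_list (N * t) L (rects (build c w')).
  apply: rects_near => //; [exact: obox_box|exact: ltW|].
  move=> k kd; rewrite /w' (_ : w k - (1 - t) * w k = t * w k); last by ring.
  by rewrite normrM (gtr0_norm t0) -[leRHS]mulr1 ler_wpM2l ?bw // ltW.
have rg := regular_build ok ow; have [sz nearL] := nr.
have [n1 n2 n3 n4] := nearL i iL; have [m1 m2 m3 m4] := nearL j jL.
rewrite (nth_index u rL) in n1 n2 n3 n4; rewrite (nth_index u qL) in m1 m2 m3 m4.
set r' := nth u _ i in n1 n2 n3 n4; set q' := nth u _ j in m1 m2 m3 m4.
have tl := good_tiles (regular_good rg); have nd := regular_ndg rg.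
have r'L : r' \in rects (build c w') by rewrite mem_nth // -sz.
have q'L : q' \in rects (build c w') by rewrite mem_nth // -sz.
have : separated q' r'.
  apply: (tiles_separated tl) => //; [|exact: (allP nd)|exact: (allP nd)].
  by apply/eqP; rewrite nth_uniq -?sz // tiles_uniq.
move: n1 n2 n3 n4 m1 m2 m3 m4; rewrite !ler_norml.
move=> /andP[? ?] /andP[? ?] /andP[? ?] /andP[? ?] /andP[? ?] /andP[? ?] /andP[? ?] /andP[? ?].
move/or4P => H; move: D0; case: H => H; lra.
Qed.

Lemma build_skel_ndg c (w : nat -> R) : code_ok c -> in_box (size c) w ->
  let L := [seq r <- rects (build c w) | ndg r] in
  [/\ tiles L, all ndg L, (size L <= (size c).+1)%N & skel L = skel (rects (build c w))].
Proof.
move=> ok bw L; have g := good_build ok bw.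
split.
- exact: tiles_filter (good_tiles g).
- exact: filter_all.
- by rewrite size_filter -(good_size g) count_size.
- by apply: skel_filter; [exact: good_tiles g|exact: good_valid g|exact: build_separated].
Qed.

Variable N : nat.
Notation T := (tiling_space R N.+1).

Lemma tiles_skeleton L : tiles L -> all ndg L -> (size L <= N.+1)%N -> is_skeleton_le R N.+1 (skel L).
Proof.
move=> tL nL sL; have [t1 t2] := tiles_tiling tL nL.
by exists (size L), (tnth (in_tuple L)).
Qed.

Lemma unit_tiles : tiles [:: u].
Proof. by move=> p /=; rewrite addn0. Qed.

Lemma unit_skeleton : is_skeleton_le R N.+1 (skel [:: u]).
Proof. by apply: tiles_skeleton; [exact: unit_tiles|rewrite /= /ndg /= ltr01|]. Qed.

(* Outside its intended domain the value is the trivial tiling. *)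
Definition tiling_of (K : set (R * R)) : T :=
  if pselect (is_skeleton_le R N.+1 K) is left h then exist _ K h else exist _ _ unit_skeleton.

Lemma tiling_ofK K : is_skeleton_le R N.+1 K -> sval (tiling_of K) = K.
Proof. by rewrite /tiling_of; case: pselect. Qed.

Definition cell (c : seq op) (w : seqspace R) : T := tiling_of (skel (rects (build c w))).

Definition code_le (c : seq op) := code_ok c && (size c <= N)%N.

Lemma cube_box d (w : seqspace R) : cube d w -> in_box d w.
Proof. by case. Qed.

Lemma open_cube_obox d (w : seqspace R) : open_cube d w -> in_obox d w.
Proof. by move=> /open_cubeP []. Qed.

Lemma cell_skel c w : code_le c -> cube (size c) w -> sval (cell c w) = skel (rects (build c w)).
Proof.
move=> /andP[ok sc] /cube_box bw; apply: tiling_ofK.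
have [tL nL sL <-] := build_skel_ndg ok bw.
by apply: tiles_skeleton => //; exact: leq_trans sL _.
Qed.

Lemma sval_inj (x y : T) : sval x = sval y -> x = y.
Proof.
case: x y => [a ax] [b bx] /= e; move: ax bx; rewrite e => ax bx.
by congr exist; exact: Prop_irrelevance.
Qed.

Lemma cell_clc c : code_le c -> clc (cube (size c)) (cell c).
Proof.
move=> /[dup] okN /andP[ok sc]; apply: (@lipschitz_clc _ _ _ _ (2 * ((size c)%:R + 1))).
  by rewrite mulr_gt0 // ltr_wpDl ?ler0n.
move=> w w' e cw cw' e0 h; rewrite !cell_skel //.
have [bw bw'] := (cube_box cw, cube_box cw').
apply: le_trans (hausdorff_near (e := (size c)%:R * e) _ _ _ _) _.
- by rewrite mulr_ge0 // ltW.
- exact/good_valid/good_build.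
- exact/good_valid/good_build.
- by apply: rects_near => //; exact: ltW.
- by rewrite mulrDr mulr1 mulrDl -mulrA lerDl mulr_ge0 // ltW.
Qed.

Lemma cell_ndg c w : code_le c -> cube (size c) w -> exists L,
  [/\ tiles L, all ndg L, L = [seq r <- rects (build c w) | ndg r] & sval (cell c w) = skel L].
Proof.
move=> /[dup] okN /andP[ok sc] cw; have [tL nL sL e] := build_skel_ndg ok (cube_box cw).
by exists [seq r <- rects (build c w) | ndg r]; split=> //; rewrite e cell_skel.
Qed.

Lemma cell_exists (x : T) : exists c w, [/\ code_le c, open_cube (size c) w & cell c w = x].
Proof.
have [L [tL nL sL xL]] := tiling_space_list x.
have [c [w [ok sc ow pL]]] := tiles_coded tL nL.
have okN : code_le c by rewrite /code_le ok -ltnS sc.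
pose v : seqspace R := fun k => if (k < size c)%N then w k else 0.
have ov : open_cube (size c) v.
  apply/open_cubeP; split=> k kd; rewrite /v; first by rewrite kd; exact: ow.
  by rewrite ltnNge kd.
exists c, v; split=> //; apply: sval_inj; rewrite cell_skel //; last by case: ov.
rewrite xL; apply: skel_perm; rewrite (@build_ext c v w) // => k kd.
by rewrite /v kd.
Qed.

Definition code (x : T) : seq op := projT1 (cid (cell_exists x)).

Lemma code_spec x : code_le (code x) /\ exists2 w, open_cube (size (code x)) w & cell (code x) w = x.
Proof. by rewrite /code; case: (cid _) => c /= [w [ok ow <-]]; split=> //; exists w. Qed.

(* Exceeds all digits, so that [rank] compares codes lexicographically. *)
Definition base_digit := N.*2.+4.+1.
Definition code_rank c := rank base_digit c.

(** At most [size c + 1] rectangles are nondegenerate, so the code cannot get longer. If the length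
    stays the same, nothing has degenerated and the comparison of codes applies. *)
Lemma cell_compare c c' w w' : code_le c -> code_le c' -> cube (size c) w -> open_cube (size c') w' ->
  cell c w = cell c' w' ->
  (size c' < size c)%N \/ [/\ size c' = size c, perm_eq (rects (build c w)) (rects (build c' w')),
     sigma_headed c' = sigma_headed c & c' = c /\ w = w' \/ (code_rank c' < code_rank c)%N].
Proof.
move=> okc okc' cw ow' e; have cw' : cube (size c') w' by case: ow'.
have [L [tL nL eL sL]] := cell_ndg okc cw; have := congr1 sval e; rewrite sL (cell_skel okc' cw').
move/andP: okc => [ok sc]; move/andP: okc' => [ok' sc'].
have rg := regular_build ok' (open_cube_obox ow'); have g' := regular_good rg.
move=> /(skel_inj tL (good_tiles g') nL (regular_ndg rg)) pL.
have szL := perm_size pL; rewrite (good_size g') in szL.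
have g := good_build ok (cube_box cw).
have : (size L <= (size c).+1)%N by rewrite -(good_size g) eL size_filter count_size.
rewrite szL ltnS leq_eqVlt => /orP[/eqP ee|lt]; [right|by left].
have EL : L = rects (build c w).
  by rewrite eL; apply/all_filterP; rewrite all_count -size_filter -eL szL ee (good_size g).
rewrite EL in pL; have hb : ((size c).*2.+4 < base_digit)%N by rewrite /base_digit; move: sc; clear; lia.
have ob : in_obox (size c) w' by rewrite -ee; exact: open_cube_obox.
have [sg H] := build_compare hb ok ok' ee (cube_box cw) ob pL.
split=> //; case: H => [[ec ew]|lt]; [left|by right].
split=> //; apply/funext => k; case: (ltnP k (size c)) => kd; first exact: ew.
by case: cw => _ ->; rewrite // ?ec; case: cw' => _ ->; rewrite // ?ec.
Qed.

(** Compare in both directions: neither the size nor the rank can drop both ways. *)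
Lemma cell_inj c c' w w' : code_le c -> code_le c' -> open_cube (size c) w -> open_cube (size c') w' ->
  cell c w = cell c' w' -> c = c' /\ w = w'.
Proof.
move=> okc okc' ow ow' e; have [cw _] := ow; have [cw' _] := ow'.
have := cell_compare okc okc' cw ow' e; have := cell_compare okc' okc cw' ow (esym e).
move=> [lt|[ee _ _ [[-> ->] //|lt]]] [lt'|[ee' _ _ [[-> ->] //|lt']]].
- by have := ltn_trans lt lt'; rewrite ltnn.
- by move: lt; rewrite ee' ltnn.
- by move: lt'; rewrite ee ltnn.
- by have := ltn_trans lt lt'; rewrite ltnn.
Qed.

Lemma code_cell c w : code_le c -> open_cube (size c) w -> code (cell c w) = c.
Proof.
move=> ok ow; have [ok' [w' ow' e]] := code_spec (cell c w).
by have [-> _] := cell_inj ok' ok ow' ow e.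
Qed.

End CellMaps.

(** * Codimension-one faces and the matching *)

Section Matching.
Variable R : realType.
Implicit Types (r q : rect R) (A B L M : seq (rect R)) (S T : state R) (s : R) (w : nat -> R).
Notation u := (unit_square R).

(* The matching pairs [c] with [Sigma :: c] whenever [low c]. *)
Fixpoint low (c : seq op) : bool :=
  match c with [::] => false | Sigma :: c' => ~~ low c' | _ :: _ => true end.

Fixpoint sigmas (c : seq op) : nat := if c is Sigma :: c' then (sigmas c').+1 else 0.

Lemma sigma_peel s s' S T c c' : good c S -> regular c' T -> 0 <= s <= 1 -> 0 < s' < 1 ->
  perm_eq (rects (apply_op Sigma s S)) (rects (apply_op Sigma s' T)) ->
  s = s' /\ perm_eq (rects S) (rects T).
Proof.
move=> g rg s01 s01' pm.
have go := good_sigma g s01; have ro := @regular_apply R Sigma c' T s' rg isT s01'.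
have gro := regular_good ro.
have [e1 e2] := right_side_unique go (good_tiles gro) (regular_ndg ro) pm (perm_refl _) (good_stack gro) (good_right gro).
case: S T {g rg go ro gro pm} e1 e2 => [A B] [A' B'] /= [-> ] p; split=> //.
by move: p => /perm_map_inj; apply; apply: squeeze_inj; case/andP: s01'.
Qed.

(** Codes meeting in equal dimension have heads of the same kind, so leading [Sigma]s are peeled off
    together until both codes reach another head or end. *)
Lemma build_low c c' w w' : code_ok c -> code_ok c' -> size c' = size c -> in_box (size c) w ->
  in_obox (size c) w' -> perm_eq (rects (build c w)) (rects (build c' w')) -> low c' = low c.
Proof.
elim: c c' w w' => [|o c IH] [|o' c'] //= w w' /andP[ad ok] /andP[ad' ok'] [sz] bw bw' pm.
have ok1 : code_ok (o :: c) by rewrite /= ad.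
have ok1' : code_ok (o' :: c') by rewrite /= ad'.
have [sg _] := build_compare (ltnSn _) ok1 ok1' (congr1 S sz) bw bw' pm.
case: o sg ad pm {ok1} => [k|k i|] /=; case: o' ad' {ok1'} => //= _ _ _ pm.
have gT : good c (build c (fun k => w k.+1)) by apply: good_build => // k kd; exact: bw.
have rT : regular c' (build c' (fun k => w' k.+1)).
  by apply: regular_build => //; rewrite sz => k kd; exact: bw'.
have [_ p] := sigma_peel gT rT (half_itv (bw 0 isT)) (half_oitv (bw' 0 isT)) pm.
congr negb; apply: IH ok ok' sz _ _ p => k kd; [exact: bw|exact: bw'].
Qed.

Lemma squeeze1 L : map (squeeze 1) L = L.
Proof. by rewrite map_id_in // => -[a b c d] _; rewrite /squeeze /= !mul1r. Qed.

Lemma ndg_squeeze s r : 0 < s -> ndg (squeeze s r) = ndg r.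
Proof. by move=> s0; rewrite /ndg /= ltr_pM2l. Qed.

Lemma filter_squeeze s L : 0 <= s ->
  [seq r <- map (squeeze s) L | ndg r] = if s == 0 then [::] else map (squeeze s) [seq r <- L | ndg r].
Proof.
move=> s0; rewrite filter_map; case: eqVneq => [->|sn].
  rewrite (eq_filter (a2 := pred0)) ?filter_pred0 // => r.
  by rewrite /= /ndg /= !mul0r ltxx.
by rewrite (eq_filter (a2 := ndg)) // => r /=; rewrite ndg_squeeze // lt_def sn.
Qed.

Definition ndg_rects c w := [seq r <- rects (build c w) | ndg r].

Lemma ndg_rects_sigma c w : 0 <= half (w 0) -> ndg_rects (Sigma :: c) w =
  (if half (w 0) < 1 then [:: Rect (half (w 0)) 1 0 1] else [::]) ++
  (if half (w 0) == 0 then [::] else map (squeeze (half (w 0))) (ndg_rects c (fun k => w k.+1))).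
Proof.
move=> s0; rewrite /ndg_rects /=; case: (build c _) => A B.
rewrite -filter_squeeze // [rects _]/= /=.
rewrite (_ : ndg (Rect _ _ _ _) = (half (w 0) < 1)); last by rewrite /ndg /= ltr01 andbT.
by case: (_ < 1).
Qed.

Lemma half1 : half (1 : R) = 1. Proof. by rewrite /half; lra. Qed.
Lemma halfN1 : half (-1 : R) = 0. Proof. by rewrite /half; lra. Qed.
Lemma half_eq1 (x : R) : half x = 1 -> x = 1. Proof. by rewrite /half; lra. Qed.
Lemma half_eq0 (x : R) : half x = 0 -> x = -1. Proof. by rewrite /half; lra. Qed.

Lemma ndg_rects_size c w : good c (build c w) -> size (ndg_rects c w) = (size c).+1 ->
  ndg_rects c w = rects (build c w).
Proof.
move=> g sz; apply/all_filterP; rewrite all_count -size_filter -/(ndg_rects c w) sz.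
by rewrite (good_size g).
Qed.

(** With another head than [Sigma] the rank of [c] is at least [b ^ size e], which exceeds that of
    [e]. For [Sigma], parameter 1 makes the added rectangle degenerate and changes nothing else;
    parameter 0 leaves only this rectangle, so [e] is empty; otherwise [e] starts with [Sigma] at
    the same parameter and the argument goes on behind it. *)
Lemma build_face b c e w w' : code_ok c -> code_ok e -> size c = (size e).+1 -> ((size c).*2.+4 < b)%N ->
  in_box (size c) w -> in_obox (size e) w' -> perm_eq (ndg_rects c w) (rects (build e w')) ->
  (rank b e < rank b c)%N \/ Sigma :: e = c /\
    ((exists2 k, (k < sigmas c)%N & w k = 1) \/ (sigmas c = size c /\ w (size e) = -1)).
Proof.
elim: c e w w' => [|o c IH] e w w' //= /andP[ad ok] oke [sz] hb bw ow pm.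
have hb' : ((size c).*2.+4 < b)%N by move: hb; rewrite doubleS; clear; lia.
have hbe : ((size e).*2.+4 < b)%N by rewrite -sz.
have rT := regular_build oke ow; have gT := regular_good rT.
case: o ad pm => [k|k i|] ad pm; try by left; rewrite /= mulSn -addnA; apply: leq_trans (rank_lt hbe oke) _; rewrite sz leq_addr.
have gS : good c (build c (fun k => w k.+1)) by apply: good_build => // k kd; exact: bw.
have s01 := half_itv (bw 0 isT); have s0 : 0 <= half (w 0) by case/andP: s01.
rewrite ndg_rects_sigma // in pm.
have [e1|n1] := eqVneq (half (w 0)) 1.
  rewrite e1 ltxx oner_eq0 squeeze1 /= in pm.
  have szr : size (ndg_rects c (fun k => w k.+1)) = (size c).+1.
    by rewrite (perm_size pm) (good_size gT) sz.
  rewrite ndg_rects_size // in pm.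
  have bw' : in_box (size c) (fun k => w k.+1) by move=> k kd; exact: bw.
  have ow' : in_obox (size c) w' by rewrite sz.
  have [_ [[-> _]|lt]] := build_compare hb' ok oke (esym sz) bw' ow' pm.
  - right; split=> //; left; exists 0 => //; exact: half_eq1.
  - by left.
have lt1 : half (w 0) < 1 by rewrite lt_neqAle n1; case/andP: s01.
rewrite lt1 in pm; have [e0|n0] := eqVneq (half (w 0)) 0.
  rewrite e0 eqxx in pm; have := perm_size pm; rewrite (good_size gT) /= => -[/esym/size0nil ee].
  rewrite ee /= in sz *; move/size0nil: sz => ->.
  by right; split=> //; right; split=> //=; exact: half_eq0.
rewrite (negbTE n0) in pm.
have s01' : 0 < half (w 0) < 1 by rewrite lt_def n0 s0.
have [e1 e2] := right_side_unique gT (good_tiles gT) (regular_ndg rT) (perm_refl _) pm (conj erefl erefl)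
   (fun r => ltac:(by rewrite inE => /eqP ->)).
case: e oke sz ow hbe rT gT pm e1 e2 => [|o e] oke sz ow hbe rT gT pm e1 e2.
  by move: e1 n0 => /= -[<-]; rewrite eqxx.
have := good_count gT; rewrite e1; case: o oke sz ow hbe rT gT pm e1 e2 => [k|k i|] oke sz ow hbe rT gT pm e1 e2.
- by have /andP[h _] := right_count_le e; move=> /= [h2]; move: h; rewrite -h2.
- by case/andP: oke => /and4P[_ _ _ h] _ /= [h2]; move: h; rewrite -subn_gt0 -h2.
move=> _; move/andP: oke => [_ oke].
have rT' : regular e (build e (fun k => w' k.+1)) by apply: regular_build => // k kd; exact: ow.
have [es pe] : half (w 0) = half (w' 0) /\ perm_eq (ndg_rects c (fun k => w k.+1)) (rects (build e (fun k => w' k.+1))).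
  move: e1 e2 => /=; case: (build e _) => A' B' /= [e1] p; split=> //; move: p; rewrite e1 perm_sym => /perm_map_inj; apply.
  by apply: squeeze_inj; case/andP: s01'.
have [|||[ee H]] := IH e (fun k => w k.+1) (fun k => w' k.+1) ok oke sz hb' _ _ pe.
- by move=> k kd; exact: bw.
- by move=> k kd; exact: ow.
- by left.
right; split; first by rewrite ee.
case: H => [[k ks wk]|[es' wl]]; [left; exists k.+1 => //|right; split=> //].
by rewrite es'.
Qed.

Definition del (k : nat) w : nat -> R := fun j => if (j < k)%N then w j else w j.+1.

(** At parameter 1 a [Sigma] squeezes nothing and adds a degenerate rectangle. All operations up to
    position [k] are [Sigma], so deleting any of them leaves the same code. *)
Lemma face_one c k w : in_box (size c) w -> (k < sigmas c)%N -> w k = 1 ->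
  perm_eq (ndg_rects c w) (ndg_rects (behead c) (del k w)).
Proof.
elim: c k w => [|[j|j i|] c IH] // [|k] w bw /= ks wk.
  by rewrite ndg_rects_sigma wk half1 ?ler01 // ltxx oner_eq0 squeeze1.
case: c IH bw ks => [|[j|j i|] c] // IH bw ks.
have s0 : 0 <= half (w 0) by case/andP: (half_itv (bw 0 isT)).
rewrite [in X in perm_eq X _]ndg_rects_sigma // [X in perm_eq _ X]ndg_rects_sigma //.
rewrite perm_cat2l; case: ifP => // _; apply: perm_map.
by apply: (IH k (fun k => w k.+1)) => // j jd; exact: bw.
Qed.

(** At parameter 0 the operation in position [j] leaves only its own rectangle, now the unit square.
    The coordinates after [j] cease to matter, and the code can be shortened at its end. *)
Lemma face_minus_one m j w : in_box m.+1 w -> (j <= m)%N -> w j = -1 ->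
  perm_eq (ndg_rects (nseq m.+1 Sigma) w) (ndg_rects (nseq m Sigma) w).
Proof.
elim: m j w => [|m IH] [|j] w bw //= jm wj.
- by rewrite ndg_rects_sigma wj halfN1 // ltr01 eqxx /= /ndg_rects /= /ndg /= ltr01.
- rewrite [in X in perm_eq X _]ndg_rects_sigma ?wj ?halfN1 // ltr01 eqxx.
  by rewrite [X in perm_eq _ X]ndg_rects_sigma ?wj ?halfN1 // ltr01 eqxx.
have s0 : 0 <= half (w 0) by case/andP: (half_itv (bw 0 isT)).
rewrite [in X in perm_eq X _]ndg_rects_sigma // [X in perm_eq _ X]ndg_rects_sigma //.
rewrite perm_cat2l; case: ifP => // _; apply: perm_map.
by apply: (IH j (fun k => w k.+1)) => // k kd; exact: bw.
Qed.

Lemma low_sigmas c : low c = if sigmas c == size c then odd (sigmas c) else ~~ odd (sigmas c).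
Proof.
elim: c => [|[j|j i|] c IH] //=; rewrite IH eqSS; case: ifP => // _; by rewrite negbK.
Qed.

Lemma sigmas_le c : (sigmas c <= size c)%N.
Proof. by elim: c => [|[j|j i|] c IH]. Qed.

Lemma sigmas_all c : sigmas c = size c -> c = nseq (size c) Sigma.
Proof. by elim: c => [|[j|j i|] c IH] //= [/IH {1}->]. Qed.

End Matching.

(** * Cancelling groups of faces *)

Section CancelFaces.
Variables (R : realType) (T : topologicalType) (d : nat).
Notation I := (@unit_itv R).
Notation W := (seqspace R).
Implicit Types (f g : nat * R) (w : W) (t : R).
Hypothesis hT : hausdorff_space T.
Variables (B : set T) (psi phi : W -> T).
Let P := B `|` psi @` cube d.
Hypothesis att_psi : attached B (cube d) (sphere_of_cube d) psi.
Hypothesis att_phi : attached P (cube d.+1) (sphere_of_cube d.+1) phi.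

Definition is_face (f : nat * R) := (f.1 < d.+1)%N /\ (f.2 = 1 \/ f.2 = -1).
Definition on_faces (s : seq (nat * R)) : set W := [set w | exists2 f, f \in s & w f.1 = f.2].

(* The faces of the big cell that are mapped onto the small cell, other than the
   face [w 0 = 1], come in groups; on the [m]-th group the attaching map factors
   through [kap m], and pushing towards a horn moves it off the small cell. *)
Variables (M : nat) (faces : nat -> seq (nat * R)) (kap : nat -> W -> W)
  (pos : nat -> nat) (sg : nat -> R).
Hypothesis pos_lt : forall m, (m < M)%N -> (pos m < d)%N.
Hypothesis sg1 : forall m, (m < M)%N -> sg m = 1 \/ sg m = -1.
Hypothesis faces_face : forall m f, (m < M)%N -> f \in faces m -> is_face f.
Hypothesis faces_disjoint : forall m m' f, (m < M)%N -> (m' < M)%N ->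
  f \in faces m -> f \in faces m' -> m = m'.
Hypothesis faces0 : forall m, (m < M)%N -> (0%N, 1) \notin faces m.
Hypothesis kap_continuous : forall m, (m < M)%N -> continuous (kap m).
Hypothesis kap_cube : forall m w, (m < M)%N -> cube d.+1 w -> cube d (kap m w).
Hypothesis kap_phi : forall m f w, (m < M)%N -> cube d.+1 w -> f \in faces m -> w f.1 = f.2 ->
  psi (kap m w) = phi w.
Hypothesis kap_horn : forall m g w, (m < M)%N -> cube d.+1 w -> is_face g -> g \notin faces m ->
  w g.1 = g.2 -> on_faces (faces m) w -> horn d (pos m) (sg m) (kap m w).
Hypothesis face0_phi : forall w, cube d.+1 w -> w 0%N = 1 -> phi w = psi (fun k => w k.+1).
Hypothesis rest_phi : forall w, sphere_of_cube d.+1 w -> w 0%N <> 1 ->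
  (forall m, (m < M)%N -> ~ on_faces (faces m) w) -> B (phi w).

Lemma on_faces_closed (s : seq (nat * R)) : closed (on_faces s).
Proof.
elim: s => [|f s IH].
  by rewrite (_ : on_faces _ = set0); [exact: closed0|apply/seteqP; split=> w // []].
rewrite (_ : on_faces _ = [set w | [set f.2] (w f.1)] `|` on_faces s).
  apply: closedU => //; apply: closed_comp => [w _|]; first exact: continuous_coord.
  by apply: compact_closed; [exact: Rhausdorff|exact: compact_set1].
apply/seteqP; split=> w.
  by move=> [g]; rewrite inE => /orP[/eqP ->|gs] e; [left|right; exists g].
by move=> [e|[g gs e]]; [exists f => //; exact: mem_head|exists g => //; rewrite inE gs orbT].
Qed.

Let group w := fun m => (m < M)%N /\ on_faces (faces m) w.

Let push m (p : W * R) := psi (horn_push d (pos m) (sg m) (kap m p.1, p.2)).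

Let h (p : W * R) : T :=
  if pselect (exists m, group p.1 m) is left e then push (projT1 (cid e)) p else phi p.1.

(** Where a group meets a face outside it, [kap m] has values in the horn, which the push fixes.
    Hence the pushes of different groups agree with each other and with [phi] on overlaps. *)
Let push_id m g w t : (m < M)%N -> cube d.+1 w -> on_faces (faces m) w -> is_face g ->
  g \notin faces m -> w g.1 = g.2 -> push m (w, t) = phi w.
Proof.
move=> mM cw [f fm wf] fg gm wg; rewrite /push horn_push_id //; try by auto.
  exact: kap_phi mM cw fm wf.
by apply: kap_horn mM cw fg gm wg _; exists f.
Qed.

Let h_group m w t : (m < M)%N -> cube d.+1 w -> on_faces (faces m) w -> h (w, t) = push m (w, t).
Proof.
move=> mM cw om; rewrite /h; case: pselect => [e|[]]; last by exists m.
case: (cid e) => m' /= [m'M om']; have [->//|mm] := eqVneq m' m.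
have [[f fm wf] [f' fm' wf']] := (om, om').
rewrite (@push_id m' f w t) //; first last.
- by apply/negP => h'; move/eqP: mm; apply; exact: faces_disjoint h' fm.
- exact: faces_face fm.
rewrite (@push_id m f' w t) //; last by apply/negP => h'; move/eqP: mm; apply; exact: faces_disjoint fm' h'.
exact: faces_face fm'.
Qed.

Let h_free g w t : cube d.+1 w -> is_face g -> w g.1 = g.2 ->
  (forall m, (m < M)%N -> g \notin faces m) -> h (w, t) = phi w.
Proof.
move=> cw fg wg ng; rewrite /h; case: pselect => //= e.
by case: (cid e) => m [mM om]; rewrite (@push_id m g) //=; exact: ng.
Qed.

Let all_faces : seq (nat * R) := [seq (k, 1) | k <- iota 0 d.+1] ++ [seq (k, -1) | k <- iota 0 d.+1].

Let all_facesP f : is_face f <-> f \in all_faces.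
Proof.
rewrite mem_cat; split.
  move=> [kd f2]; apply/orP; move: kd f2; case: f => k e; rewrite [(k, e).1]/= [(k, e).2]/= => kd [->|->]; [left|right].
    by apply/mapP; exists k; rewrite // mem_iota add0n.
  by apply/mapP; exists k; rewrite // mem_iota add0n.
by case/orP => /mapP[k]; rewrite mem_iota add0n => /andP[_ kd] ->; split=> //; [left|right].
Qed.

Let free_faces := [seq f <- all_faces | all (fun m => f \notin faces m) (iota 0 M)].

Let sphere_face w : sphere_of_cube d.+1 w -> exists2 f, is_face f & w f.1 = f.2.
Proof.
move=> /sphere_of_cubeP [_ [k kd wk]]; exists (k, w k) => //; split=> //=.
by move/eqP: wk; rewrite eqr_norml => /andP[/orP[/eqP|/eqP]]; [left|right].
Qed.

Let face_sphere w f : cube d.+1 w -> is_face f -> w f.1 = f.2 -> sphere_of_cube d.+1 w.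
Proof.
by move=> cw [fd f2] wf; apply: (sphere_of_cubeI cw fd); rewrite wf; case: f2 => ->; rewrite ?normrN normr1.
Qed.

(** The sphere is covered by the groups and by the faces in no group; on each of these closed sets
    [h] is given by one formula. *)
Let ch : clc (sphere_of_cube d.+1 `*` I) h.
Proof.
have [cpsi _ _ _ _] := att_psi; have [cphi _ _ _ _] := att_phi.
have cI := @unit_itv_closed R; have cQ := @cube_closed R d.+1.
pose G m := cube d.+1 `&` on_faces (faces m) : set W.
have key k : (k <= M)%N -> clc ([set p : W * R | exists2 m, (m < k)%N & G m p.1 /\ I p.2]) h.
  elim: k => [|k IH] kM.
    rewrite (_ : [set p | _] = set0); last by apply/seteqP; split=> p // [m].
    by move=> C _; rewrite set0I; exact: closed0.
  rewrite (_ : [set p | _] = [set p : W * R | exists2 m, (m < k)%N & G m p.1 /\ I p.2] `|` G k `*` I); last first.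
    apply/seteqP; split=> p.
      move=> [m]; rewrite ltnS leq_eqVlt => /orP[/eqP ->|mk] H; [by right|by left; exists m].
    by move=> [[m mk H]|H]; [exists m => //; exact: ltnW|exists k].
  apply: clcU; first exact/IH/ltnW.
  apply: (@clc_eq _ _ _ (push k)); last by move=> [w t] [/= [cw om] It]; rewrite (@h_group k).
  apply: (@clc_comp _ _ _ _ _ (fun p : W * R => horn_push d (pos k) (sg k) (kap k p.1, p.2)) psi _ cpsi).
    apply: continuous_clc; first by apply: closed_setX => //; apply: closedI => //; exact: on_faces_closed.
    apply: (@continuous_comp2 _ _ _ (fun p : W * R => (kap k p.1, p.2)) (horn_push d (pos k) (sg k))); last exact: horn_push_continuous.
    apply: continuous_pair; last exact: continuous_snd.
    by apply: (@continuous_comp2 _ _ _ fst (kap k)); [exact: continuous_fst|exact: kap_continuous].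
  move=> [w t] [/= [cw om] It]; apply: horn_push_cube => //; [exact: pos_lt|exact: sg1|exact: kap_cube].
rewrite (_ : _ `*` _ = [set p : W * R | exists2 m, (m < M)%N & G m p.1 /\ I p.2] `|`
   (cube d.+1 `&` on_faces free_faces) `*` I); last first.
  apply/seteqP; split=> -[w t] /=.
    move=> [sw It]; have [cw _] := sw; have [f ff wf] := sphere_face sw.
    have [fr|] := boolP (f \in free_faces); first by right; split=> //; split=> //; exists f.
    rewrite mem_filter (proj1 (all_facesP f) ff) andbT => /allPn [m].
    rewrite mem_iota add0n negbK => /andP[_ mM] fm; left; exists m => //; split=> //.
    by split=> //; exists f.
  move=> [[m mM [[cw [f fm wf]] It]]|[[cw [f]]]]; first by split=> //; apply: face_sphere wf => //; exact: faces_face fm.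
  by rewrite mem_filter => /andP[_ /all_facesP ff] wf It; split=> //; exact: face_sphere wf.
apply: clcU; first exact: key.
apply: (@clc_eq _ _ _ (phi \o fst)).
  apply: (@clc_comp _ _ _ _ _ fst phi _ cphi) => [|p [[]]//].
  apply: continuous_clc; last exact: continuous_fst.
  by apply: closed_setX => //; apply: closedI => //; exact: on_faces_closed.
move=> [w t] [/= [cw [f]]]; rewrite mem_filter => /andP[/allP fr /all_facesP ff] wf It.
by rewrite (@h_free f) // => m mM; apply: fr; rewrite mem_iota add0n.
Qed.

(** At time 1 each group is mapped through a horn, hence through the boundary of the small cube,
    which [psi] sends to [B]. Only the face [w 0 = 1] still covers the small cell. *)
Lemma cancel_faces : deforms_into R (P `|` phi @` cube d.+1) B.
Proof.
have [_ _ _ _ [sB _ _]] := att_psi; have [_ _ _ _ [sP _ _]] := att_phi.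
have pushP w : (exists m, group w m) \/ (forall m, (m < M)%N -> ~ on_faces (faces m) w).
  by case: (pselect (exists m, group w m)) => e; [left|right=> m mM om; apply: e; exists m].
have hphi w t : (forall m, (m < M)%N -> ~ on_faces (faces m) w) -> h (w, t) = phi w.
  by move=> n; rewrite /h; case: pselect => // e; exfalso; case: e => m [mM om]; exact: n om.
have face0 : is_face (0%N, 1) by split=> //; left.
have shift_cube (w : W) : cube d.+1 w -> cube d (fun k => w k.+1).
  by move=> [c1 c2]; split=> k kd; [exact: c1|exact: c2].
apply: (@pair_deform R T d hT B psi phi h att_psi att_phi ch).
- move=> w sw; have [cw _] := sw; have [[m [mM om]]|n] := pushP w; last exact: hphi.
  rewrite (@h_group m) // /push horn_push0 //=; case: om => f fm wf; exact: kap_phi fm wf.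
- move=> w t sw It; have [cw _] := sw; have [[m [mM om]]|n] := pushP w; last by rewrite hphi //; exact: sP.
  rewrite (@h_group m) //; right; eexists; last reflexivity.
  by apply: horn_push_cube => //; [exact: pos_lt|exact: sg1|exact: kap_cube].
- move=> w [cw _] w0; rewrite -face0_phi //; apply: (@h_free (0%N, 1)) => //; exact: faces0.
move=> w [cw hw]; have [[m [mM om]]|n] := pushP w.
  rewrite (@h_group m) // /push horn_push1; apply: sB.
  have [cr hr] := horn_retr_horn (pos_lt mM) (sg1 mM) (kap_cube mM cw).
  case: hr => [e|[k [kd _ e]]]; last exact: sphere_of_cubeI e.
  apply: (sphere_of_cubeI cr (pos_lt mM)); rewrite e.
  by case: (sg1 mM) => ->; rewrite ?opprK ?normrN normr1.
rewrite hphi //; have [w0|w0] := pselect (w 0%N = 1).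
  rewrite face0_phi //; apply: sB; case: hw => [e|[[|k] [kd // _ e]]].
    by move: e; rewrite w0 => /eqP; rewrite -subr_eq0 opprK gt_eqF // ltr0n.
  exact: (sphere_of_cubeI (shift_cube w cw) kd).
apply: rest_phi => //; case: hw => [e|[k [kd _ e]]]; last exact: sphere_of_cubeI e.
by apply: (@sphere_of_cubeI _ _ _ 0) => //; rewrite e normrN normr1.
Qed.

End CancelFaces.

(** * Generic tilings *)

Section GenericPoints.
Variable R : realType.
Implicit Types (r q : rect R) (A B L M : seq (rect R)) (S : state R) (s : R) (w : nat -> R).
Notation u := (unit_square R).

Definition values (f : rect R -> R) L := undup (map f L).
(* The number of distinct coordinates detects generic points of a cell: it is
   maximal there and never maximal on the boundary of a cell. *)
Definition coord_number L : nat := (size (values rx0 L) + size (values ry0 L))%N.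

Lemma coord_number_perm L M : perm_eq L M -> coord_number L = coord_number M.
Proof. by move=> LM; rewrite /coord_number /values; congr addn; apply/perm_size/perm_undup/perm_mem/perm_map. Qed.

Lemma values_le f g L M : {subset map f L <= map g M} -> (size (values f L) <= size (values g M))%N.
Proof.
move=> LM; apply: uniq_leq_size; first exact: undup_uniq.
by move=> x; rewrite !mem_undup; exact: LM.
Qed.

Lemma values_le1 f g L M a : {subset map f L <= a :: map g M} -> (size (values f L) <= (size (values g M)).+1)%N.
Proof.
move=> LM; apply: (@uniq_leq_size _ _ (a :: values g M)); first exact: undup_uniq.
by move=> x; rewrite inE !mem_undup => /LM; rewrite inE.
Qed.

Lemma values_lt f g L M a : a \notin map f L -> {subset a :: map f L <= map g M} ->
  (size (values f L) < size (values g M))%N.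
Proof.
move=> aL LM; apply: (@uniq_leq_size _ (a :: values f L)); first by rewrite /= undup_uniq mem_undup aL.
by move=> x; rewrite inE !mem_undup => h; apply: LM; rewrite inE.
Qed.

Lemma hcut_coords k s A B : (k < size A)%N -> let L := rects (apply_op (Hcut k) s (A, B)) in
  let a := ry0 (cut_high s (nth u A k)) in
  [/\ map rx0 L =i map rx0 (A ++ B) & map ry0 L =i a :: map ry0 (A ++ B)].
Proof.
move=> kA L a; have EA := split_nth kA.
have EL : L = take k A ++ [:: cut_low s (nth u A k), cut_high s (nth u A k) & drop k.+1 A] ++ B.
  by rewrite /L /rects /= -catA.
split=> x; rewrite EL [in RHS]EA !(map_cat, mem_cat, map_cons, in_cons) ?mem_cat.
  rewrite (_ : rx0 (cut_low _ _) = rx0 (nth u A k)) // (_ : rx0 (cut_high _ _) = rx0 (nth u A k)) //.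
  by case: (x == rx0 _); case: (x \in map _ (take k A)).
rewrite (_ : ry0 (cut_low _ _) = ry0 (nth u A k)) // -/a; case: (x == a); case: (x == ry0 _); case: (x \in map _ (take k A)); rewrite ?orbT //.
Qed.

Lemma strip_coords c k i s S : good c S -> admissible (Strip k i) c -> 0 <= s <= 1 ->
  let L := rects (apply_op (Strip k i) s S) in
  [/\ map rx0 L =i strip_left k i s S.1 :: map rx0 (rects S) & map ry0 L =i map ry0 (rects S)].
Proof.
move=> g ad s01 L; have [y [y' sp]] := strip_facts g ad s01.
case: S g sp @L => A B g sp L; have EA := split_three A k i; set M := take i (drop k A) in EA.
have M0 : M != [::].
  by rewrite -size_eq0 (strip_size2 sp); case/and4P: ad => _ h _ _; rewrite -lt0n.
have hM : head u M \in M by case: (M) M0 => //= r M' _; exact: mem_head.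
have EL : L = take k A ++ Rect (strip_left k i s A) 1 (ry0 (head u M)) (ry1 (last u M)) :: drop (k + i) A ++
    map (trim (strip_left k i s A)) M ++ B by rewrite /L /rects /= -catA.
have e0 a : map rx0 (map (trim a) M) = map rx0 M by rewrite -map_comp.
have e1 a : map ry0 (map (trim a) M) = map ry0 M by rewrite -map_comp.
rewrite EL /rects [(A, B).1]/= [(A, B).2]/= {EL L}; set a := strip_left k i s A.
split=> x; rewrite [in RHS]EA !(map_cat, mem_cat, in_cons, map_cons) ?e0 ?e1 /=.
  by case: (x == _); case: (x \in map rx0 (take k A)); case: (x \in map rx0 M); case: (x \in map rx0 (drop _ A)).
case: eqVneq => [->|_]; first by rewrite (map_f _ hM) ?orbT.
by case: (x \in map ry0 (take k A)); case: (x \in map ry0 M); case: (x \in map ry0 (drop _ A)).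
Qed.

(** A [Hcut] adds one height, a [Strip] or a [Sigma] one left coordinate; squeezing can only
    identify left coordinates. *)
Lemma coord_number_apply o c S s : good c S -> admissible o c -> 0 <= s <= 1 ->
  (coord_number (rects (apply_op o s S)) <= (coord_number (rects S)).+1)%N.
Proof.
move=> g ad s01; case: o ad => [k|k i|] ad; rewrite /coord_number.
- case: S g => A B g.
  have kA : (k < size A)%N by rewrite (good_count g); exact: leq_ltn_trans ad (good_peak g).
  have [e1 e2] := hcut_coords s B kA; rewrite -addnS leq_add //.
    by apply: values_le => x; rewrite e1.
  by apply: values_le1 => x; rewrite e2; apply.
- have [e1 e2] := strip_coords g ad s01; rewrite -addSn leq_add //.
    by apply: values_le1 => x; rewrite e1; apply.
  by apply: values_le => x; rewrite e2.
- case: S g => A B g; have A0 : A != [::] by rewrite -size_eq0 (good_count g); have := good_peak g; case: (right_count c).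
  have st := good_stack g; have [h0 _] := stack_ends st A0; rewrite -addSn leq_add //.
    rewrite /values /= -map_comp.
    apply: leq_trans (_ : (size (undup (map (rx0 \o squeeze s) (A ++ B)))).+1 <= _)%N; first by case: ifP.
    rewrite ltnS (map_comp (fun x => s * x) rx0) -[leqRHS](size_map (fun x => s * x)).
    apply: uniq_leq_size; first exact: undup_uniq.
    by move=> x; rewrite mem_undup => /mapP[y yL ->]; rewrite map_f // mem_undup.
  apply: values_le => x; rewrite /= -map_comp inE => /orP[/eqP ->|//].
  rewrite -h0 map_f // mem_cat; case: (A) A0 => //= r A' _; by rewrite mem_head.
Qed.

Lemma ndg_apply o c S s : good c S -> admissible o c -> 0 <= s <= 1 ->
  all ndg (rects (apply_op o s S)) -> all ndg (rects S).
Proof.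
move=> g ad s01; case: o ad => [k|k i|] ad.
- case: S g => A B g.
  have kA : (k < size A)%N by rewrite (good_count g); exact: leq_ltn_trans ad (good_peak g).
  rewrite /rects /= [in X in _ -> X](split_nth kA) !all_cat /= => /andP[/and4P[-> /andP[h1 h2] _ ->] ->].
  rewrite !andbT /= /ndg h1 /=; move: h2; rewrite /= ltrDl; case/andP: s01 => s0 _.
  move=> h; rewrite -subr_gt0 ltNge; apply/negP => h'.
  by move: h; rewrite ltNge mulr_ge0_le0.
- have [y [y' sp]] := strip_facts g ad s01; case: S g sp => A B g sp.
  rewrite /rects /= [in X in _ -> X](split_three A k i) !all_cat /= => /andP[/and3P[-> _ ->] /andP[/allP h ->]].
  rewrite !andbT /=; apply/allP => r rM; have := h _ (map_f _ rM); rewrite /ndg /= => /andP[h1 ->].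
  rewrite andbT (good_right g) ?(mem_drop (mem_take rM)) //.
  exact: lt_le_trans h1 (strip_le1 sp).
- case: S g => A B g /= /andP[_ /allP h]; apply/allP => r rL; have := h _ (map_f _ rL).
  rewrite /ndg /= => /andP[h1 ->]; rewrite andbT; case/andP: s01 => s0 _; move: h1.
  by apply: contraTT; rewrite -!leNgt => ?; exact: ler_wpM2l.
Qed.

(** The extreme parameters produce degenerate rectangles, except for [Strip] at 0; there the new
    left coordinate is the largest one in the window, which is not new. *)
Lemma coord_number_end o c S s : good c S -> admissible o c -> s = 0 \/ s = 1 ->
  all ndg (rects (apply_op o s S)) -> (coord_number (rects (apply_op o s S)) <= coord_number (rects S))%N.
Proof.
move=> g ad s01; case: o ad => [k|k i|] ad.
- case: S g => A B g.
  rewrite /rects /= !all_cat /= => /andP[/and4P[_ /andP[_ h1] /andP[_ h2] _] _]; exfalso.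
  by move: h1 h2 => /=; case: s01 => ->; rewrite ?mul0r ?mul1r ?addr0 ?subrKC ltxx.
- case: s01 => es; last first.
    case: S g => A B g; rewrite /rects /= !all_cat /= => /andP[/and3P[_ /andP[/= h _] _] _].
    by move: h; rewrite es /strip_left mul1r subrKC ltxx.
  have s01 : 0 <= s <= 1 by rewrite es lexx ler01.
  have [y [y' sp]] := strip_facts g ad s01; have [e1 e2] := strip_coords g ad s01 => _.
  apply: leq_add; apply: values_le => x; rewrite ?e1 ?e2 //.
  rewrite inE => /orP[/eqP ->|//]; rewrite es /strip_left mul0r addr0.
  (* If the maximum is only the initial value 0, a trimmed rectangle starts at 0, so the value 0
     occurs already. *)
  case: (max_left_attained (window k i S.1)) => [m0|[q /window_sub qA ->]]; last by rewrite map_f // mem_cat qA.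
  have [q qM] : exists q, q \in take i (drop k S.1).
    have := strip_size2 sp; case/and4P: ad => _ h _ _; case: (take i _) => [e|q M _]; first by rewrite -e in h.
    by exists q; exact: mem_head.
  have qA := mem_drop (mem_take qM); have := strip_mid_le sp qM; rewrite m0 => q0.
  have [q0' _ _ _ _] := good_left g qA.
  by rewrite (_ : 0 = rx0 q) ?map_f ?mem_cat ?qA //; apply/le_anti; rewrite q0 q0'.
- case: S g => A B g /= /andP[/andP[h1 _] /allP h2]; exfalso.
  case: s01 => es; last by move: h1; rewrite es ltxx.
  have [r rA] : exists r, r \in A.
    have := good_count g; have := good_peak g; case: (A) => [|r A'] /=; last by exists r; exact: mem_head.
    by move=> h e; rewrite -e in h.
  have := h2 (squeeze s r); rewrite map_f ?mem_cat ?rA // => /(_ isT) /andP[/= h _].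
  by move: h; rewrite es !mul0r ltxx.
Qed.

Lemma coord_number_build c w : code_ok c -> in_box (size c) w ->
  (coord_number (rects (build c w)) <= size c + 2)%N.
Proof.
elim: c w => [|o c IH] w /=; first by move=> _ _; rewrite /rects /= /coord_number.
move=> /andP[ad ok] bw; have bw' : in_box (size c) (fun k => w k.+1) by move=> k kd; exact: bw.
apply: leq_trans (coord_number_apply (good_build ok bw') ad (half_itv (bw 0 isT))) _.
by rewrite ltnS; exact: IH.
Qed.

Lemma coord_number_boundary c w k : code_ok c -> in_box (size c) w -> (k < size c)%N -> `|w k| = 1 ->
  all ndg (rects (build c w)) -> (coord_number (rects (build c w)) < size c + 2)%N.
Proof.
elim: c k w => [|o c IH] // k w /= /andP[ad ok] bw kd wk nd.
have bw' : in_box (size c) (fun k => w k.+1) by move=> j jd; exact: bw.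
have g := good_build ok bw'; have s01 := half_itv (bw 0 isT).
case: k kd wk => [|k] kd wk.
  rewrite addSn ltnS; apply: leq_trans (coord_number_build ok bw').
  apply: coord_number_end g ad _ nd.
  move/eqP: wk; rewrite eqr_norml => /andP[/orP[/eqP ->|/eqP ->] _]; rewrite /half; [right|left]; lra.
apply: leq_ltn_trans (coord_number_apply g ad s01) _; rewrite addSn ltnS.
by apply: IH wk _ => //; exact: ndg_apply g ad s01 nd.
Qed.

Lemma avoid_finite (bad : seq R) : exists2 s, 0 < s < 1 & s \notin bad.
Proof.
pose pts : seq R := [seq (k.+2%:R)^-1 | k <- iota 0 (size bad).+1].
have upts : uniq pts.
  rewrite map_inj_uniq ?iota_uniq // => i j /invr_inj /eqP; rewrite eqr_nat => /eqP [].
  by [].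
have : ~~ all (mem bad) pts.
  apply/negP => /allP h; have := uniq_leq_size upts h.
  by rewrite size_map size_iota ltnn.
move=> /allPn [s /mapP[k _ ->] sb]; exists (k.+2%:R)^-1 => //.
by rewrite invr_gt0 ltr0n /= invf_lt1 ?ltr0n // ltr1n.
Qed.

Lemma avoid_affine (bad : seq R) (a d : R) : d != 0 -> exists2 s, 0 < s < 1 & a + s * d \notin bad.
Proof.
move=> d0; have [s s01 sb] := avoid_finite [seq (x - a) / d | x <- bad].
exists s => //; apply: contra sb => h; apply/mapP; exists (a + s * d) => //.
by rewrite addrAC subrr add0r mulfK.
Qed.

(** The new coordinate is a nonconstant affine function of the parameter, so it avoids finitely many
    values. For [Sigma] the parameter 1/2 will do: squeezed nondegenerate rectangles start to the
    left of 1/2. *)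
Lemma coord_number_grow o c S : regular c S -> admissible o c ->
  exists2 s, 0 < s < 1 & (coord_number (rects S) < coord_number (rects (apply_op o s S)))%N.
Proof.
move=> rg ad; have g := regular_good rg; have nd := allP (regular_ndg rg).
case: o ad => [k|k i|] ad; rewrite /coord_number.
- case: S g rg nd => A B g rg nd.
  have kA : (k < size A)%N by rewrite (good_count g); exact: leq_ltn_trans ad (good_peak g).
  have /andP[_ ny] : ndg (nth u A k) by apply: nd; rewrite mem_cat mem_nth.
  have d0 : ry1 (nth u A k) - ry0 (nth u A k) != 0 by rewrite subr_eq0 gt_eqF.
  have [s s01 sb] := avoid_affine (map ry0 (A ++ B)) (ry0 (nth u A k)) d0; exists s => //.
  have [e1 e2] := hcut_coords s B kA; rewrite -addnS leq_add //.
    by apply: values_le => x; rewrite e1.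
  by apply: (values_lt sb) => x; rewrite e2.
- have m1 := regular_max_left k i rg.
  have d0 : 1 - max_left (window k i S.1) != 0 by rewrite subr_eq0 gt_eqF.
  have [s s01 sb] := avoid_affine (map rx0 (rects S)) (max_left (window k i S.1)) d0; exists s => //.
  have s01' : 0 <= s <= 1 by case/andP: s01 => /ltW -> /ltW ->.
  have [e1 e2] := strip_coords g ad s01'; rewrite -addSn leq_add //.
    by apply: (values_lt sb) => x; rewrite e1.
  by apply: values_le => x; rewrite e2.
- case: S g rg nd => A B g rg nd; exists 2^-1; first by rewrite invr_gt0 invf_lt1 ?ltr0n // ltr1n.
  have sn : (2^-1 : R) != 0 by rewrite invr_neq0.
  rewrite -addSn leq_add //; last first.
    by apply: values_le => x; rewrite /= -map_comp inE => ->; rewrite orbT.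
  rewrite /values /= -map_comp (map_comp (fun x => 2^-1 * x) rx0) ifF.
    by rewrite (undup_map_inj (mulfI sn)) /= size_map.
  apply/negP => /mapP[x /mapP[r rL ->] /eqP]; rewrite -{1}[2^-1]mulr1 (inj_eq (mulfI sn)) => /eqP e.
  have /andP[nx _] := nd r rL; have /and5P[_ _ x1 _ _] := allP (good_valid g) r rL.
  by move: nx; rewrite -e ltNge x1.
Qed.

Lemma generic_point c : code_ok c -> exists w, in_obox (size c) w /\
  coord_number (rects (build c w)) = (size c + 2)%N.
Proof.
elim: c => [|o c IH] /=; first by move=> _; exists (fun=> 0); split.
move=> /andP[ad ok]; have [w [ow gw]] := IH ok; have rg := regular_build ok ow.
have [s s01 h] := coord_number_grow rg ad.
pose w' := fun k => if k is k'.+1 then w k' else 2 * s - 1.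
have es : half (w' 0) = s by rewrite /half /=; lra.
have ow' : in_obox (size c).+1 w'.
  by move=> [|k] kd /=; [rewrite ltr_norml; case/andP: s01 => ? ?; apply/andP; split; lra|exact: ow].
exists w'; split=> //; apply/eqP; rewrite eqn_leq.
have := @coord_number_build (o :: c) w'; rewrite /= ad ok es => -> //=; last exact: obox_box.
by rewrite addSn -gw.
Qed.

End GenericPoints.

(** * Subcomplexes *)

Section CellComplex.
Variables (R : realType) (N : nat).
Notation T := (tiling_space R N.+1).
Notation W := (seqspace R).
Notation cell := (@cell R N).
Notation code := (@code R N).
Notation code_le := (code_le N).
Implicit Types (c e : seq op) (w : W) (x : T) (Q l : seq (seq op)).
Let hT : hausdorff_space T := @tiling_space_hausdorff R N.+1.

Lemma cell_eq c c' w w' : code_le c -> code_le c' -> cube (size c) w -> cube (size c') w' ->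
  perm_eq (ndg_rects c w) (ndg_rects c' w') -> cell c w = cell c' w'.
Proof.
move=> okc okc' cw cw' pm; apply: sval_inj.
have [L [_ _ -> ->]] := cell_ndg okc cw; have [L' [_ _ -> ->]] := cell_ndg okc' cw'.
exact: skel_perm.
Qed.

Lemma cell_ndg_rects c e w w' : code_le c -> code_le e -> cube (size c) w -> open_cube (size e) w' ->
  cell c w = cell e w' -> perm_eq (ndg_rects c w) (rects (build e w')).
Proof.
move=> okc oke cw ow ee; have [cw' _] := ow.
have [L [tL nL eL sL]] := cell_ndg okc cw; rewrite /ndg_rects -eL.
move/andP: (oke) => [ok _]; have rg := regular_build ok (open_cube_obox ow).
apply: skel_inj => //; [exact: good_tiles (regular_good rg)|exact: regular_ndg rg|].
by rewrite -sL ee cell_skel.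
Qed.

(** In equal dimension the role in the matching is kept too: lower members of pairs run only into
    low codes, upper members only into codes with head [Sigma] that are not low. *)
Lemma code_boundary c w : code_le c -> sphere_of_cube (size c) w ->
  let e := code (cell c w) in
  (size e < size c)%N \/ [/\ size e = size c, sigma_headed e = sigma_headed c, low e = low c &
    (code_rank N e < code_rank N c)%N].
Proof.
move=> okc sw e; have [cw _] := sw; have [oke [w' ow ee]] := code_spec (cell c w).
rewrite -/e in oke ow ee.
have [lt|[sz pm sg [[ec ww]|lt]]] := cell_compare okc oke cw ow (esym ee); [by left| |right].
  by exfalso; rewrite sz -ww in ow; exact: open_sphere ow sw.
split=> //; move/andP: okc => [ok _]; move/andP: oke => [ok' _].
apply: (build_low ok ok' sz (cube_box cw) _ pm).
by rewrite -sz; exact: open_cube_obox.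
Qed.

(** The rank is less than the power of the base, so the size dominates and the rank decides among
    codes of equal size. *)
Definition key c := (base_digit N ^ size c + code_rank N c)%N.

Lemma code_rank_lt c : code_le c -> (code_rank N c < base_digit N ^ size c)%N.
Proof.
move=> /andP[ok sc]; apply: rank_lt => //.
by rewrite /base_digit !ltnS leq_double.
Qed.

Lemma key_size_lt c e : code_le e -> (size e < size c)%N -> (key e < key c)%N.
Proof.
move=> oke lt; apply: leq_trans (leq_addr _ _).
apply: leq_trans (_ : 2 * base_digit N ^ size e <= _)%N.
  by rewrite mul2n -addnn ltn_add2l code_rank_lt.
apply: leq_trans (_ : base_digit N ^ (size e).+1 <= _)%N; last by rewrite leq_exp2l.
by rewrite expnS leq_mul2r orbT.
Qed.

Lemma key_rank_lt c e : size e = size c -> (code_rank N e < code_rank N c)%N -> (key e < key c)%N.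
Proof. by move=> sz; rewrite /key sz ltn_add2l. Qed.

Definition complex Q : set T := [set x | code x \in Q].

(** A complex is a union of open cells; this closure condition on boundaries makes it a closed
    set. *)
Definition subcomplex Q := (forall c, c \in Q -> code_le c) /\
  forall c w, c \in Q -> sphere_of_cube (size c) w -> code (cell c w) \in Q.

Lemma subcomplex_cell Q c w : subcomplex Q -> c \in Q -> cube (size c) w -> complex Q (cell c w).
Proof.
move=> [okQ bQ] cQ cw; have [sw|ow] := cubeVP cw; first exact: bQ.
by rewrite /complex /= code_cell //; exact: okQ.
Qed.

Lemma subcomplex_closed Q : subcomplex Q -> closed (complex Q).
Proof.
move=> sQ; have [okQ bQ] := sQ.
rewrite (_ : complex Q = [set x | exists2 c, c \in Q & (cell c @` cube (size c)) x]); last first.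
  apply/seteqP; split=> x; last by move=> [c cQ [w cw <-]]; exact: subcomplex_cell.
  move=> xQ; have [ok [w [cw _] e]] := code_spec x; exists (code x) => //; by exists w.
elim: (Q) okQ => [|c Q' IH] okQ'.
  by rewrite (_ : [set x | _] = set0); [exact: closed0|apply/seteqP; split=> x // []].
rewrite (_ : [set x | _] = (cell c @` cube (size c)) `|` [set x | exists2 c, c \in Q' & (cell c @` cube (size c)) x]).
  apply: closedU; last by apply: IH => c' c'Q; apply: okQ'; rewrite inE c'Q orbT.
  apply: compact_closed => //; apply: clc_compact; last exact: cube_compact.
  by apply: cell_clc; apply: okQ'; exact: mem_head.
apply/seteqP; split=> x.
  by move=> [c']; rewrite inE => /orP[/eqP ->|c'Q] h; [left|right; exists c'].
by move=> [h|[c' c'Q h]]; [exists c => //; exact: mem_head|exists c' => //; rewrite inE c'Q orbT].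
Qed.

Lemma subcomplex_cons Q c : subcomplex Q -> code_le c ->
  (forall w, sphere_of_cube (size c) w -> code (cell c w) \in Q) -> subcomplex (c :: Q).
Proof.
move=> [okQ bQ] okc bc; split=> [c'|c' w]; rewrite inE => /orP[/eqP ->//|c'Q]; [exact: okQ| |].
  by move=> sw; rewrite inE bc ?orbT.
by move=> sw; rewrite inE bQ ?orbT.
Qed.

Lemma attached_cell Q c : subcomplex Q -> code_le c -> c \notin Q ->
  (forall w, sphere_of_cube (size c) w -> code (cell c w) \in Q) ->
  attached (complex Q) (cube (size c)) (sphere_of_cube (size c)) (cell c).
Proof.
move=> sQ okc cQ bc; split.
- exact: cell_clc.
- exact: cube_compact.
- exact: subcomplex_closed.
- by move=> w [].
- split=> //.
  + move=> w cw sw; have [//|ow] := cubeVP cw; rewrite /complex /= code_cell //; exact/negP.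
  + move=> v w cv cw sv sw; have [//|ov] := cubeVP cv; have [//|ow] := cubeVP cw.
    by move=> /(cell_inj okc okc ov ow) [].
Qed.

Lemma complex_cons Q c : subcomplex (c :: Q) -> complex (c :: Q) = complex Q `|` cell c @` cube (size c).
Proof.
move=> sQ; apply/seteqP; split=> x; rewrite /complex /= ?inE.
  move=> /orP[/eqP e|xQ]; [right|by left].
  by have [ok [w [cw _] ee]] := code_spec x; rewrite e in cw ee; exists w.
move=> [->|[w cw <-]]; first by rewrite orbT.
by rewrite -in_cons; apply: subcomplex_cell sQ _ cw; exact: mem_head.
Qed.

(** Folds the faces [w i = 1] and [w i.+1 = 1] along their common edge onto one cube: on either face
    the minimum is the other coordinate, so this deletes the coordinate that is 1. *)
Definition merge_coords (i : nat) (w : W) : W := fun k =>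
  if (k < i)%N then w k else if k == i then Num.min (w i) (w i.+1) else w k.+1.
Definition drop_coord (d : nat) (w : W) : W := fun k => if (k < d)%N then w k else 0.

Lemma merge_coords_continuous i : continuous (merge_coords i).
Proof.
apply: continuous_seqspace => k; rewrite /merge_coords.
case: (k < i)%N; first exact: continuous_coord.
case: (k == i); last exact: continuous_coord.
by apply: continuous_minimum; exact: continuous_coord.
Qed.

Lemma drop_coord_continuous d : continuous (drop_coord d).
Proof.
apply: continuous_seqspace => k; rewrite /drop_coord.
case: (k < d)%N; [exact: continuous_coord|exact: continuous_const].
Qed.

Lemma merge_coords_cube d i w : (i < d)%N -> cube d.+1 w -> cube d (merge_coords i w).
Proof.
move=> id [c1 c2]; split=> k kd; rewrite /merge_coords.
  case: ifP => _; first by apply: c1; exact: ltnW.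
  case: ifP => _; last exact: c1.
  by case: (leP (w i) (w i.+1)) => _; apply: c1 => //; exact: ltnW.
by rewrite ltnNge (ltnW (leq_trans id kd)) /= gtn_eqF ?c2 //; exact: leq_trans id kd.
Qed.

Lemma drop_coord_cube d w : cube d.+1 w -> cube d (drop_coord d w).
Proof.
move=> [c1 c2]; split=> k kd; rewrite /drop_coord; first by rewrite kd; apply: c1; exact: ltnW.
by rewrite ltnNge kd.
Qed.

Lemma merge_coords_del i k w : w k = 1 -> (forall j, w j <= 1) -> k = i \/ k = i.+1 ->
  merge_coords i w = del k w.
Proof.
move=> wk w1 ki; apply/funext => j; rewrite /merge_coords /del.
case: ki => e; rewrite e in wk *.
  by case: ltnP => // ij; case: eqVneq => [->|//]; rewrite wk min_r.
have [ji|ji] := ltnP j i; first by rewrite ltnS (ltnW ji).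
have [->|ij] := eqVneq j i; first by rewrite ltnSn wk min_l.
by rewrite ltnS leqNgt ltn_neqAle eq_sym ij ji.
Qed.

End CellComplex.

(** * Removing one matched pair *)

Section PairRemoval.
Variables (R : realType) (N : nat).
Notation T := (tiling_space R N.+1).
Notation W := (seqspace R).
Notation cell := (@cell R N).
Notation code := (@code R N).
Notation code_le := (code_le N).
Notation complex := (@complex R N).
Notation subcomplex := (@subcomplex R N).
Implicit Types (e : seq op) (w : W) (x : T) (Q : seq (seq op)) (m : nat).
Variable c : seq op.
Notation C := (Sigma :: c).
Let d := size c.
Hypotheses (okC : code_le C) (low_c : low c).

Let okc : code_le c.
Proof. by move: okC => /andP[/= ok sc]; rewrite /code_le ok ltnW. Qed.

Let all_sigma := sigmas c == d.
Let pairs := (sigmas c)./2.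
Let groups := (pairs + all_sigma)%N.

(** The faces [w k = 1] with 1 <= k <= [sigmas c] are grouped in adjacent pairs. If all of [c] is
    [Sigma], the face [w d = 1] is left over and goes with [w d = -1]: on both, the last coordinate
    is forgotten. These two are opposite; the face [w d.-1 = -1], on which it is forgotten as well,
    joins them to one connected group. *)
Let faces m : seq (nat * R) := if (m < pairs)%N then [:: (m.*2.+1, 1); (m.*2.+2, 1)]
  else [:: (d, 1); (d, -1); (d.-1, -1)].
Let kap m : W -> W := if (m < pairs)%N then merge_coords m.*2.+1 else drop_coord d.
Let pos m := if (m < pairs)%N then m.*2.+1 else d.-1.
Let sg m : R := if (m < pairs)%N then 1 else -1.

Let parity : if all_sigma then odd (sigmas c) else ~~ odd (sigmas c).
Proof. by move: low_c; rewrite low_sigmas. Qed.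

Let sig_d : (sigmas c <= d)%N := sigmas_le c.

Let pair_le m : (m < pairs)%N -> (m.*2.+2 <= sigmas c)%N /\ (m.*2.+2 <= d)%N /\ (all_sigma -> (m.*2.+2 < d)%N).
Proof.
rewrite /pairs => mp; have h : (m.*2.+2 <= sigmas c)%N by move: mp; clear; lia.
split=> //; split; first exact: leq_trans h sig_d.
move=> a; move: parity; rewrite a; move/eqP: a => <- od; move: od h; clear; lia.
Qed.

Let last_group m : (m < groups)%N -> (pairs <= m)%N -> [/\ all_sigma, m = pairs, (0 < d)%N & c = nseq d Sigma].
Proof.
rewrite /groups; case a : all_sigma; last by rewrite addn0 => h h'; move: (leq_ltn_trans h' h); rewrite ltnn.
rewrite addn1 ltnS => h h'; have em : m = pairs by apply/eqP; rewrite eqn_leq h h'.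
move/eqP: (a) => es; split=> //; last exact: sigmas_all.
by move: parity; rewrite a es; case: (d).
Qed.

Let w_le1 w : cube d.+1 w -> forall j, -1 <= w j <= 1.
Proof.
move=> [c1 c2] j; have [jd|jd] := ltnP j d.+1; first by have := c1 j jd; rewrite ler_norml.
by rewrite c2 //; apply/andP; split; lra.
Qed.

Let cell_face w (w' : W) (v : nat -> R) : cube d.+1 w -> cube d w' ->
  perm_eq (ndg_rects C w) (ndg_rects c v) -> (forall k, (k < d)%N -> v k = w' k) -> cell c w' = cell C w.
Proof.
move=> cw cw' pm vw; apply/esym/cell_eq => //.
by apply: perm_trans pm _; rewrite /ndg_rects (@build_ext _ c v w').
Qed.

Let kap_cell m (f : nat * R) w : (m < groups)%N -> cube d.+1 w -> f \in faces m -> w f.1 = f.2 ->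
  cell c (kap m w) = cell C w.
Proof.
move=> mM cw; rewrite /faces /kap; case: (ltnP m pairs) => [mp|pm].
  have [l1 [l2 _]] := pair_le mp; have kc : cube d (merge_coords m.*2.+1 w) by exact: merge_coords_cube.
  have one k : k = m.*2.+1 \/ k = m.*2.+2 -> w k = 1 -> cell c (merge_coords m.*2.+1 w) = cell C w.
    move=> hk wk; apply: (cell_face cw kc (v := del k w)).
      apply: (@face_one R C _ w (cube_box cw) _ wk); rewrite /= ltnS.
      by case: hk => ->; [exact: ltnW|].
    move=> j _; rewrite (@merge_coords_del _ m.*2.+1 k) // => i; by case/andP: (w_le1 cw i).
  by rewrite !inE => /orP[] /eqP -> /= wk; apply: one wk; [left|right].
have [a em d0 ec] := last_group mM pm.
have kc : cube d (drop_coord d w) by exact: drop_coord_cube.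
have minus j : (j <= d)%N -> w j = -1 -> cell c (drop_coord d w) = cell C w.
  move=> jd wj; apply: (cell_face cw kc (v := w)); last by move=> k kd; rewrite /drop_coord kd.
  by rewrite ec; apply: (@face_minus_one _ d j w) => //; exact: cube_box.
rewrite !inE => /or3P[] /eqP -> /= wk; [|by apply: minus wk|by apply: minus wk; exact: leq_pred].
apply: (cell_face cw kc (v := del d w)); last by move=> k kd; rewrite /drop_coord /del kd.
by apply: (@face_one R C _ w (cube_box cw) _ wk); rewrite /= ltnS; move/eqP: a => ->.
Qed.

Let norm_sign (x : R) : x = 1 \/ x = -1 -> `|x| = 1.
Proof. by move=> [->|->]; rewrite ?normrN normr1. Qed.

(** A face outside the group restricts to a face of the small cube. It is never the one missing in
    the horn: for a fold, -1 in either merged coordinate makes the minimum -1, which is the opposite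
    face, and in the last group the missing face [w d.-1 = -1] belongs to the group. *)
Let kap_horn m (g : nat * R) w : (m < groups)%N -> cube d.+1 w -> is_face d g -> g \notin faces m ->
  w g.1 = g.2 -> on_faces (faces m) w -> horn d (pos m) (sg m) (kap m w).
Proof.
case: g => k e mM cw [/= kd e1]; have wl := w_le1 cw; rewrite /faces /kap /pos /sg; case: (ltnP m pairs) => [mp|pm] ng wk _.
  have [l1 [l2 _]] := pair_le mp.
  split; first exact: merge_coords_cube.
  have [lt|ge] := ltnP k m.*2.+1.
    right; exists k; split; [exact: leq_trans lt (ltnW l2)|by rewrite ltn_eqF|].
    by rewrite /merge_coords lt wk norm_sign.
  have eN : k = m.*2.+1 \/ k = m.*2.+2 -> e = -1.
    by move=> hk; case: e1 => // e1; move: ng; rewrite e1 !inE !xpair_eqE eqxx !andbT; case: hk => ->; rewrite eqxx ?orbT.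
  have minE (a b : R) : -1 <= a -> -1 <= b -> a = -1 \/ b = -1 -> Num.min a b = -1.
    by move=> ha hb [->|->]; [rewrite min_l|rewrite min_r].
  have w1 j : -1 <= w j by case/andP: (wl j).
  have [ek|nk] := eqVneq k m.*2.+1.
    by left; rewrite /merge_coords ltnn eqxx; apply: minE => //; left; rewrite -ek wk eN //; left.
  have [ek|nk'] := eqVneq k m.*2.+2.
    by left; rewrite /merge_coords ltnn eqxx; apply: minE => //; right; rewrite -ek wk eN //; right.
  have [k1 k2] : (m.*2.+2 < k)%N /\ k.-1.+1 = k by move: ge nk nk'; clear; split; lia.
  right; exists k.-1; split.
  - by rewrite -ltnS k2.
  - by apply/eqP => h; move: nk'; rewrite -k2 h eqxx.
  - have k3 : (k.-1 < m.*2.+1)%N = false by move: k1 k2; clear; lia.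
    rewrite /merge_coords k3 ifF; first by rewrite k2 wk norm_sign.
    by apply/eqP => h; move: nk'; rewrite -k2 h eqxx.
have [a em d0 ec] := last_group mM pm.
split; first exact: drop_coord_cube.
have kd' : (k < d)%N.
  rewrite ltn_neqAle -[(k <= d)%N]ltnS kd andbT; apply/eqP => h; move: ng; rewrite h !inE !xpair_eqE eqxx /=.
  by case: e1 => ->; rewrite eqxx ?orbT.
have [ek|nk] := eqVneq k d.-1.
  left; rewrite /drop_coord -ek kd' wk opprK; case: e1 => // e1.
  by move: ng; rewrite e1 ek !inE !xpair_eqE !eqxx !orbT.
by right; exists k; split=> //; rewrite /drop_coord kd' wk norm_sign.
Qed.

Let faces_not m m' (f : nat * R) : (m < groups)%N -> (m' < groups)%N ->
  f \in faces m -> f \in faces m' -> m = m'.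
Proof.
have n1 : (1 == -1 :> R) = false by rewrite -subr_eq0 opprK gt_eqF // ltr0n.
case: f => k e mM m'M; rewrite /faces; case: ltnP => mp; case: ltnP => mp'; rewrite !inE !xpair_eqE.
- by move=> /orP[] /andP[/eqP -> _] /orP[] /andP[/eqP + _]; clear; lia.
- have [a _ _ _] := last_group m'M mp'; have [_ [_ /(_ a) l]] := pair_le mp.
  move=> /orP[] /andP[/eqP -> /eqP ->]; rewrite eqxx n1 !andbF !orbF andbT => /eqP h; move: l; rewrite -h; clear; lia.
- have [a _ _ _] := last_group mM mp; have [_ [_ /(_ a) l]] := pair_le mp'.
  move=> h0 /orP[] /andP[/eqP ek /eqP ee]; move: h0; rewrite ek ee eqxx n1 !andbF !orbF andbT => /eqP h; move: l; rewrite -h; clear; lia.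
- by have [_ -> _ _] := last_group mM mp; have [_ -> _ _] := last_group m'M mp'.
Qed.

Lemma remove_pair Q : subcomplex Q -> c \notin Q -> C \notin Q ->
  (forall w, sphere_of_cube (size c) w -> code (cell c w) \in Q) ->
  (forall w, sphere_of_cube (size C) w -> code (cell C w) \in c :: Q) ->
  subcomplex [:: C, c & Q] /\ deforms_into R (complex [:: C, c & Q]) (complex Q).
Proof.
move=> sQ cQ CQ bc bC.
have sQ1 := subcomplex_cons sQ okc bc.
have sQ2 := subcomplex_cons sQ1 okC bC; split=> //.
have CcQ : C \notin c :: Q.
  rewrite inE negb_or CQ andbT; apply/eqP => /(congr1 size) /= /eqP.
  by rewrite eqn_leq ltnn.
have att1 := attached_cell sQ okc cQ bc; have att2 := attached_cell sQ1 okC CcQ bC.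
rewrite complex_cons // complex_cons //; rewrite complex_cons // in att2.
have n1 : (1 == -1 :> R) = false by rewrite -subr_eq0 opprK gt_eqF // ltr0n.
apply: (@cancel_faces R T d (@tiling_space_hausdorff R N.+1) (complex Q) (cell c) (cell C) att1 att2
  groups faces kap pos sg).
- move=> m mM; rewrite /pos; case: (ltnP m pairs) => [mp|pm]; first by have [_ [l _]] := pair_le mp; exact: l.
  by have [_ _ d0 _] := last_group mM pm; rewrite prednK.
- by move=> m _; rewrite /sg; case: ifP; [left|right].
- move=> m [k e] mM; rewrite /faces; case: (ltnP m pairs) => [mp|pm].
    have [_ [l _]] := pair_le mp.
    by rewrite !inE => /orP[] /eqP [-> ->]; split=> /=; try (by left); rewrite ltnS // ltnW.
  by rewrite !inE => /or3P[] /eqP [-> ->]; split=> /=; try (by left); try (by right); rewrite ltnS // leq_pred.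
- exact: faces_not.
- move=> m mM; rewrite /faces; case: (ltnP m pairs) => [mp|pm]; first by rewrite !inE !xpair_eqE.
  have [_ _ d0 _] := last_group mM pm; rewrite !inE !xpair_eqE eqxx n1 !andbF !orbF andbT.
  by rewrite eq_sym gtn_eqF.
- move=> m mM; rewrite /kap; case: ifP => _; [exact: merge_coords_continuous|exact: drop_coord_continuous].
- move=> m w mM cw; rewrite /kap; case: (ltnP m pairs) => [mp|pm]; last exact: drop_coord_cube.
  by have [_ [l _]] := pair_le mp; exact: merge_coords_cube.
- exact: kap_cell.
- exact: kap_horn.
- move=> w cw w0; apply/esym/(cell_face cw (v := del 0 w)) => //.
    by case: cw => c1 c2; split=> k kd; [exact: c1|exact: c2].
  by apply: (@face_one R C 0 w (cube_box cw) _ w0).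
(* A value in the open cell of [c] would put [w] on a grouped face or on [w 0 = 1]. The alternative
   of a smaller rank is void, as [Sigma] has digit 0 and does not change the rank. *)
move=> w sw w0 ng; have [cw _] := sw; have := bC w sw; rewrite inE => /orP[/eqP ec|//]; exfalso.
have [okc' [w' ow' e]] := code_spec (cell C w); rewrite ec in e ow'.
have pm := cell_ndg_rects okC okc cw ow' (esym e).
move/andP: (okC) => [ok sC]; move/andP: (okc) => [ok' sc].
have hb : ((size C).*2.+4 < base_digit N)%N by rewrite /base_digit !ltnS leq_double.
have := build_face ok ok' erefl hb (cube_box cw) (open_cube_obox ow') pm.
have grp m k (v : R) : (m < groups)%N -> (k, v) \in faces m -> w k = v -> False.
  by move=> mM kf wk; apply: (ng m mM); exists (k, v).
have lastg k (v : R) : all_sigma -> (k, v) \in [:: (d, 1); (d, -1); (d.-1, -1)] -> w k = v -> False.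
  move=> a kf; apply: (grp pairs); last by rewrite /faces ltnn.
  by rewrite /groups a addn1.
move=> [|[_ [[k ks wk]|[es wl]]]]; first by rewrite /= mul0n add0n ltnn.
  case: k ks wk => // k ks wk; rewrite /= ltnS in ks.
  have [mp|pm'] := ltnP k./2 pairs.
    apply: (grp k./2 k.+1 1) => //; first exact: leq_trans mp (leq_addr _ _).
    by rewrite /faces mp !inE !xpair_eqE eqxx !andbT -[X in X == _](odd_double_half k.+1) /=; move: (odd_double_half k); case: (odd k) => /=; clear; lia.
  have [a ek] : all_sigma /\ k.+1 = d.
    move: parity sig_d pm' ks; rewrite /pairs /all_sigma; case: eqP => [->|_]; clear; [split=> //|]; lia.
  by apply: (lastg k.+1 1) => //; rewrite ek !inE eqxx.
have a : all_sigma by rewrite /all_sigma; move: es => /= [->].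
by apply: (lastg d (-1)) => //; rewrite !inE eqxx orbT.
Qed.

End PairRemoval.

(** * Finiteness of the set of codes *)

Section Enumeration.
Implicit Types (c e : seq op).

(** A finite superset of the operations admissible after [n] others; [all_codes] filters
    afterwards. *)
Definition ops n : seq op := Sigma :: [seq Hcut k | k <- iota 0 n.+2] ++
  [seq Strip k i | k <- iota 0 n.+2, i <- iota 0 n.+2].
Fixpoint codes n : seq (seq op) :=
  if n is n'.+1 then [seq o :: c | o <- ops n', c <- codes n'] else [:: [::]].

Lemma ops_mem o c : code_ok (o :: c) -> o \in ops (size c).
Proof.
move=> /[dup] /digit_le dg /andP[ad ok]; have rc := right_count_le c.
rewrite inE mem_cat; case: o ad dg => [k|k i|] ad dg; last by rewrite eqxx.
  apply/orP; right; apply/orP; left; apply/mapP; exists k; rewrite // mem_iota.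
  by move: dg; rewrite /digit; clear; lia.
apply/orP; right; apply/orP; right; apply/allpairsP; exists (k, i); split=> //; rewrite mem_iota.
  by move: dg; rewrite /digit /fst; clear; lia.
by case/and4P: ad => _ _ _; move: rc; rewrite /snd; clear; lia.
Qed.

Lemma codes_mem c : code_ok c -> c \in codes (size c).
Proof.
elim: c => // o c IH /[dup] oko /andP[_ ok].
rewrite [codes _]/(allpairs _ (ops (size c)) (codes (size c))).
by apply/allpairsP; exists (o, c); split=> //; [exact: ops_mem|exact: IH].
Qed.

Definition all_codes N := [seq c <- flatten [seq codes n | n <- iota 0 N.+1] | code_le N c].

Lemma all_codesE N c : (c \in all_codes N) = code_le N c.
Proof.
rewrite mem_filter; case: (boolP (code_le N c)) => // /andP[ok sc]; rewrite andTb.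
by apply/flatten_mapP; exists (size c); [rewrite mem_iota|exact: codes_mem].
Qed.

End Enumeration.

(** * Contracting the matched part *)

Section MatchedComplex.
Variables (R : realType) (N : nat).
Notation T := (tiling_space R N.+1).
Notation W := (seqspace R).
Notation cell := (@cell R N).
Notation code := (@code R N).
Notation code_le := (code_le N).
Notation complex := (@complex R N).
Notation subcomplex := (@subcomplex R N).
Notation key := (key N).
Implicit Types (c e : seq op) (w : W) (x : T) (Q l : seq (seq op)) (m : nat).

Definition tree l : seq (seq op) := [::] :: flatten [seq [:: Sigma :: c; c] | c <- l].

Lemma mem_tree l e : reflect (e = [::] \/ exists2 c, c \in l & e = c \/ e = Sigma :: c) (e \in tree l).
Proof.
rewrite inE; apply: (iffP orP) => [[/eqP|/flatten_mapP [c cl]]|[->|[c cl h]]]; first by left.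
- by rewrite !inE => /orP[] /eqP ->; right; exists c => //; [right|left].
- by left.
- by right; apply/flatten_mapP; exists c => //; rewrite !inE; case: h => ->; rewrite eqxx ?orbT.
Qed.

Definition lower e := [/\ code_ok e, (size e < N)%N & low e].
Definition below l c := forall e, lower e -> (key e < key c)%N -> e \in l.

Lemma low_code_le e : lower e -> code_le e.
Proof. by move=> [ok sz _]; rewrite /code_le ok ltnW. Qed.

Lemma not_low e : ~~ low e -> e = [::] \/ exists2 e', e = Sigma :: e' & low e'.
Proof. by case: e => [|[k|k i|] e] //=; [left|rewrite negbK; right; exists e]. Qed.

(** A code that is not low is empty or [Sigma :: e'] with [e'] low. Such an [e'] is shorter than
    [c], so its pair is present already. *)
Lemma tree_below l c e : lower c -> below l c -> code_le e ->
  (size e < size c)%N \/ (size e = size c /\ (code_rank N e < code_rank N c)%N) -> e \in tree l.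
Proof.
move=> lc bl oke h; have [ok sz _] := lc; have okc := low_code_le lc.
have [oke' _] := andP oke.
have se : (size e <= size c)%N by case: h => [/ltnW|[->]].
apply/mem_tree; case: (boolP (low e)) => [le|/not_low [->|[e' ee le]]]; [|by left|].
  right; exists e; last by left.
  apply: bl; first by split=> //; exact: leq_ltn_trans se sz.
  by case: h => [lt|[ee lt]]; [exact: key_size_lt|exact: key_rank_lt].
right; exists e'; last by right.
have se' : (size e' < size c)%N by apply: leq_trans se; rewrite ee.
have oke1 : code_ok e' by move: oke'; rewrite ee => /andP[].
have lo : lower e' by split=> //; exact: ltn_trans se' sz.
by apply: bl => //; apply: key_size_lt => //; exact: low_code_le.
Qed.

Lemma low_boundary l c w : lower c -> below l c -> sphere_of_cube (size c) w ->
  code (cell c w) \in tree l.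
Proof.
move=> lc bl sw; have okc := low_code_le lc; have [oke _] := code_spec (cell c w).
apply: (tree_below lc bl oke).
by case: (code_boundary okc sw) => [lt|[sz _ _ lt]]; [left|right].
Qed.

(** In the dimension of [Sigma :: c] only upper members of pairs of smaller rank occur. One
    dimension lower, [build_face] leaves codes of smaller rank and [c] itself. Shorter codes are
    covered by their size. *)
Lemma sigma_boundary l c w : lower c -> below l c -> sphere_of_cube (size c).+1 w ->
  code (cell (Sigma :: c) w) \in c :: tree l.
Proof.
move=> lc bl sw; have [ok sz lw] := lc; have okC : code_le (Sigma :: c) by rewrite /code_le /= ok.
have [oke [w' ow ee]] := code_spec (cell (Sigma :: c) w).
set e := code _ in oke ow ee *.
have rC : code_rank N (Sigma :: c) = code_rank N c by rewrite /code_rank /= mul0n.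
have [lt|[se sg le lt]] := code_boundary okC sw; rewrite -/e in lt *; last first.
  rewrite -/e in se sg le; rewrite inE; apply/orP; right; apply/mem_tree; right.
  case: e se sg le lt oke {ow ee} => [|[k|k i|] e'] //= [se] _ le; rewrite rC /code_rank /= mul0n add0n => lt oke.
  exists e'; last by right.
  have oke' : code_ok e' by case/andP: oke.
  apply: bl; last exact: key_rank_lt.
  by split; rewrite ?se //; move: le; rewrite lw => /negbFE.
rewrite /= ltnS leq_eqVlt in lt; case/orP: lt => [/eqP es|lt]; last first.
  by rewrite inE (tree_below lc bl oke) ?orbT //; left.
have [cw _] := sw; have pm := cell_ndg_rects okC oke cw ow (esym ee).
have hb : ((size (Sigma :: c)).*2.+4 < base_digit N)%N by rewrite /base_digit !ltnS leq_double.
have [ok1 _] := andP okC; have [ok2 _] := andP oke.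
have [lt|[[ec] _]] := build_face ok1 ok2 (congr1 S (esym es)) hb (cube_box cw) (open_cube_obox ow) pm.
  by rewrite inE (tree_below lc bl oke) ?orbT //; right; split=> //; rewrite -rC.
by rewrite inE ec eqxx.
Qed.

Lemma complex_mem Q Q' : Q =i Q' -> complex Q = complex Q'.
Proof. by move=> QQ; apply/seteqP; split=> x; rewrite /complex /= QQ. Qed.

Lemma subcomplex_mem Q Q' : Q =i Q' -> subcomplex Q -> subcomplex Q'.
Proof.
by move=> QQ [h1 h2]; split=> [c|c w]; rewrite -!QQ; [exact: h1|exact: h2].
Qed.

Lemma argmax_mem l (f : seq op -> nat) : l != [::] ->
  exists2 c, c \in l & forall e, e \in l -> (f e <= f c)%N.
Proof.
elim: l => // c l IH _; have [->|l0] := eqVneq l [::].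
  by exists c; [exact: mem_head|move=> e; rewrite inE => /eqP ->].
have [c' c'l h] := IH l0; have [lt|le] := ltnP (f c) (f c').
  exists c'; first by rewrite inE c'l orbT.
  by move=> e; rewrite inE => /orP[/eqP ->|/h //]; exact: ltnW.
exists c; first exact: mem_head.
by move=> e; rewrite inE => /orP[/eqP ->//|/h h']; exact: leq_trans le.
Qed.

Definition origin : T := cell [::] (fun=> 0).

Lemma cube0 w : cube 0 w -> w = (fun=> 0).
Proof. by move=> [_ h]; apply/funext => k; exact: h. Qed.

Lemma code_origin : code origin = [::].
Proof. by apply: code_cell => //; apply/open_cubeP; split. Qed.

Lemma complex_nil : complex [:: [::]] = [set origin].
Proof.
apply/seteqP; split=> x; last by move=> ->; rewrite /complex /= code_origin.
rewrite /complex /= inE => /eqP e; have [_ [w [cw _] <-]] := code_spec x.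
by rewrite e in cw *; rewrite (cube0 cw).
Qed.

Definition initial l := [/\ uniq l, forall c, c \in l -> lower c & forall c, c \in l -> below l c].

(** The pair with the largest key goes first: no other boundary needs it, and its own boundary lies
    in the remaining pairs. *)
Lemma tree_contractible l : initial l ->
  subcomplex (tree l) /\ contractible_to R (complex (tree l)) origin.
Proof.
have [n] := ubnP (size l); elim: n l => // n IH l sl [ul ll bl].
have [l0|l0] := eqVneq l [::].
  rewrite l0 /tree /=; split.
    by split=> [c|c w]; rewrite inE => /eqP -> // /sphere_of_cubeP [_ []].
  exists (fun p => p.1); rewrite complex_nil; split=> //.
  apply: continuous_clc; last exact: continuous_fst.
  apply: closed_setX; last exact: unit_itv_closed.
  rewrite -complex_nil; apply: (@subcomplex_closed R N).
  by split=> [c|c w]; rewrite inE => /eqP -> // /sphere_of_cubeP [_ []].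
have [c cl cmax] := argmax_mem key l0.
set l' := rem c l; have pl : perm_eq l (c :: l') := perm_to_rem cl.
have ul' : uniq l' by exact: rem_uniq.
have cl' : c \notin l' by rewrite mem_rem_uniqF.
have l'l e : e \in l' -> e \in l by move=> h; rewrite (perm_mem pl) inE h orbT.
have below' e : (key e <= key c)%N -> below l e -> below l' e.
  move=> ec be e' le' lt; have := be e' le' lt; rewrite (perm_mem pl) inE => /orP[/eqP h|//].
  by move: (leq_trans lt ec); rewrite h ltnn.
have init' : initial l'.
  split=> // e el'; first exact/ll/l'l.
  by apply: below'; [exact/cmax/l'l|exact/bl/l'l].
have [|sQ cQ] := IH l' _ init'; first by move: sl; rewrite (perm_size pl) /= ltnS.
have lc := ll c cl; have [ok sz lw] := lc.
have okC : code_le (Sigma :: c) by rewrite /code_le /= ok.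
have blc := below' c (leqnn _) (bl c cl).
have eqQ : [:: Sigma :: c, c & tree l'] =i tree l.
  move=> e; apply/idP/mem_tree.
    rewrite !inE => /or3P[/eqP ->|/eqP ->|/mem_tree [->|[c' c'l h]]]; [| |by left|].
    - by right; exists c => //; right.
    - by right; exists c => //; left.
    - by right; exists c' => //; exact: l'l.
  move=> [->|[c' +]]; first by rewrite !inE eqxx !orbT.
  rewrite (perm_mem pl) inE => /orP[/eqP -> [->|->]|c'l h]; try by rewrite !inE eqxx ?orbT.
  by rewrite !inE; apply/or3P; constructor 3; apply/mem_tree; right; exists c'.
have [||||sQ2 dQ] := @remove_pair R N c okC lw (tree l') sQ.
- apply/mem_tree => -[e|[c' c'l' [e|e]]]; first by move: lw; rewrite e.
    by move: cl'; rewrite e c'l'.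
  by have [_ _ h] := ll c' (l'l _ c'l'); move: lw; rewrite e /= h.
- apply/mem_tree => -[e|[c' c'l' [e|[e]]]] //.
    by have [_ _ ] := ll c' (l'l _ c'l'); rewrite -e /= lw.
  by move: cl'; rewrite e c'l'.
- by move=> w; exact: low_boundary.
- by move=> w; exact: sigma_boundary.
split; first exact: subcomplex_mem eqQ sQ2.
rewrite -(complex_mem eqQ); apply: (deforms_trans (B := complex (tree l'))) => //.
  exact: subcomplex_closed.
by move=> x; rewrite /complex /= !inE => ->; rewrite !orbT.
Qed.

End MatchedComplex.

(** * Moving the centre of a cube *)

Section Recentering.
Variable R : realType.
Notation W := (seqspace R).
Implicit Types (z w y : W) (d : nat).

(** In each coordinate a piecewise linear bijection of [-1, 1] that fixes the ends and sends 0 to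
    [z k]. *)
Definition recentre z w : W := fun k => w k + (1 - `|w k|) * z k.

Lemma recentre_continuous z : continuous (recentre z).
Proof.
apply: continuous_seqspace => k; apply: continuous_add; first exact: continuous_coord.
apply: continuous_mul; last exact: continuous_const.
by apply: continuous_sub; [exact: continuous_const|apply: continuous_abs; exact: continuous_coord].
Qed.

Lemma recentre0 z : recentre z (fun=> 0) = z.
Proof. by apply/funext => k; rewrite /recentre normr0 subr0 mul1r add0r. Qed.

Let step (t a : R) : `|t| < 1 -> `|a| <= 1 -> `|a + (1 - `|a|) * t| <= 1.
Proof.
move=> t1 a1; apply: le_trans (ler_normD _ _) _; rewrite normrM [`|1 - _|]ger0_norm ?subr_ge0 //.
have := normr_ge0 t; move: `|a| `|t| a1 t1 => x y; nra.
Qed.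

Let step_lt (t a : R) : `|t| < 1 -> `|a| < 1 -> `|a + (1 - `|a|) * t| < 1.
Proof.
move=> t1 a1; apply: le_lt_trans (ler_normD _ _) _; rewrite normrM [`|1 - _|]ger0_norm ?subr_ge0 1?ltW //.
have := normr_ge0 t; move: `|a| `|t| a1 t1 => x y; nra.
Qed.

Lemma recentre_cube d z w : open_cube d z -> cube d w -> cube d (recentre z w).
Proof.
move=> /open_cubeP [z1 z2] [c1 c2]; split=> k kd; rewrite /recentre; first by apply: step; [exact: z1|exact: c1].
by rewrite c2 // z2 // mulr0 addr0.
Qed.

Lemma recentre_open d z w : open_cube d z -> open_cube d w -> open_cube d (recentre z w).
Proof.
move=> /open_cubeP [z1 z2] /open_cubeP [c1 c2]; apply/open_cubeP; split=> k kd; rewrite /recentre.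
  by apply: step_lt; [exact: z1|exact: c1].
by rewrite c2 // z2 // mulr0 addr0.
Qed.

Lemma recentre_sphere d z w : open_cube d z -> sphere_of_cube d w -> sphere_of_cube d (recentre z w).
Proof.
move=> oz sw; have [cw [k kd wk]] := sphere_of_cubeP sw.
apply: (sphere_of_cubeI (recentre_cube oz cw) kd).
by rewrite /recentre wk subrr mul0r addr0.
Qed.

Lemma recentre_inj d z v w : open_cube d z -> cube d v -> cube d w -> recentre z v = recentre z w -> v = w.
Proof.
move=> /open_cubeP [z1 z2] [_ cv] [_ cw] e; apply/funext => k.
have [kd|kd] := ltnP k d; last by rewrite cv // cw.
have := congr1 (fun f : W => f k) e; rewrite /recentre /=.
have := z1 k kd; rewrite ltr_norml => /andP[t0 t1].
move: (v k) (w k) (z k) t0 t1; clear => a b t t0 t1.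
have p1 : 0 < 1 - t by lra.
have p2 : 0 < 1 + t by lra.
case: (ger0P a) => ha; case: (ger0P b) => hb.
- by move=> h; apply: (@mulfI _ (1 - t)); [rewrite gt_eqF|lra].
- move=> h; exfalso; have h1 := mulr_ge0 (ltW p1) ha.
  have h2 : 0 < (1 + t) * - b by rewrite mulr_gt0 // oppr_gt0.
  lra.
- move=> h; exfalso; have h1 := mulr_ge0 (ltW p1) hb.
  have h2 : 0 < (1 + t) * - a by rewrite mulr_gt0 // oppr_gt0.
  lra.
- by move=> h; apply: (@mulfI _ (1 + t)); [rewrite gt_eqF|lra].
Qed.

Lemma recentre_surj d z y : open_cube d z -> open_cube d y -> exists2 w, open_cube d w & recentre z w = y.
Proof.
move=> /open_cubeP [z1 z2] /open_cubeP [y1 y2].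
exists (fun k => if z k <= y k then (y k - z k) / (1 - z k) else (y k - z k) / (1 + z k)).
  apply/open_cubeP; split=> k kd; last by rewrite z2 // y2 // lexx subrr mul0r.
  have /andP[a0 a1] : -1 < y k < 1 by rewrite -ltr_norml y1.
  have /andP[t0 t1] : -1 < z k < 1 by rewrite -ltr_norml z1.
  have p1 : 0 < 1 - z k by lra.
  have p2 : 0 < 1 + z k by lra.
  rewrite /=; case: (leP (z k) (y k)) => h; rewrite ltr_norml ltr_pdivlMr // ltr_pdivrMr //; apply/andP; split; lra.
apply/funext => k; rewrite /recentre; have [kd|kd] := ltnP k d; last first.
  by rewrite z2 // y2 // lexx subrr mul0r mulr0 addr0.
have := z1 k kd; rewrite ltr_norml => /andP[t0 t1].
have p1 : 0 < 1 - z k by lra.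
have p2 : 0 < 1 + z k by lra.
case: (leP (z k) (y k)) => h.
  rewrite ger0_norm; last by rewrite divr_ge0 ?subr_ge0 // ltW.
  by field; rewrite gt_eqF.
rewrite ltr0_norm; last by rewrite pmulr_llt0 ?invr_gt0 // subr_lt0.
by field; rewrite gt_eqF.
Qed.

End Recentering.

(** * Unmatched top cells and the wedge *)

Section CriticalCells.
Variables (R : realType) (N : nat).
Notation T := (tiling_space R N.+1).
Notation W := (seqspace R).
Notation cell := (@cell R N).
Notation code := (@code R N).
Notation code_le := (code_le N).
Notation complex := (@complex R N).
Notation subcomplex := (@subcomplex R N).
Notation sup := (supnorm (R:=R) xpredT N).
Implicit Types (c e : seq op) (v w : W) (x : T) (l : seq (seq op)).
Let hT : hausdorff_space T := @tiling_space_hausdorff R N.+1.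

Lemma centre_exists c : exists z : W, code_ok c -> open_cube (size c) z /\
  coord_number (rects (build c z)) = (size c + 2)%N.
Proof.
case: (boolP (code_ok c)) => ok; last by exists (fun=> 0).
have [w [ow gw]] := generic_point R ok; exists (fun k => if (k < size c)%N then w k else 0) => _.
split; last by rewrite -gw (@build_ext _ c _ w) // => k kd; rewrite kd.
by apply/open_cubeP; split=> k kd; [rewrite kd; exact: ow|rewrite ltnNge kd].
Qed.

Definition centre c : W := projT1 (cid (centre_exists c)).
Definition critical c := [&& code_ok c, size c == N & low c].
(** The generic tiling is moved to the origin, so that small cubes round it are balls of the
    norm. *)
Definition crit_cell c w : T := cell c (recentre (centre c) w).
Definition lows := undup [seq c <- all_codes N | (size c < N)%N && low c].
Definition crits := undup [seq c <- all_codes N | critical c].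

Lemma critical_le c : critical c -> code_le c.
Proof. by move=> /and3P[ok /eqP sz _]; rewrite /code_le ok sz leqnn. Qed.

Lemma crits_mem c : (c \in crits) = critical c.
Proof.
rewrite mem_undup mem_filter all_codesE; case: (boolP (critical c)) => //= cr.
exact: critical_le.
Qed.

Lemma centreP c : critical c -> open_cube N (centre c) /\ coord_number (rects (build c (centre c))) = (N + 2)%N.
Proof. by move=> /and3P[ok /eqP sz _]; rewrite /centre; case: (cid _) => z /= /(_ ok); rewrite sz. Qed.

Lemma lows_initial : initial N lows.
Proof.
have mem e : (e \in lows) <-> lower N e.
  rewrite mem_undup mem_filter all_codesE; split.
    by move=> /andP[/andP[sz lw] /andP[ok _]].
  by move=> [ok sz lw]; rewrite sz lw /code_le ok ltnW.
split; first exact: undup_uniq.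
  by move=> c /mem.
by move=> c _ e le _; apply/mem.
Qed.

Lemma code_cases e : code_le e -> e \in tree lows \/ critical e.
Proof.
move=> /andP[ok sz]; have mem e' : lower N e' -> e' \in lows.
  move=> [ok' sz' lw']; rewrite mem_undup mem_filter all_codesE sz' lw' /code_le ok'.
  exact: ltnW.
case: (boolP (low e)) => [le|/not_low [->|[e' ee le]]].
- move: sz; rewrite leq_eqVlt => /orP[es|lt]; first by right; apply/and3P.
  by left; apply/mem_tree; right; exists e; [exact: mem|left].
- by left; apply/mem_tree; left.
- left; apply/mem_tree; right; exists e'; last by right.
  by apply: mem; rewrite ee in ok sz; case/andP: ok.
Qed.

Lemma critical_tree c : critical c -> c \notin tree lows.
Proof.
move=> /and3P[ok /eqP sz lw]; apply/mem_tree => -[e|[e el [ee|ee]]]; first by rewrite e in lw.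
  have [_ /(_ e el) [_ h _] _] := lows_initial; by move: h; rewrite -ee sz ltnn.
by have [_ /(_ e el) [_ _ h] _] := lows_initial; move: lw; rewrite ee /= h.
Qed.

Lemma crit_cell_clc c : critical c -> clc (cube N) (crit_cell c).
Proof.
move=> cr; have [oz _] := centreP cr; have := @cell_clc R N c (critical_le cr).
case/and3P: (cr) => _ /eqP -> _ cc.
apply: (@clc_comp _ _ _ _ _ (recentre (centre c)) (cell c) _ cc); last by move=> w; exact: recentre_cube.
by apply: continuous_clc; [exact: cube_closed|exact: recentre_continuous].
Qed.

Lemma crit_cell_open c e v w : critical c -> code_le e -> open_cube N v -> open_cube (size e) w ->
  crit_cell c v = cell e w -> c = e /\ recentre (centre c) v = w.
Proof.
move=> cr oke ov ow ee; have [oz _] := centreP cr.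
apply: cell_inj (critical_le cr) oke _ ow ee.
by case/and3P: (cr) => _ /eqP -> _; exact: recentre_open.
Qed.

Lemma crit_cell_inj c e v w : critical c -> critical e -> open_cube N v -> open_cube N w ->
  crit_cell c v = crit_cell e w -> c = e /\ v = w.
Proof.
move=> cr cre ov ow ee; have [oz _] := centreP cr; have [oz' _] := centreP cre.
have ow' : open_cube (size e) (recentre (centre e) w).
  by case/and3P: (cre) => _ /eqP -> _; exact: recentre_open.
have [ce rr] := crit_cell_open cr (critical_le cre) ov ow' ee.
split=> //; rewrite -ce in rr; have [[cv _] [cw _]] := (ov, ow).
exact: recentre_inj oz cv cw rr.
Qed.

Lemma crit_cell_code c v : critical c -> open_cube N v -> code (crit_cell c v) = c.
Proof.
move=> cr ov; have [oz _] := centreP cr; apply: code_cell; first exact: critical_le.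
by case/and3P: (cr) => _ /eqP -> _; exact: recentre_open.
Qed.

Lemma crit_cell_onto x : critical (code x) -> exists2 v, open_cube N v & crit_cell (code x) v = x.
Proof.
move=> cr; have [_ [w ow e]] := code_spec x; have [oz _] := centreP cr.
move: ow; case/and3P: (cr) => _ /eqP -> _ ow; have [v ov rv] := recentre_surj oz ow.
by exists v => //; rewrite /crit_cell rv.
Qed.

Lemma crit_boundary c v : critical c -> sphere_of_cube N v ->
  code (crit_cell c v) \in tree lows \/
  critical (code (crit_cell c v)) /\ (code_rank N (code (crit_cell c v)) < code_rank N c)%N.
Proof.
move=> cr sv; have [oz _] := centreP cr; have [_ /eqP sz _] := and3P cr.
have sr : sphere_of_cube (size c) (recentre (centre c) v) by rewrite sz; exact: recentre_sphere.
have [oke _] := code_spec (crit_cell c v).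
have [|cre] := code_cases oke; [by left|right; split=> //].
case: (code_boundary (critical_le cr) sr) => [|[]//].
by rewrite -/(crit_cell c v); case/and3P: cre => _ /eqP -> _; rewrite sz ltnn.
Qed.

(* A tiling with the maximal number of distinct coordinates is on no cell boundary;
   compactness then provides the radius. *)
Lemma centre_avoids c e : critical c -> critical e -> exists2 a : R, 0 < a &
  forall a', 0 < a' < a -> forall v w, cube N v -> sup v <= a' -> sphere_of_cube N w ->
  crit_cell c v <> crit_cell e w.
Proof.
move=> cr cre; pose K := crit_cell e @` sphere_of_cube N.
have cS : clc (sphere_of_cube N) (crit_cell e).
  by apply: clc_sub (crit_cell_clc cre); [exact: sphere_of_cube_closed|move=> w []].
have kS : compact (sphere_of_cube N : set W).
  by apply: subclosed_compact (@cube_compact R N) _; [exact: sphere_of_cube_closed|move=> w []].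
have cK : closed K by apply: compact_closed => //; exact: clc_compact.
(* The norms of those points of the cell of [c] that the boundary of the cell of [e] runs through.
   This compact set omits 0 by the coordinate count, hence a neighbourhood of 0. *)
have kK : compact (sup @` (cube N `&` crit_cell c @^-1` K)).
  apply: continuous_compact; first exact/continuous_subspaceT/supnorm_continuous.
  apply: subclosed_compact (@cube_compact R N) _; last by move=> w [].
  exact: crit_cell_clc.
have n0 : ~ (sup @` (cube N `&` crit_cell c @^-1` K)) 0.
  move=> [v [cv [w sw ew]] v0]; have [oz gz] := centreP cr.
  have ev : v = (fun=> 0).
    apply/funext => k; have [kd|kd] := ltnP k N; last by case: cv => _; apply.
    by apply/eqP; rewrite -normr_le0 -v0; exact: le_supnorm.
  move: ew; rewrite ev /crit_cell recentre0 => ew.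
  have [oz' _] := centreP cre; have sw' := recentre_sphere oz' sw.
  have [cw' [k kd wk]] := sphere_of_cubeP sw'.
  have [okc /eqP szc _] := and3P cr; have [oke /eqP sze _] := and3P cre.
  have cwe : cube (size e) (recentre (centre e) w) by rewrite sze.
  have ozc : open_cube (size c) (centre c) by rewrite szc.
  have [|[_ pm _ _]] := cell_compare (critical_le cre) (critical_le cr) cwe ozc ew.
    by rewrite szc sze ltnn.
  have nd : all ndg (rects (build e (recentre (centre e) w))).
    by rewrite (perm_all _ pm); exact: regular_ndg (regular_build okc (open_cube_obox ozc)).
  have := @coord_number_boundary R e _ k oke (cube_box cwe); rewrite sze => /(_ kd wk nd).
  by rewrite (coord_number_perm pm) gz ltnn.
have cB := compact_closed (@Rhausdorff R) kK.
have : nbhs (0 : R) (~` (sup @` (cube N `&` crit_cell c @^-1` K))).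
  by apply: open_nbhs_nbhs; split=> //; exact: closed_openC.
move=> /nbhs_ballP [a /= a0 H]; exists a => // a' /andP[a'0 a'a] v w cv va sw ew.
apply: (H (sup v)); last by exists v => //; split=> //; exists w.
by rewrite /ball /= sub0r normrN ger0_norm ?supnorm_ge0 //; exact: le_lt_trans a'a.
Qed.

Lemma common_radius : exists2 a : R, 0 < a < 1 & forall c e v w, critical c -> critical e ->
  cube N v -> sup v <= a -> sphere_of_cube N w -> crit_cell c v <> crit_cell e w.
Proof.
have [p|a a0 H] := @eventually_all R _ [seq (c, e) | c <- crits, e <- crits] (fun p a =>
  forall v w, cube N v -> sup v <= a -> sphere_of_cube N w -> crit_cell p.1 v <> crit_cell p.2 w).
  by move=> /allpairsP [[c e] /= [cc ce ->]] /=; apply: centre_avoids; rewrite -crits_mem.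
pose b : R := Num.min (a / 2) 2^-1.
have b0 : 0 < b by rewrite lt_min divr_gt0 //= invr_gt0.
have b1 : b <= a / 2 by rewrite ge_min lexx.
have b2 : b <= 2^-1 by rewrite ge_min lexx orbT.
have ba : 0 < b < a by rewrite b0 /=; lra.
exists b; first by rewrite b0 /=; lra.
move=> c e v w cr cre cv vb sw.
apply: (H (c, e) b) => //; apply/allpairsP; exists (c, e); split=> //=; by rewrite crits_mem.
Qed.

Lemma tiling_space_compact : compact [set: T].
Proof.
rewrite (_ : [set: T] = [set x | exists2 c, c \in all_codes N & (cell c @` cube (size c)) x]); last first.
  apply/seteqP; split=> x // _; have [ok [w [cw _] e]] := code_spec x.
  by exists (code x); [rewrite all_codesE|exists w].
have : forall c, c \in all_codes N -> code_le c by move=> c; rewrite all_codesE.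
elim: (all_codes N) => [|c l IH] ok.
  by rewrite (_ : [set x | _] = set0); [exact: compact0|apply/seteqP; split=> x // []].
rewrite (_ : [set x | _] = (cell c @` cube (size c)) `|` [set x | exists2 e, e \in l & (cell e @` cube (size e)) x]).
  apply: compactU; last by apply: IH => e el; apply: ok; rewrite inE el orbT.
  apply: clc_compact; last exact: cube_compact.
  by apply: cell_clc; apply: ok; exact: mem_head.
apply/seteqP; split=> x.
  by move=> [e]; rewrite inE => /orP[/eqP ->|el] h; [left|right; exists e].
by move=> [h|[e el h]]; [exists c => //; exact: mem_head|exists e => //; rewrite inE el orbT].
Qed.

Section Punctured.
Variable a : R.
Hypothesis a01 : 0 < a < 1.
Hypothesis a_avoids : forall c e v w, critical c -> critical e ->
  cube N v -> sup v <= a -> sphere_of_cube N w -> crit_cell c v <> crit_cell e w.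

Definition punctured l : set T := complex (tree lows) `|`
  [set x | exists2 c, c \in l & (crit_cell c @` annulus N a) x].

Lemma punctured_closed l : (forall c, c \in l -> critical c) -> closed (punctured l).
Proof.
move=> cl; apply: closedU.
  by apply: (@subcomplex_closed R N); case: (tree_contractible R lows_initial).
elim: l cl => [|c l IH] cl.
  by rewrite (_ : [set x | _] = set0); [exact: closed0|apply/seteqP; split=> x // []].
rewrite (_ : [set x | _] = (crit_cell c @` annulus N a) `|` [set x | exists2 c, c \in l & (crit_cell c @` annulus N a) x]).
  apply: closedU; last by apply: IH => e el; apply: cl; rewrite inE el orbT.
  apply: compact_closed => //; apply: clc_compact; last exact: annulus_compact.
  apply: clc_sub (crit_cell_clc (cl c (mem_head _ _))); [exact: annulus_closed|by move=> w []].
apply/seteqP; split=> x.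
  by move=> [e]; rewrite inE => /orP[/eqP ->|el] h; [left|right; exists e].
by move=> [h|[e el h]]; [exists c => //; exact: mem_head|exists e => //; rewrite inE el orbT].
Qed.

(** Two situations are covered: a cell that is new to [l] and of maximal rank, so that no boundary
    in [l] runs through it, and a point of a central cube, which all boundaries avoid. *)
Lemma open_not_punctured c v l : critical c -> open_cube N v ->
  (forall e, e \in l -> critical e) -> (forall e, e \in l -> (code_rank N e <= code_rank N c)%N) \/ sup v <= a ->
  (sup v < a \/ c \notin l) -> ~ punctured l (crit_cell c v).
Proof.
move=> cr ov cl hr hv [h|[e el [w [cw aw] ew]]].
  by move: h; rewrite /complex /= crit_cell_code // (negbTE (critical_tree cr)).
have [sw|ow] := cubeVP cw.
  case: hr => [hr|va]; last by apply: (a_avoids cr (cl e el) _ va sw (esym ew)); case: ov.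
  have := crit_boundary (cl e el) sw; rewrite ew crit_cell_code // (negbTE (critical_tree cr)).
  by move=> [//|[_ lt]]; have := leq_ltn_trans (hr e el) lt; rewrite ltnn.
have [ee vw] := crit_cell_inj (cl e el) cr ow ov ew.
by case: hv => [|/negP]; [rewrite -vw ltNge aw|rewrite -ee].
Qed.

(** Annuli are pushed out by decreasing rank. The outer sphere of an annulus lies in the matched
    part or in critical cells of smaller rank, and there it stays off the central cubes, that is, in
    the annuli that are left. *)
Lemma punctured_contractible l : uniq l -> (forall c, c \in l -> critical c) ->
  (forall c e, c \in l -> critical e -> (code_rank N e < code_rank N c)%N -> e \in l) ->
  contractible_to R (punctured l) (origin R N).
Proof.
have [a0 a1] := andP a01.
have [n] := ubnP (size l); elim: n l => // n IH l sl ul cl dl.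
have [l0|l0] := eqVneq l [::].
  rewrite l0 (_ : punctured [::] = complex (tree lows)); first by case: (tree_contractible R lows_initial).
  by apply/seteqP; split=> x; [move=> [//|[]]|left].
have [c cc cmax] := argmax_mem (code_rank N) l0.
set l' := rem c l; have pl : perm_eq l (c :: l') := perm_to_rem cc.
have ul' : uniq l' by exact: rem_uniq.
have cl' : c \notin l' by rewrite mem_rem_uniqF.
have l'l e : e \in l' -> e \in l by move=> h; rewrite (perm_mem pl) inE h orbT.
have cr := cl c cc; have crl' e : e \in l' -> critical e by move=> /l'l /cl.
have below e : critical e -> (code_rank N e < code_rank N c)%N -> e \in l'.
  move=> cre lt; have := dl c e cc cre lt; rewrite (perm_mem pl) inE => /orP[/eqP ee|//].
  by move: lt; rewrite ee ltnn.
have cont' : contractible_to R (punctured l') (origin R N).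
  apply: IH => //; first by move: sl; rewrite (perm_size pl) /= ltnS.
  move=> c' e c'l' cre lt; apply: below => //; apply: leq_trans lt _; exact/cmax/l'l.
have eP : punctured l = punctured l' `|` crit_cell c @` annulus N a.
  apply/seteqP; split=> x.
    move=> [h|[e el h]]; first by left; left.
    by move: el; rewrite (perm_mem pl) inE => /orP[/eqP ee|el]; [right; rewrite -ee|left; right; exists e].
  move=> [[h|[e el h]]|h]; [by left|by right; exists e => //; exact: l'l|by right; exists c].
apply: (deforms_trans (B := punctured l')) => //; first exact: punctured_closed.
  by rewrite eP; exact: subsetUl.
rewrite eP; apply: puncture_deform => //; split.
- by apply: clc_sub (crit_cell_clc cr); [exact: annulus_closed|move=> w []].
- exact: annulus_compact.
- exact: punctured_closed.
- by move=> w [cw ew]; split=> //; rewrite ew ltW.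
split.
- move=> w sw; have [h|[cre lt]] := crit_boundary cr sw; first by left.
  right; exists (code (crit_cell c w)); first exact: below.
  have [v ov e] := crit_cell_onto cre; exists v => //; have [cv _] := ov; split=> //.
  rewrite leNgt; apply/negP => va; exact: (a_avoids cre cr cv (ltW va) sw e).
- move=> v [cv av] nsv; have [//|ov] := cubeVP cv.
  apply: open_not_punctured => //; last by right.
  by left => e /l'l; exact: cmax.
- move=> v w [cv _] [cw _] sv sw; have [//|ov] := cubeVP cv; have [//|ow] := cubeVP cw.
  by move=> /(crit_cell_inj cr cr ov ow) [].
Qed.

End Punctured.

(** The attached cells are the central cubes of radius [a], rescaled by [shrink]; their boundaries
    lie in the punctured space, which is contractible. Whole critical cells would not do, since
    their boundaries may run through one another. *)
Lemma tiling_space_wedge : exists k, homotopy_equivalent R T (wedge_of_spheres R N k).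
Proof.
have [a /[dup] a01 /andP[a0 a1] av] := common_radius.
exists (size crits); pose crit (i : 'I_(size crits)) := nth [::] crits i.
have critP i : critical (crit i) by rewrite -crits_mem mem_nth.
pose shrink (v : W) : W := fun k => a * v k.
have supS v : sup (shrink v) = a * sup v by rewrite /shrink supnormZ // ltW.
have cubeS v : cube N v -> cube N (shrink v).
  move=> /cubeP [h1 h2]; apply: cubeZ => //; first exact: ltW.
  by rewrite mulr_ile1 // ?supnorm_ge0 // ltW.
have openS v : open_cube N v -> open_cube N (shrink v).
  move=> [cv lt]; split; first exact: cubeS.
  rewrite supS; apply: le_lt_trans lt; rewrite -[leRHS]mul1r.
  by apply: ler_wpM2r; [exact: supnorm_ge0|exact: ltW].
have mem_crits c : c \in crits -> critical c by rewrite crits_mem.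
pose Y := punctured a crits.
apply: (@collapse_contractible R T N (size crits) hT tiling_space_compact Y (origin R N)
  (fun i => crit_cell (crit i) \o shrink)).
- exact: punctured_closed.
- apply: punctured_contractible => //; first exact: undup_uniq.
  by move=> c e _ cre _; rewrite crits_mem.
- move=> i; apply: clc_comp (crit_cell_clc (critP i)) cubeS.
  apply: continuous_clc; first exact: cube_closed.
  apply: continuous_seqspace => k; apply: continuous_mul; [exact: continuous_const|exact: continuous_coord].
- move=> i v [cv v1]; right; exists (crit i); first by rewrite mem_nth.
  by exists (shrink v) => //; split; [exact: cubeS|rewrite supS v1 mulr1].
- move=> i v ov; have lt : sup (shrink v) < a.
    by case: ov => _ h; rewrite supS -[ltRHS]mulr1 ltr_pM2l.
  by apply: (open_not_punctured av (critP i) (openS v ov)) => //; [right; exact: ltW|left].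
- move=> i j v w ov ow /= /(crit_cell_inj (critP i) (critP j) (openS v ov) (openS w ow)) [ij vw]; split.
    by apply/val_inj/eqP; rewrite -(nth_uniq [::] (ltn_ord i) (ltn_ord j) (undup_uniq _)); exact/eqP.
  apply/funext => k; have := congr1 (fun f : W => f k) vw; rewrite /shrink.
  by apply: mulfI; rewrite gt_eqF.
- by left; rewrite /complex /= code_origin; apply/mem_tree; left.
move=> x; have [oke _] := code_spec x; have [h|cr] := code_cases oke; first by left; left.
have [v ov e] := crit_cell_onto cr; have [cv _] := ov.
have [va|va] := leP a (sup v).
  by left; right; exists (code x); [rewrite crits_mem|exists v].
right; have ci : (index (code x) crits < size crits)%N by rewrite index_mem crits_mem.
exists (Ordinal ci), (fun k => a^-1 * v k); split.
  apply: cubeZ; first by rewrite invr_ge0 ltW.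
    by rewrite mulrC ler_pdivrMr // mul1r ltW.
  by case: cv.
rewrite /= /crit /= nth_index ?crits_mem // -[RHS]e; congr crit_cell.
by apply/funext => k; rewrite /shrink mulrA divff ?mul1r // gt_eqF.
Qed.

End CriticalCells.
Theorem theorem1 (R : realType) (n : nat) (hn : (1 <= n)%N) :
  exists k : nat,
    homotopy_equivalent R (tiling_space R n) (wedge_of_spheres R n.-1 k).
Proof. by case: n hn => // N _; exact: tiling_space_wedge. Qed.
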